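(* Let $D\geq 1$ be an odd square-free integer. There exists $K_0=K_0(D)$ such that for every even integer $K\geq K_0$ the following holds: if $\ell$ is an integer with $3\leq \ell\leq\frac{K-2}{2}$ and $\chi_1,\dots,\chi_n$ are primitive Dirichlet characters mod $D$ such that $\chi_i(-1)=(-1)^{\ell}$ for all $i$ and the values $\chi_1(2),\dots,\chi_n(2)$ are pairwise distinct, then the twisted periods $r_{\ell-1,\chi_1},\dots,r_{\ell-1,\chi_n}$, viewed as elements of $\mathrm{Hom}_{\mathbb{C}}(S_K,\mathbb{C})$, are linearly independent over $\mathbb{C}$.
   Context: $S_K$ is the space of cusp forms of weight $K$ for $\mathrm{SL}_2(\mathbb{Z})$, $q=e^{2\pi i z}$. For $f(z)=\sum_{n\ge1}a_f(n)q^n\in S_K$ and a Dirichlet character $\chi$, put $f_\chi(z)=\sum_{n\geq1}\chi(n)a_f(n)q^n$ and $L(f,\chi,s)=\sum_{n\ge1}\chi(n)a_f(n)n^{-s}$ (analytically continued to $\mathbb{C}$). For a primitive Dirichlet character $\chi$ mod $D$ and $0\leq m\leq K-2$, the $m$-th twisted period is the linear functional on $S_K$ given by $r_{m,\chi}(f)=\int_0^{i\infty}f_\chi(z)z^m\,dz=\frac{m!}{(-2\pi i)^{m+1}}L(f,\chi,m+1)$. *)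

(* Defs.v *)
From Stdlib Require Import Reals ZArith.
From Coquelicot Require Import Coquelicot.

Local Open Scope C_scope.

Definition ZtoC (a : Z) : C := RtoC (IZR a).

Definition Cexp (z : C) : C :=
  RtoC (exp (Re z)) * (cos (Im z), sin (Im z)).

Definition qpar (z : C) : C := Cexp (RtoC (2 * PI) * Ci * z).

(* Coquelicot's [Series] is real valued, hence the componentwise sum. *)
Definition CSeries (u : nat -> C) : C :=
  (Series (fun n => Re (u n)), Series (fun n => Im (u n))).

Definition squarefree (D : nat) : Prop :=
  forall d : nat, Nat.divide (d * d) D -> d = 1%nat.

(* Characters are extended by 0 to integers not coprime to the modulus;
   [chi 1 = 1] follows from [dc_mul] and [dc_unit]. *)
Record dirichlet_char (D : nat) (chi : Z -> C) : Prop := {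
  dc_periodic : forall n : Z, chi (n + Z.of_nat D)%Z = chi n;
  dc_mul : forall m n : Z, chi (m * n)%Z = chi m * chi n;
  dc_unit : forall n : Z, chi n <> 0 <-> Z.gcd n (Z.of_nat D) = 1%Z
}.

Definition induced_from (D : nat) (chi : Z -> C) (d : nat) : Prop :=
  exists psi : Z -> C, dirichlet_char d psi /\
    forall n : Z, Z.gcd n (Z.of_nat D) = 1%Z -> chi n = psi n.

Definition primitive_char (D : nat) (chi : Z -> C) : Prop :=
  dirichlet_char D chi /\
  forall d : nat, Nat.divide d D -> (d < D)%nat -> ~ induced_from D chi d.

(* Elements of S_K.  A form is a function on the upper half-plane; the values
   of [cf_fun] elsewhere are arbitrary and never used.  The coefficients a_f(n)
   are determined by the restriction of [cf_fun] to the upper half-plane, so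
   carrying them in the record adds no data.  Holomorphy at the cusp and
   vanishing there are expressed by the expansion having no terms of
   exponent n <= 0. *)
Record cusp_form (K : nat) := {
  cf_fun :> C -> C;
  cf_coef : nat -> C;
  cf_holo : forall z : C, (0 < Im z)%R ->
    ex_derive (K := C_AbsRing) (V := C_NormedModule) cf_fun z;
  cf_modular : forall a b c d : Z, (a * d - b * c = 1)%Z ->
    forall z : C, (0 < Im z)%R ->
    cf_fun ((ZtoC a * z + ZtoC b) / (ZtoC c * z + ZtoC d)) =
    (ZtoC c * z + ZtoC d) ^ K * cf_fun z;
  cf_coef0 : cf_coef 0%nat = 0;
  cf_qexp : forall z : C, (0 < Im z)%R ->
    is_series (K := C_AbsRing) (V := C_NormedModule)
      (fun n : nat => cf_coef n * qpar z ^ n) (cf_fun z)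
}.

Arguments cf_fun {K} _ _.
Arguments cf_coef {K} _ _.

(* f_chi; the n = 0 term vanishes because a_f(0) = 0. *)
Definition twist {K : nat} (chi : Z -> C) (f : cusp_form K) (z : C) : C :=
  CSeries (fun n : nat => chi (Z.of_nat n) * cf_coef f n * qpar z ^ n).

(* The integral from 0 to i*oo of f_chi(z) z^m dz, along z = i t with
   dz = i dt; improper at both ends. *)
Definition twisted_period {K : nat} (m : nat) (chi : Z -> C)
    (f : cusp_form K) : C :=
  RInt_gen (V := C_R_CompleteNormedModule)
    (fun t : R => twist chi f (Ci * RtoC t) * (Ci * RtoC t) ^ m * Ci)
    (at_right 0%R) (Rbar_locally p_infty).

(* Linear independence over C of phi_1, ..., phi_n in the space of all functions
   T -> C.  For T = S_K this space contains Hom_C(S_K, C) as a subspace, so for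
   linear functionals it is linear independence in Hom_C(S_K, C). *)
Definition lin_indep {T : Type} (n : nat) (phi : nat -> T -> C) : Prop :=
  forall c : nat -> C,
    (forall f : T,
       sum_n_m (G := C_AbelianMonoid) (fun i => c i * phi i f) 1 n = RtoC 0) ->
    forall i : nat, (1 <= i <= n)%nat -> c i = 0.

(* Main.v *)
Require Import Defs.
From Stdlib Require Import Reals ZArith Znumtheory List Lra Lia Permutation ClassicalEpsilon.
From Coquelicot Require Import Coquelicot.
Import ListNotations.
Local Open Scope R_scope.

(** The relation is tested on the cusp forms
      f_tau(z) = sum over (a b; c d) in SL_2(Z) of (a z + b + tau (c z + d))^(-K),  Im tau > 0.
    Write l for [ell].  Put p = a + c tau and q = b + d tau; these terms are (p z + q)^(-K).
    Grouping the sum by translations and applying Lipschitz's formula gives the q-expansion.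
    A primitive chi mod D is sum_r chi^(r) e(n r / D), so the twisted period is a combination of
    integrals of f_tau along the vertical lines over r / D; these are Beta integrals, with value
    a nonzero constant times
      S_r(tau) = sum of p^(-l) w^(-(K-l)),  w = r p + D q.
    In S_r the terms with w = 1 or -1 (as polynomials in tau) give, again by Lipschitz's formula,
    a multiple of sum_n n^(l-1) e(-n r* / D) e(n tau), where r r* = 1 mod D; all other terms are
    small high up in the upper half-plane.  A relation with coefficients c_i therefore forces
    the coefficients sum_i c_i chi_i^(1)^2 / chi_i(n) of the main terms to be at most epsilon
    times sum_i |c_i chi_i^(1)|, provided the height is chosen close to (l-1) / (2 pi n).
    For n = 2^j with 0 <= j < N, where 2^N = 1 mod D, the numbers chi_i(2) are distinct N-th roots
    of unity and orthogonality isolates each c_i; for K large this gives c_i = 0. *)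

(** * Unconditional sums *)

(** The estimate must be uniform in l from 3 up to (K-2)/2. At height Y the m-th coefficient of the
    main terms carries m^(l-1) e^(-2 pi m Y) (2 pi)^l / (l-1)!, largest at Y0 = (l-1)/(2 pi m),
    where Stirling makes it comparable with Y0^(-(l-1)) up to a factor linear in l. The other terms
    are of order Y^(-(K-l-1)), so the gain is about Y^(-(K-2l)), and the upper bound on l makes this
    exponent at least 2. For l near K/2 the exponent is small and smallness comes from Y0 growing
    with l; for l small, Y0 may be below 1 and smallness must come from the exponent, which requires
    Y to stay away from 1. The height Y = Y0 + 2D serves both ranges: the shift costs a factor
    bounded in terms of D, since m is at most 2^N, and 2D also absorbs the powers of D. The sums run
    over matrices and are arranged in several ways: by first column, by translation classes, by the
    pair (p, w). They are therefore taken over finite subsets without any order, with terms extended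
    by 0 off determinant one. *)

Definition eqd {I : Type} (x y : I) : {x = y} + {x <> y} :=
  excluded_middle_informative (x = y).

Fixpoint lsum {I : Type} (f : I -> C) (l : list I) : C :=
  match l with nil => RtoC 0 | i :: l' => Cplus (f i) (lsum f l') end.

Fixpoint rsum {I : Type} (f : I -> R) (l : list I) : R :=
  match l with nil => 0 | i :: l' => f i + rsum f l' end.

(** Convergence along the net of finite subsets of the index set, a subset being a duplicate-free
    list. No enumeration is chosen, so reindexing and exchange of sums need no ordering
    conventions. *)
Definition has_sum {I : Type} (f : I -> C) (s : C) : Prop :=
  forall eps : R, 0 < eps -> exists l0 : list I, forall l : list I,
    NoDup l -> incl l0 l -> Cmod (lsum f l - s)%C < eps.

(** Absolute summability in quantitative form: an explicit majorant of all finite partial sums, with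
    no value attached to the sum itself. *)
Definition sum_le {I : Type} (f : I -> R) (M : R) : Prop :=
  forall l : list I, NoDup l -> rsum f l <= M.

Section FiniteSums.
Context {I : Type}.
Implicit Types (f g : I -> C) (l : list I).

Lemma lsum_app f l1 l2 : lsum f (l1 ++ l2) = (lsum f l1 + lsum f l2)%C.
Proof. induction l1 as [|i l1 IH]; simpl; [ring | rewrite IH; ring]. Qed.

Lemma rsum_app (f : I -> R) l1 l2 : rsum f (l1 ++ l2) = rsum f l1 + rsum f l2.
Proof. induction l1 as [|i l1 IH]; simpl; [ring | rewrite IH; ring]. Qed.

Lemma lsum_perm f l1 l2 : Permutation l1 l2 -> lsum f l1 = lsum f l2.
Proof.
  induction 1; simpl; try congruence; ring.
Qed.

Lemma rsum_perm (f : I -> R) l1 l2 : Permutation l1 l2 -> rsum f l1 = rsum f l2.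
Proof. induction 1; simpl; try congruence; ring. Qed.

Lemma lsum_ext f g l : (forall i, In i l -> f i = g i) -> lsum f l = lsum g l.
Proof.
  induction l as [|i l IH]; simpl; intros H; [reflexivity|].
  rewrite H by auto. rewrite IH; auto.
Qed.

Lemma rsum_le (f g : I -> R) l :
  (forall i, In i l -> f i <= g i) -> rsum f l <= rsum g l.
Proof.
  induction l as [|i l IH]; simpl; intros H; [lra|].
  assert (f i <= g i) by auto. assert (rsum f l <= rsum g l) by auto. lra.
Qed.

Lemma rsum_const (c : R) l : rsum (fun _ => c) l = INR (length l) * c.
Proof. induction l as [|i l IH]; [simpl; ring|].
  change (c + rsum (fun _ => c) l = INR (S (length l)) * c). rewrite IH, S_INR; ring. Qed.

Lemma rsum_nonneg (f : I -> R) l : (forall i, 0 <= f i) -> 0 <= rsum f l.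
Proof. intros H; induction l as [|i l IH]; simpl; [lra|]. specialize (H i); lra. Qed.

Lemma Cmod_lsum f l : Cmod (lsum f l) <= rsum (fun i => Cmod (f i)) l.
Proof.
  induction l as [|i l IH]; simpl; [rewrite Cmod_0; lra|].
  eapply Rle_trans; [apply Cmod_triangle|lra].
Qed.

Lemma lsum_plus f g l : lsum (fun i => f i + g i)%C l = (lsum f l + lsum g l)%C.
Proof. induction l as [|i l IH]; simpl; [ring|]. rewrite IH; ring. Qed.

Lemma lsum_scal (c : C) f l : lsum (fun i => c * f i)%C l = (c * lsum f l)%C.
Proof. induction l as [|i l IH]; simpl; [ring|]. rewrite IH; ring. Qed.

Lemma lsum_minus f g l : lsum (fun i => f i - g i)%C l = (lsum f l - lsum g l)%C.
Proof. induction l as [|i l IH]; simpl; [ring|]. rewrite IH; ring. Qed.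

Lemma rsum_scal (c : R) (f : I -> R) l : rsum (fun i => c * f i) l = c * rsum f l.
Proof. induction l as [|i l IH]; simpl; [ring|]. rewrite IH; ring. Qed.

Lemma rsum_plus (f g : I -> R) l : rsum (fun i => f i + g i) l = rsum f l + rsum g l.
Proof. induction l as [|i l IH]; simpl; [ring|]. rewrite IH; ring. Qed.

Lemma lsum_zero f l : (forall i, In i l -> f i = RtoC 0) -> lsum f l = RtoC 0.
Proof.
  induction l as [|i l IH]; simpl; intros H; [reflexivity|].
  rewrite H by auto. rewrite IH by auto. ring.
Qed.

Lemma lsum_const (c : C) l : lsum (fun _ => c) l = (RtoC (INR (length l)) * c)%C.
Proof. induction l as [|i l IH]; [simpl; ring|].
  change (c + lsum (fun _ => c) l = RtoC (INR (S (length l))) * c)%C.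
  rewrite IH, S_INR, RtoC_plus; ring. Qed.

Definition ldiff l l0 : list I :=
  filter (fun i => if in_dec eqd i l0 then false else true) l.

Lemma in_ldiff l l0 i : In i (ldiff l l0) <-> In i l /\ ~ In i l0.
Proof.
  unfold ldiff. rewrite filter_In. destruct (in_dec eqd i l0); intuition congruence.
Qed.

Lemma NoDup_ldiff l l0 : NoDup l -> NoDup (ldiff l l0).
Proof. apply NoDup_filter. Qed.

Lemma ldiff_perm l l0 :
  NoDup l -> NoDup l0 -> incl l0 l -> Permutation l (l0 ++ ldiff l l0).
Proof.
  intros Hl Hl0 Hi. apply NoDup_Permutation; auto.
  - apply NoDup_app; auto using NoDup_ldiff.
    intros i H1 H2. apply in_ldiff in H2. tauto.
  - intros i. rewrite in_app_iff, in_ldiff. split.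
    + intros H. destruct (in_dec eqd i l0); auto.
    + intros [H|H]; [apply Hi; auto | tauto].
Qed.

Definition lunion l1 l2 : list I := nodup eqd (l1 ++ l2).

Lemma NoDup_lunion l1 l2 : NoDup (lunion l1 l2).
Proof. apply NoDup_nodup. Qed.

Lemma incl_lunion_l l1 l2 : incl l1 (lunion l1 l2).
Proof. intros i H. apply nodup_In, in_or_app; auto. Qed.

Lemma incl_lunion_r l1 l2 : incl l2 (lunion l1 l2).
Proof. intros i H. apply nodup_In, in_or_app; auto. Qed.

End FiniteSums.

Lemma lsum_map {I J : Type} (h : I -> J) (f : J -> C) (l : list I) :
  lsum f (map h l) = lsum (fun i => f (h i)) l.
Proof. induction l as [|i l IH]; simpl; [reflexivity|]. now rewrite IH. Qed.

Lemma rsum_map {I J : Type} (h : I -> J) (f : J -> R) (l : list I) :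
  rsum f (map h l) = rsum (fun i => f (h i)) l.
Proof. induction l as [|i l IH]; simpl; [reflexivity|]. now rewrite IH. Qed.

Lemma lsum_swap {I J : Type} (f : I -> J -> C) (l : list I) (m : list J) :
  lsum (fun i => lsum (f i) m) l = lsum (fun j => lsum (fun i => f i j) l) m.
Proof.
  induction l as [|i l IH]; simpl.
  - now rewrite lsum_zero.
  - now rewrite IH, lsum_plus.
Qed.

Lemma lsum_prod {I J : Type} (f : I * J -> C) (l : list I) (m : list J) :
  lsum f (list_prod l m) = lsum (fun i => lsum (fun j => f (i, j)) m) l.
Proof.
  induction l as [|i l IH]; simpl; [reflexivity|].
  now rewrite lsum_app, IH, lsum_map.
Qed.

Lemma rsum_prod {I J : Type} (f : I * J -> R) (l : list I) (m : list J) :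
  rsum f (list_prod l m) = rsum (fun i => rsum (fun j => f (i, j)) m) l.
Proof.
  induction l as [|i l IH]; simpl; [reflexivity|].
  now rewrite rsum_app, IH, rsum_map.
Qed.

Lemma NoDup_list_prod {I J : Type} (l : list I) (m : list J) :
  NoDup l -> NoDup m -> NoDup (list_prod l m).
Proof.
  intros Hl Hm. induction Hl as [|i l Hi Hl IH]; simpl; [constructor|].
  apply NoDup_app; auto.
  - apply FinFun.Injective_map_NoDup; auto. intros x y H; congruence.
  - intros [a b] H1 H2. apply in_map_iff in H1. destruct H1 as [x [E _]].
    inversion E; subst. apply in_prod_iff in H2. tauto.
Qed.

Section Sums.
Context {I : Type}.
Implicit Types (f g : I -> C).

Lemma has_sum_unique f s t : has_sum f s -> has_sum f t -> s = t.
Proof.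
  intros Hs Ht.
  destruct (Req_dec (Cmod (s - t)%C) 0) as [E|E].
  - apply Cmod_eq_0 in E. replace s with (s - t + t)%C by ring. rewrite E. ring.
  - pose proof (Cmod_ge_0 (s - t)%C).
    destruct (Hs (Cmod (s - t)%C / 2)) as [l0 H0]; [lra|].
    destruct (Ht (Cmod (s - t)%C / 2)) as [l1 H1]; [lra|].
    specialize (H0 (lunion l0 l1) (NoDup_lunion _ _) (incl_lunion_l _ _)).
    specialize (H1 (lunion l0 l1) (NoDup_lunion _ _) (incl_lunion_r _ _)).
    set (u := lsum f (lunion l0 l1)) in *.
    assert (Cmod (s - t)%C <= Cmod (u - t)%C + Cmod (u - s)%C); [|lra].
    replace (s - t)%C with ((u - t) + - (u - s))%C by ring.
    eapply Rle_trans; [apply Cmod_triangle|]. rewrite Cmod_opp; lra.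
Qed.

Lemma has_sum_ext f g s : (forall i, f i = g i) -> has_sum f s -> has_sum g s.
Proof.
  intros E H eps He. destruct (H eps He) as [l0 H0]. exists l0. intros l Hl Hi.
  rewrite <- (lsum_ext f g); auto.
Qed.

Lemma has_sum_plus f g s t :
  has_sum f s -> has_sum g t -> has_sum (fun i => f i + g i)%C (s + t)%C.
Proof.
  intros Hs Ht eps He.
  destruct (Hs (eps / 2)) as [l0 H0]; [lra|].
  destruct (Ht (eps / 2)) as [l1 H1]; [lra|].
  exists (l0 ++ l1). intros l Hl Hi.
  apply incl_app_inv in Hi. destruct Hi as [Hi0 Hi1].
  specialize (H0 l Hl Hi0). specialize (H1 l Hl Hi1).
  rewrite lsum_plus.
  replace (lsum f l + lsum g l - (s + t))%C with ((lsum f l - s) + (lsum g l - t))%C by ring.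
  eapply Rle_lt_trans; [apply Cmod_triangle|]. lra.
Qed.

Lemma has_sum_scal (c : C) f s : has_sum f s -> has_sum (fun i => c * f i)%C (c * s)%C.
Proof.
  intros Hs eps He. pose proof (Cmod_ge_0 c).
  destruct (Hs (eps / (Cmod c + 1))) as [l0 H0]; [apply Rdiv_lt_0_compat; lra|].
  exists l0. intros l Hl Hi. specialize (H0 l Hl Hi).
  rewrite lsum_scal. replace (c * lsum f l - c * s)%C with (c * (lsum f l - s))%C by ring.
  rewrite Cmod_mult.
  apply Rle_lt_trans with ((Cmod c) * (eps / (Cmod c + 1))).
  - apply Rmult_le_compat_l; lra.
  - replace (Cmod c * (eps / (Cmod c + 1))) with (eps * (Cmod c / (Cmod c + 1))) by (field; lra).
    rewrite <- (Rmult_1_r eps) at 2. apply Rmult_lt_compat_l; auto.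
    apply Rmult_lt_reg_r with (Cmod c + 1); [lra|]. field_simplify; lra.
Qed.

Lemma has_sum_zero : has_sum (fun _ : I => RtoC 0) (RtoC 0).
Proof.
  intros eps He. exists nil. intros l _ _. rewrite lsum_zero by auto.
  replace (RtoC 0 - RtoC 0)%C with (RtoC 0) by ring. rewrite Cmod_0; auto.
Qed.

Lemma has_sum_lsum {J : Type} (f : J -> I -> C) (s : J -> C) (m : list J) :
  (forall j, In j m -> has_sum (f j) (s j)) ->
  has_sum (fun i => lsum (fun j => f j i) m) (lsum s m).
Proof.
  induction m as [|j m IH]; intros H; simpl.
  - apply has_sum_zero.
  - apply has_sum_plus; [apply H; left; auto | apply IH; intros; apply H; right; auto].
Qed.

Lemma has_sum_finite f (l0 : list I) :
  NoDup l0 -> (forall i, ~ In i l0 -> f i = RtoC 0) -> has_sum f (lsum f l0).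
Proof.
  intros H0 Hz eps He. exists l0. intros l Hl Hi.
  rewrite (lsum_perm f l (l0 ++ ldiff l l0)) by (apply ldiff_perm; auto).
  rewrite lsum_app, (lsum_zero f (ldiff l l0)).
  - replace (lsum f l0 + RtoC 0 - lsum f l0)%C with (RtoC 0) by ring.
    rewrite Cmod_0; auto.
  - intros i Hin. apply in_ldiff in Hin. apply Hz; tauto.
Qed.

Lemma has_sum_bound f s M : sum_le (fun i => Cmod (f i)) M -> has_sum f s -> Cmod s <= M.
Proof.
  intros HM Hs. apply Rnot_lt_le. intros Hlt.
  destruct (Hs (Cmod s - M)) as [l0 H0]; [lra|].
  specialize (H0 (nodup eqd l0) (NoDup_nodup _ _)).
  assert (Hi : incl l0 (nodup eqd l0)) by (intros i; apply nodup_In).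
  specialize (H0 Hi). specialize (HM (nodup eqd l0) (NoDup_nodup _ _)).
  pose proof (Cmod_lsum f (nodup eqd l0)).
  set (u := lsum f (nodup eqd l0)) in *.
  assert (Cmod s <= Cmod u + Cmod (u - s)%C); [|lra].
  replace s with (u + - (u - s))%C at 1 by ring.
  eapply Rle_trans; [apply Cmod_triangle|]. rewrite Cmod_opp; lra.
Qed.

(** A finite subset whose sum is within [eps] of the supremum leaves at most [eps] for every finite
    subset disjoint from it. *)
Lemma sum_le_tail (m : I -> R) M :
  (forall i, 0 <= m i) -> sum_le m M -> forall eps, 0 < eps ->
  exists l0, NoDup l0 /\ forall l, NoDup l -> (forall i, In i l -> ~ In i l0) -> rsum m l <= eps.
Proof.
  intros Hm HM eps He.
  destruct (completeness (fun x => exists l, NoDup l /\ x = rsum m l)) as [S [Hub Hlub]].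
  - exists M. intros x [l [Hl ->]]. auto.
  - exists 0, nil. split; [constructor | reflexivity].
  - destruct (classic (exists l0, NoDup l0 /\ S - eps < rsum m l0)) as [[l0 [H0 H1]]|Hn].
    + exists l0. split; auto. intros l Hl Hd.
      assert (rsum m (l0 ++ l) <= S).
      { apply Hub. exists (l0 ++ l). split; auto. apply NoDup_app; auto.
        intros i Hi Hi'. exact (Hd i Hi' Hi). }
      rewrite rsum_app in H. lra.
    + exfalso. assert (S <= S - eps); [|lra].
      apply Hlub. intros x [l [Hl ->]]. apply Rnot_lt_le. intros Hlt. apply Hn. eauto.
Qed.

Lemma has_sum_nonneg (m : I -> R) M :
  (forall i, 0 <= m i) -> sum_le m M -> exists s : R, has_sum (fun i => RtoC (m i)) (RtoC s).
Proof.
  intros Hm HM.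
  destruct (completeness (fun x => exists l, NoDup l /\ x = rsum m l)) as [S [Hub Hlub]].
  - exists M. intros x [l [Hl ->]]. auto.
  - exists 0, nil. split; [constructor | reflexivity].
  - exists S. intros eps He.
    destruct (classic (exists l0, NoDup l0 /\ S - eps < rsum m l0)) as [[l0 [H0 H1]]|Hn].
    + exists l0. intros l Hl Hi.
      assert (E : lsum (fun i => RtoC (m i)) l = RtoC (rsum m l)).
      { clear. induction l as [|i l IH]; simpl; [reflexivity|].
        now rewrite IH, RtoC_plus. }
      rewrite E, <- RtoC_minus, Cmod_R.
      assert (rsum m l <= S) by (apply Hub; eauto).
      rewrite (rsum_perm m l (l0 ++ ldiff l l0)) in * by (apply ldiff_perm; auto).
      rewrite rsum_app in *. pose proof (rsum_nonneg m (ldiff l l0) Hm).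
      rewrite Rabs_left1; lra.
    + exfalso. assert (S <= S - eps); [|lra].
      apply Hlub. intros x [l [Hl ->]]. apply Rnot_lt_le. intros Hlt. apply Hn. eauto.
Qed.

Lemma sum_le_mono (m m' : I -> R) M :
  (forall i, m i <= m' i) -> sum_le m' M -> sum_le m M.
Proof.
  intros H HM l Hl. eapply Rle_trans; [apply rsum_le; intros; apply H | auto].
Qed.

Lemma sum_le_scal (c : R) (m : I -> R) M :
  0 <= c -> sum_le m M -> sum_le (fun i => c * m i) (c * M).
Proof. intros Hc HM l Hl. rewrite rsum_scal. apply Rmult_le_compat_l; auto. Qed.

Lemma sum_le_plus (m m' : I -> R) M M' :
  sum_le m M -> sum_le m' M' -> sum_le (fun i => m i + m' i) (M + M').
Proof. intros H H' l Hl. rewrite rsum_plus. specialize (H l Hl). specialize (H' l Hl). lra. Qed.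

(** A real family u dominated by |f| is the difference of the nonnegative families |f| + u and |f|,
    each summable by completeness. This is applied to the real and imaginary parts. *)
Lemma has_sum_ex f M : sum_le (fun i => Cmod (f i)) M -> exists s, has_sum f s.
Proof.
  intros HM.
  assert (P : forall u : I -> R, (forall i, Rabs (u i) <= Cmod (f i)) ->
     exists s : R, has_sum (fun i => RtoC (u i)) (RtoC s)).
  { intros u Hu.
    destruct (has_sum_nonneg (fun i => Cmod (f i)) M) as [s1 H1]; auto using Cmod_ge_0.
    destruct (has_sum_nonneg (fun i => Cmod (f i) + u i) (2 * M)) as [s2 H2].
    - intros i. specialize (Hu i). apply Rabs_le_between in Hu. lra.
    - apply sum_le_mono with (fun i => 2 * Cmod (f i)).
      + intros i. specialize (Hu i). apply Rabs_le_between in Hu. lra.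
      + apply sum_le_scal; [lra | auto].
    - exists (s2 + -1 * s1).
      apply has_sum_ext with
        (fun i => RtoC (Cmod (f i) + u i) + RtoC (-1) * RtoC (Cmod (f i)))%C.
      + intros i. rewrite <- RtoC_mult, <- RtoC_plus. f_equal. ring.
      + rewrite RtoC_plus, RtoC_mult. apply has_sum_plus; auto. apply has_sum_scal; auto. }
  destruct (P (fun i => Re (f i))) as [s1 H1].
  { intros i. apply re_le_Cmod. }
  destruct (P (fun i => Im (f i))) as [s2 H2].
  { intros i. eapply Rle_trans; [apply Rmax_r | apply Rmax_Cmod]. }
  exists (RtoC s1 + Ci * RtoC s2)%C.
  apply has_sum_ext with (fun i => RtoC (Re (f i)) + Ci * RtoC (Im (f i)))%C.
  - intros i. destruct (f i) as [x y]. unfold RtoC, Ci, Cplus, Cmult; simpl. f_equal; ring.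
  - apply has_sum_plus; auto. apply has_sum_scal; auto.
Qed.

(** The tail is measured by the majorant [m], so the estimate is uniform over all families that [m]
    dominates. *)
Lemma has_sum_tail f s (m : I -> R) (l0 : list I) eps :
  (forall i, Cmod (f i) <= m i) -> NoDup l0 ->
  (forall l, NoDup l -> (forall i, In i l -> ~ In i l0) -> rsum m l <= eps) ->
  has_sum f s -> Cmod (lsum f l0 - s)%C <= eps.
Proof.
  intros Hf H0 Ht Hs. apply Rnot_lt_le. intros Hlt.
  destruct (Hs (Cmod (lsum f l0 - s)%C - eps)) as [l1 H1]; [lra|].
  specialize (H1 (lunion l0 l1) (NoDup_lunion _ _) (incl_lunion_r _ _)).
  rewrite (lsum_perm f _ _ (ldiff_perm _ _ (NoDup_lunion l0 l1) H0 (incl_lunion_l _ _))) in H1.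
  rewrite lsum_app in H1.
  set (d := ldiff (lunion l0 l1) l0) in *.
  assert (Hd : Cmod (lsum f d) <= eps).
  { eapply Rle_trans; [apply Cmod_lsum|].
    eapply Rle_trans; [apply rsum_le; intros; apply Hf|].
    apply Ht; [apply NoDup_ldiff, NoDup_lunion|]. intros i Hi. apply in_ldiff in Hi. tauto. }
  assert (Cmod (lsum f l0 - s)%C <= Cmod (lsum f l0 + lsum f d - s)%C + Cmod (lsum f d)); [|lra].
  replace (lsum f l0 - s)%C with ((lsum f l0 + lsum f d - s) + - lsum f d)%C by ring.
  eapply Rle_trans; [apply Cmod_triangle|]. rewrite Cmod_opp; lra.
Qed.

(** Dominated convergence for series, along an arbitrary filter. It gives the limit over N in
    Lipschitz's formula and the limits at both ends of the period integrals. *)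
Lemma Tannery {U : Type} (F : (U -> Prop) -> Prop) (FF : Filter F)
  (f : U -> I -> C) (sf : U -> C) (g : I -> C) (sg : C) (m : I -> R) (M : R) :
  sum_le m M -> (forall i, Cmod (g i) <= m i) ->
  F (fun x => forall i, Cmod (f x i) <= m i) ->
  F (fun x => has_sum (f x) (sf x)) -> has_sum g sg ->
  (forall i eps, 0 < eps -> F (fun x => Cmod (f x i - g i)%C < eps)) ->
  forall eps, 0 < eps -> F (fun x => Cmod (sf x - sg)%C < eps).
Proof.
  intros HM Hg Hf Hsf Hsg Hlim eps He.
  assert (Hm : forall i, 0 <= m i).
  { intros i. eapply Rle_trans; [apply Cmod_ge_0 | apply Hg]. }
  destruct (sum_le_tail m M Hm HM (eps / 4)) as [l0 [H0 Ht]]; [lra|].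
  assert (Hfin : forall l d, 0 < d -> F (fun x => Cmod (lsum (f x) l - lsum g l)%C < d)).
  { induction l as [|i l IH]; intros d Hd; simpl.
    - apply filter_forall. intros x. replace (RtoC 0 - RtoC 0)%C with (RtoC 0) by ring.
      rewrite Cmod_0; auto.
    - generalize (@filter_and _ F FF _ _ (Hlim i (d / 2) ltac:(lra)) (IH (d / 2) ltac:(lra))).
      apply filter_imp. intros x [H1 H2].
      replace (f x i + lsum (f x) l - (g i + lsum g l))%C with
        ((f x i - g i) + (lsum (f x) l - lsum g l))%C by ring.
      eapply Rle_lt_trans; [apply Cmod_triangle|]. lra. }
  generalize (@filter_and _ F FF _ _ Hf (@filter_and _ F FF _ _ Hsf (Hfin l0 (eps / 4) ltac:(lra)))).
  apply filter_imp. intros x [H1 [H2 H3]].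
  pose proof (has_sum_tail (f x) (sf x) m l0 (eps / 4) H1 H0 Ht H2) as T1.
  pose proof (has_sum_tail g sg m l0 (eps / 4) Hg H0 Ht Hsg) as T2.
  replace (sf x - sg)%C with
    ((lsum (f x) l0 - lsum g l0) + (- (lsum (f x) l0 - sf x) + (lsum g l0 - sg)))%C by ring.
  eapply Rle_lt_trans; [apply Cmod_triangle|].
  assert (Cmod (- (lsum (f x) l0 - sf x) + (lsum g l0 - sg))%C <= eps / 4 + eps / 4); [|lra].
  eapply Rle_trans; [apply Cmod_triangle|]. rewrite Cmod_opp. lra.
Qed.

End Sums.

(** Comparison and injectivity are asked for on the support of [m], because some index maps used
    later are injective only on the matrices whose term is nonzero. *)
Lemma sum_le_inj {I J : Type} (phi : I -> J) (m : I -> R) (m' : J -> R) M :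
  (forall i, 0 <= m i) -> (forall i, m i <> 0 -> m i <= m' (phi i)) ->
  (forall i i', m i <> 0 -> m i' <> 0 -> phi i = phi i' -> i = i') ->
  sum_le m' M -> sum_le m M.
Proof.
  intros Hm0 Hm Hinj HM l Hl.
  set (l' := filter (fun i => if Req_EM_T (m i) 0 then false else true) l).
  assert (E : rsum m l = rsum m l').
  { unfold l'. clear. induction l as [|i l IH]; simpl; [reflexivity|].
    destruct (Req_EM_T (m i) 0); simpl; rewrite IH; [rewrite e; ring | reflexivity]. }
  assert (Hl' : forall i, In i l' -> m i <> 0).
  { intros i Hi. unfold l' in Hi. apply filter_In in Hi.
    destruct (Req_EM_T (m i) 0); intuition congruence. }
  assert (Hn : NoDup l') by (apply NoDup_filter; auto).
  rewrite E. apply Rle_trans with (rsum m' (map phi l')).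
  - rewrite rsum_map. apply rsum_le. intros i Hi. apply Hm; auto.
  - apply HM. clear E. revert Hl' Hn. generalize l'. clear -Hinj.
    induction l' as [|i l IH]; intros Hl Hn; simpl; [constructor|].
    inversion Hn; subst. constructor.
    + rewrite in_map_iff. intros [i' [E Hi']].
      assert (i' = i) by (apply Hinj; auto; apply Hl; simpl; auto). congruence.
    + apply IH; auto. intros; apply Hl; simpl; auto.
Qed.

(** Every finite subset of a product lies in the product of its two projections, where the sum can
    be iterated. *)
Lemma sum_le_prod {I J : Type} (m : I * J -> R) (g : I -> R) M :
  (forall x, 0 <= m x) -> (forall i, sum_le (fun j => m (i, j)) (g i)) -> sum_le g M -> sum_le m M.
Proof.
  intros Hm Hg HM l Hl.
  set (la := nodup eqd (map fst l)). set (lb := nodup eqd (map snd l)).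
  assert (Hi : incl l (list_prod la lb)).
  { intros [a b] H. apply in_prod; apply nodup_In.
    - apply (in_map fst) in H; auto.
    - apply (in_map snd) in H; auto. }
  assert (Hn : NoDup (list_prod la lb)) by (apply NoDup_list_prod; apply NoDup_nodup).
  apply Rle_trans with (rsum m (list_prod la lb)).
  - rewrite (rsum_perm m _ _ (ldiff_perm _ _ Hn Hl Hi)), rsum_app.
    pose proof (rsum_nonneg m (ldiff (list_prod la lb) l) Hm). lra.
  - rewrite rsum_prod. apply Rle_trans with (rsum g la).
    + apply rsum_le. intros i _. apply Hg, NoDup_nodup.
    + apply HM, NoDup_nodup.
Qed.

Lemma sum_le_mult {I J : Type} (u : I -> R) (v : J -> R) U V :
  (forall i, 0 <= u i) -> (forall j, 0 <= v j) -> sum_le u U -> sum_le v V ->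
  sum_le (fun x : I * J => u (fst x) * v (snd x)) (V * U).
Proof.
  intros Hu Hv HU HV.
  assert (0 <= V) by (apply (HV nil); constructor).
  apply sum_le_prod with (fun i => V * u i).
  - intros x. apply Rmult_le_pos; auto.
  - intros i l Hl. simpl. rewrite rsum_scal. rewrite Rmult_comm.
    apply Rmult_le_compat_r; auto.
  - apply sum_le_scal; auto.
Qed.

(** The maps [phi] and [psi] are mutually inverse between the supports and arbitrary elsewhere,
    which suits families extended by zero off determinant one. *)
Lemma has_sum_reindex {I J : Type} (f : I -> C) (g : J -> C) (phi : J -> I) (psi : I -> J) s :
  (forall i, f i <> RtoC 0 -> g (psi i) = f i /\ phi (psi i) = i) ->
  (forall j, g j <> RtoC 0 -> f (phi j) = g j /\ psi (phi j) = j) ->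
  has_sum f s -> has_sum g s.
Proof.
  intros Hf Hg Hs eps He. destruct (Hs eps He) as [l0 H0].
  exists (map psi l0). intros l Hl Hi.
  set (nz := fun j => if excluded_middle_informative (g j = RtoC 0) then false else true).
  set (l' := map phi (filter nz l)).
  assert (Hnz : forall j, In j (filter nz l) -> g j <> RtoC 0).
  { intros j Hj. apply filter_In in Hj. unfold nz in Hj.
    destruct (excluded_middle_informative (g j = RtoC 0)); intuition congruence. }
  assert (Hn : NoDup l').
  { unfold l'. assert (Hf0 : NoDup (filter nz l)) by (apply NoDup_filter; auto).
    revert Hf0 Hnz. generalize (filter nz l). clear -Hg.
    induction l as [|j l IH]; intros Hn Hnz; simpl; [constructor|].
    inversion Hn; subst. constructor.
    - rewrite in_map_iff. intros [j' [E Hj']].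
      assert (j' = j); [|congruence].
      destruct (Hg j) as [_ E1]; [apply Hnz; simpl; auto|].
      destruct (Hg j') as [_ E2]; [apply Hnz; simpl; auto|]. congruence.
    - apply IH; auto. intros; apply Hnz; simpl; auto. }
  assert (E1 : lsum g l = lsum f l').
  { transitivity (lsum g (filter nz l)).
    - clear. induction l as [|j l IH]; simpl; [reflexivity|]. unfold nz at 1.
      destruct (excluded_middle_informative (g j = RtoC 0)); simpl; rewrite IH;
        [rewrite e; ring | reflexivity].
    - unfold l'. rewrite lsum_map. apply lsum_ext. intros j Hj. symmetry. apply Hg; auto. }
  set (z := ldiff (nodup eqd l0) l').
  assert (E2 : lsum f (l' ++ z) = lsum f l').
  { rewrite lsum_app, (lsum_zero f z); [ring|].
    intros i Hi'. unfold z in Hi'. apply in_ldiff in Hi'. destruct Hi' as [A B].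
    destruct (excluded_middle_informative (f i = RtoC 0)) as [|Hne]; auto. exfalso. apply B.
    destruct (Hf i Hne) as [Eg Ep]. unfold l'. rewrite <- Ep. apply in_map, filter_In. split.
    - apply Hi, in_map. apply nodup_In in A. auto.
    - unfold nz. destruct (excluded_middle_informative (g (psi i) = RtoC 0)); congruence. }
  rewrite E1, <- E2. apply H0.
  - apply NoDup_app; auto.
    + apply NoDup_ldiff, NoDup_nodup.
    + intros i A B. apply in_ldiff in B. tauto.
  - intros i Hi'. apply in_or_app. destruct (in_dec eqd i l'); [auto|right].
    apply in_ldiff. split; auto. apply nodup_In; auto.
Qed.

Lemma has_sum_Fubini {I J : Type} (f : I * J -> C) (g : I -> C) s :
  has_sum f s -> (forall i, has_sum (fun j => f (i, j)) (g i)) -> has_sum g s.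
Proof.
  intros Hs Hg eps He. destruct (Hs (eps / 2)) as [l0 H0]; [lra|].
  exists (map fst l0). intros l Hl Hi.
  (* For finitely many rows, one finite set of columns approximates all the row sums at once and
     also contains the columns that occur in [l0]. *)
  assert (Hb : forall (k : list I) d, 0 < d -> exists lb, NoDup lb /\ incl (map snd l0) lb /\
     Cmod (lsum (fun i => lsum (fun j => f (i, j)) lb) k - lsum g k)%C < d /\
     forall lb', NoDup lb' -> incl lb lb' ->
     Cmod (lsum (fun i => lsum (fun j => f (i, j)) lb') k - lsum g k)%C < d).
  { assert (Hb' : forall (k : list I) d, 0 < d -> exists lb,
     forall lb', NoDup lb' -> incl lb lb' ->
     Cmod (lsum (fun i => lsum (fun j => f (i, j)) lb') k - lsum g k)%C < d).
    { induction k as [|i k IH]; intros d Hd.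
      - exists nil. intros lb' _ _. simpl. replace (RtoC 0 - RtoC 0)%C with (RtoC 0) by ring.
        rewrite Cmod_0; auto.
      - destruct (IH (d / 2)) as [b1 H1]; [lra|].
        destruct (Hg i (d / 2)) as [b2 H2]; [lra|].
        exists (b1 ++ b2). intros lb' Hn Hin. apply incl_app_inv in Hin. destruct Hin as [I1 I2].
        specialize (H1 lb' Hn I1). specialize (H2 lb' Hn I2). simpl.
        match goal with |- Cmod (?a + ?b - (?c + ?e))%C < _ =>
          replace (a + b - (c + e))%C with ((a - c) + (b - e))%C by ring end.
        eapply Rle_lt_trans; [apply Cmod_triangle|]. lra. }
    intros k d Hd. destruct (Hb' k d Hd) as [lb H]. exists (lunion (map snd l0) lb).
    split; [apply NoDup_lunion|]. split; [apply incl_lunion_l|]. split.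
    - apply H; [apply NoDup_lunion | apply incl_lunion_r].
    - intros lb' Hn Hin. apply H; auto. intros j Hj. apply Hin, incl_lunion_r; auto. }
  destruct (Hb l (eps / 2)) as [lb [Hn [Hi2 [Hc _]]]]; [lra|].
  specialize (H0 (list_prod l lb)). rewrite lsum_prod in H0.
  assert (Cmod (lsum (fun i => lsum (fun j => f (i, j)) lb) l - s)%C < eps / 2).
  { apply H0.
    - apply NoDup_list_prod; auto.
    - intros [a b] H. apply in_prod.
      + apply Hi. apply (in_map fst) in H; auto.
      + apply Hi2. apply (in_map snd) in H; auto. }
  set (u := lsum (fun i => lsum (fun j => f (i, j)) lb) l) in *.
  replace (lsum g l - s)%C with ((u - s) + - (u - lsum g l))%C by ring.
  eapply Rle_lt_trans; [apply Cmod_triangle|]. rewrite Cmod_opp. lra.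
Qed.

Lemma has_sum_swap {I J : Type} (f : I * J -> C) s :
  has_sum f s -> has_sum (fun x : J * I => f (snd x, fst x)) s.
Proof.
  apply has_sum_reindex with (phi := fun x => (snd x, fst x)) (psi := fun x => (snd x, fst x)).
  - intros [a b] _; auto.
  - intros [a b] _; auto.
Qed.

Lemma lsum_seq_sum_n (f : nat -> C) n :
  lsum f (seq 0 (S n)) = sum_n (G := C_AbelianMonoid) f n.
Proof.
  induction n as [|n IH].
  - rewrite sum_O. simpl. ring.
  - rewrite seq_S, lsum_app, IH, sum_Sn. simpl. change plus with Cplus. ring.
Qed.

Lemma has_sum_is_series (f : nat -> C) s :
  has_sum f s -> is_series (K := C_AbsRing) (V := C_NormedModule) f s.
Proof.
  intros Hs. unfold is_series. apply filterlim_locally. intros eps.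
  destruct (Hs eps (cond_pos eps)) as [l0 H0].
  exists (list_max l0). intros n Hn.
  specialize (H0 (seq 0 (S n)) (seq_NoDup _ _)).
  rewrite lsum_seq_sum_n in H0.
  apply C_NormedModule_mixin_compat1. apply H0.
  intros i Hi. apply in_seq. split; [lia|].
  assert (i <= list_max l0)%nat; [|lia].
  pose proof (proj1 (list_max_le l0 (list_max l0)) (le_n _)) as HF.
  rewrite Forall_forall in HF. auto.
Qed.

(** * The exponential and sums over the integers *)

Lemma Cmult_reg_l (a x y : C) : a <> RtoC 0 -> (a * x = a * y)%C -> x = y.
Proof.
  intros Ha E. replace x with (/ a * (a * x))%C by (field; auto). rewrite E. field; auto.
Qed.

Lemma Cexp_plus (z w : C) : Cexp (z + w)%C = (Cexp z * Cexp w)%C.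
Proof.
  destruct z as [a b], w as [c d]. unfold Cexp, RtoC, Cmult, Cplus; simpl.
  rewrite exp_plus, cos_plus, sin_plus. f_equal; ring.
Qed.

Lemma Cexp_0 : Cexp (RtoC 0) = RtoC 1.
Proof. unfold Cexp, RtoC, Cmult; simpl. rewrite exp_0, cos_0, sin_0. f_equal; ring. Qed.

Lemma qpar_pair (s t : R) :
  qpar (s, t) = (exp (- (2 * PI * t)) * cos (2 * PI * s), exp (- (2 * PI * t)) * sin (2 * PI * s)).
Proof.
  unfold qpar, Cexp, RtoC, Ci, Cmult; simpl.
  replace ((2 * PI * 0 - 0 * 1) * s - (2 * PI * 1 + 0 * 0) * t) with (- (2 * PI * t)) by ring.
  replace ((2 * PI * 0 - 0 * 1) * t + (2 * PI * 1 + 0 * 0) * s) with (2 * PI * s) by ring.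
  f_equal; ring.
Qed.

Lemma qpar_plus (z w : C) : qpar (z + w)%C = (qpar z * qpar w)%C.
Proof. unfold qpar. rewrite <- Cexp_plus. f_equal. ring. Qed.

Lemma qpar_0 : qpar (RtoC 0) = RtoC 1.
Proof. unfold qpar. rewrite <- Cexp_0. f_equal. ring. Qed.

Lemma qpar_pow (z : C) (n : nat) : (qpar z ^ n)%C = qpar (RtoC (INR n) * z)%C.
Proof.
  induction n as [|n IH].
  - simpl. rewrite <- qpar_0. f_equal. ring.
  - rewrite Cpow_S, IH, <- qpar_plus, S_INR, RtoC_plus. f_equal. ring.
Qed.

Lemma qpar_nat (n : nat) : qpar (RtoC (INR n)) = RtoC 1.
Proof.
  unfold RtoC at 1. rewrite qpar_pair. rewrite Rmult_0_r, Ropp_0, exp_0.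
  replace (2 * PI * INR n) with (0 + 2 * INR n * PI) by ring.
  rewrite cos_period, sin_period, cos_0, sin_0. unfold RtoC. f_equal; ring.
Qed.

Lemma qpar_opp (z : C) : (qpar z * qpar (- z))%C = RtoC 1.
Proof. rewrite <- qpar_plus, <- qpar_0. f_equal. ring. Qed.

Lemma qpar_Z (n : Z) : qpar (ZtoC n) = RtoC 1.
Proof.
  assert (H : forall p : nat, qpar (ZtoC (Z.of_nat p)) = RtoC 1).
  { intros p. unfold ZtoC. rewrite <- INR_IZR_INZ. apply qpar_nat. }
  destruct (Z.le_ge_cases 0 n) as [Hn|Hn].
  - rewrite <- (Z2Nat.id n) by auto. apply H.
  - pose proof (qpar_opp (ZtoC n)) as E.
    replace (- ZtoC n)%C with (ZtoC (Z.of_nat (Z.to_nat (- n)))) in E.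
    + rewrite H in E. rewrite <- E. ring.
    + unfold ZtoC. rewrite Z2Nat.id by lia. rewrite opp_IZR, RtoC_opp. reflexivity.
Qed.

Lemma qpar_shift (z : C) (n : Z) : qpar (z + ZtoC n)%C = qpar z.
Proof. rewrite qpar_plus, qpar_Z. ring. Qed.

Lemma Cmod_qpar (z : C) : Cmod (qpar z) = exp (- (2 * PI * Im z)).
Proof.
  destruct z as [s t]. rewrite qpar_pair. unfold Cmod; simpl fst; simpl snd; simpl Im.
  set (E := exp _). set (a := cos _). set (b := sin _).
  assert (HE : 0 < E) by apply exp_pos.
  replace ((E * a) ^ 2 + (E * b) ^ 2) with (Rsqr E).
  - apply sqrt_Rsqr; lra.
  - pose proof (sin2_cos2 (2 * PI * s)) as H. fold a b in H. unfold Rsqr in *.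
    transitivity (E * E * (b * b + a * a)); [rewrite H; ring | ring].
Qed.

Lemma Cmod_qpar_lt_1 (z : C) : 0 < Im z -> Cmod (qpar z) < 1.
Proof.
  intros H. rewrite Cmod_qpar, <- exp_0. apply exp_increasing.
  pose proof PI_RGT_0. assert (0 < 2 * PI * Im z); [|lra].
  apply Rmult_lt_0_compat; lra.
Qed.

Lemma Cmod_qpar_R (x : R) : Cmod (qpar (RtoC x)) = 1.
Proof. rewrite Cmod_qpar. simpl. rewrite Rmult_0_r, Ropp_0, exp_0. reflexivity. Qed.

Lemma geom_sum (x : C) (n : nat) :
  ((1 - x) * lsum (fun j => x ^ j) (seq 0 n) = 1 - x ^ n)%C.
Proof.
  induction n as [|n IH]; [simpl; ring|].
  rewrite seq_S, lsum_app, Cmult_plus_distr_l, IH. simpl. ring.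
Qed.

Lemma qpar_neq_1 (r : R) : 0 < r < 1 -> qpar (RtoC r) <> RtoC 1.
Proof.
  intros Hr E. unfold RtoC in E. rewrite qpar_pair in E.
  rewrite Rmult_0_r, Ropp_0, exp_0 in E. inversion E as [[E1 E2]].
  replace (2 * PI * r) with (2 * (PI * r)) in E1 by ring.
  rewrite cos_2a_sin in E1. pose proof PI_RGT_0.
  assert (0 < sin (PI * r)).
  { apply sin_gt_0; [apply Rmult_lt_0_compat; lra|].
    rewrite <- (Rmult_1_r PI) at 2. apply Rmult_lt_compat_l; lra. }
  assert (0 < sin (PI * r) * sin (PI * r)) by (apply Rmult_lt_0_compat; auto).
  lra.
Qed.

Lemma unity_sum (N : nat) (m : Z) : (0 < N)%nat ->
  lsum (fun j => qpar (RtoC (INR j * IZR m / INR N))) (seq 0 N)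
  = if (m mod Z.of_nat N =? 0)%Z then RtoC (INR N) else RtoC 0.
Proof.
  intros HN. assert (HN' : 0 < INR N) by (apply lt_0_INR; auto).
  set (r := (m mod Z.of_nat N)%Z). set (k := (m / Z.of_nat N)%Z).
  assert (Hm : m = (Z.of_nat N * k + r)%Z) by (apply Z.div_mod; lia).
  assert (Hr : (0 <= r < Z.of_nat N)%Z) by (apply Z.mod_pos_bound; lia).
  rewrite (lsum_ext _ (fun j => qpar (RtoC (IZR r / INR N)) ^ j)%C).
  - destruct (Z.eqb_spec r 0) as [E|E].
    + rewrite (lsum_ext _ (fun _ => RtoC 1)).
      * rewrite lsum_const, length_seq. ring.
      * intros j _. rewrite E. unfold Rdiv. rewrite Rmult_0_l, qpar_0, Cpow_1_l. reflexivity.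
    + pose proof (geom_sum (qpar (RtoC (IZR r / INR N))) N) as G.
      rewrite qpar_pow in G.
      replace (RtoC (INR N) * RtoC (IZR r / INR N))%C with (ZtoC r) in G.
      * rewrite qpar_Z in G.
        assert (Hx : qpar (RtoC (IZR r / INR N)) <> RtoC 1).
        { apply qpar_neq_1. assert (0 < IZR r) by (apply IZR_lt; lia).
          assert (IZR r < INR N) by (rewrite INR_IZR_INZ; apply IZR_lt; lia).
          split; [apply Rdiv_lt_0_compat; auto|].
          apply Rmult_lt_reg_r with (INR N); auto. field_simplify; lra. }
        set (x := qpar _) in *. set (S := lsum _ _) in *.
        assert (Hx' : (1 - x)%C <> RtoC 0).
        { intros E'. apply Hx. replace x with (1 - (1 - x))%C by ring. rewrite E'. ring. }
        apply Cmult_reg_l with (1 - x)%C; auto. rewrite G. ring.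
      * unfold ZtoC. rewrite <- RtoC_mult. f_equal. field. lra.
  - intros j _. rewrite qpar_pow. symmetry. rewrite <- (qpar_shift _ (Z.of_nat j * k)). f_equal.
    unfold ZtoC. rewrite <- RtoC_mult, <- RtoC_plus. f_equal.
    rewrite Hm. rewrite plus_IZR, !mult_IZR, <- !INR_IZR_INZ. field. lra.
Qed.

Lemma sum_le_seq (u : nat -> R) M :
  (forall n, 0 <= u n) -> (forall n, rsum u (seq 0 n) <= M) -> sum_le u M.
Proof.
  intros Hu H l Hl.
  assert (Hi : incl l (seq 0 (S (list_max l)))).
  { intros i Hi. apply in_seq. split; [lia|].
    assert (i <= list_max l)%nat; [|lia].
    pose proof (proj1 (list_max_le l (list_max l)) (le_n _)) as HF.
    rewrite Forall_forall in HF. auto. }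
  specialize (H (S (list_max l))). set (L := seq 0 (S (list_max l))) in *.
  rewrite (rsum_perm u L _ (ldiff_perm L l (seq_NoDup _ _) Hl Hi)), rsum_app in H.
  pose proof (rsum_nonneg u (ldiff L l) Hu). lra.
Qed.

Lemma sum_le_nat (u v : nat -> R) :
  (forall n, 0 <= u n) -> (forall n, 0 <= v n) -> (forall n, u n <= v n - v (S n)) ->
  sum_le u (v 0%nat).
Proof.
  intros Hu Hv H. apply sum_le_seq; auto. intros n.
  assert (rsum u (seq 0 n) <= v 0%nat - v n).
  { induction n as [|n IH]; [simpl; lra|].
    rewrite seq_S, rsum_app. simpl. specialize (H n). lra. }
  specialize (Hv n). lra.
Qed.

(* [zh] is two-to-one onto the naturals: n and -n-1 have the same image. *)
Definition zh (n : Z) : nat := if (0 <=? n)%Z then Z.to_nat n else Z.to_nat (- n - 1).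

Lemma sum_le_zh (u : nat -> R) M :
  (forall n, 0 <= u n) -> sum_le u M -> sum_le (fun n : Z => u (zh n)) (2 * M).
Proof.
  intros Hu HM.
  apply sum_le_inj with (phi := fun n => ((0 <=? n)%Z, zh n)) (m' := fun x : bool * nat => u (snd x)).
  - intros; auto.
  - intros; simpl; lra.
  - intros i i' _ _ E. unfold zh in E. inversion E as [[E1 E2]].
    destruct (Z.leb_spec 0 i), (Z.leb_spec 0 i'); try discriminate; lia.
  - apply sum_le_prod with (fun _ => M).
    + intros; auto.
    + intros b l Hl. apply HM; auto.
    + intros l Hl. assert (0 <= M) by (apply (HM nil); constructor).
      rewrite rsum_const. apply Rmult_le_compat_r; auto.
      replace 2 with (INR (length [true; false])) by (simpl; ring).
      apply le_INR. apply NoDup_incl_length; auto. intros [|] _; simpl; auto.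
Qed.

(** The weight (1+|n|)^(-3/2) is summable over the integers, and the product of two such weights in
    the entries of a pair (a, c) still dominates |a + c tau|^(-3) up to a constant. This is why
    exponent 3 suffices throughout. *)
Definition wt (n : Z) : R := / ((1 + IZR (Z.abs n)) * sqrt (1 + IZR (Z.abs n))).

Lemma wt_pos n : 0 < wt n.
Proof.
  assert (0 <= IZR (Z.abs n)) by (apply IZR_le; lia).
  apply Rinv_0_lt_compat, Rmult_lt_0_compat; [lra|]. apply sqrt_lt_R0; lra.
Qed.

Lemma wt_sum : sum_le wt 16.
Proof.
  assert (H : sum_le (fun n : nat => / ((1 + INR n) * sqrt (1 + INR n))) 4).
  { replace 4 with (4 / sqrt (1 + INR 0)).
    2: { simpl. rewrite Rplus_0_r, sqrt_1. field. }
    (* With p = sqrt x and q = sqrt (x+1), the difference 4/p - 4/q equals 4/(p q (p+q)), which is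
       at least 1/p^3 because q <= 3p/2. *)
    apply sum_le_nat with (v := fun n => 4 / sqrt (1 + INR n)).
    - intros n. pose proof (pos_INR n). left. apply Rinv_0_lt_compat, Rmult_lt_0_compat; [lra|].
      apply sqrt_lt_R0; lra.
    - intros n. pose proof (pos_INR n). apply Rlt_le, Rdiv_lt_0_compat; [lra|]. apply sqrt_lt_R0; lra.
    - intros n. pose proof (pos_INR n). rewrite S_INR.
      set (x := 1 + INR n). replace (1 + (INR n + 1)) with (x + 1) by (unfold x; ring).
      assert (Hx : 1 <= x) by (unfold x; lra).
      set (p := sqrt x). set (q := sqrt (x + 1)).
      assert (Hp : 0 < p) by (apply sqrt_lt_R0; lra).
      assert (Hq : 0 < q) by (apply sqrt_lt_R0; lra).
      assert (Ep : p * p = x) by (apply sqrt_sqrt; lra).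
      assert (Eq : q * q = x + 1) by (apply sqrt_sqrt; lra).
      assert (Hpq : q <= 3 / 2 * p). { apply Rsqr_incr_0_var; unfold Rsqr; nra. }
      assert (Hpq' : p < q) by nra.
      replace (4 / p - 4 / q) with (4 * / (p * q * (p + q))).
      + rewrite <- Ep.
        apply Rmult_le_reg_r with (p * p * p); [repeat apply Rmult_lt_0_compat; auto|].
        rewrite Rinv_l by (apply Rgt_not_eq; repeat apply Rmult_lt_0_compat; auto).
        apply Rmult_le_reg_r with (p * q * (p + q)); [repeat apply Rmult_lt_0_compat; lra|].
        replace (4 * / (p * q * (p + q)) * (p * p * p) * (p * q * (p + q))) with (4 * (p * p * p))
          by (field; split; [|split]; nra).
        rewrite Rmult_1_l. replace (p * q * (p + q)) with (p * (q * p + q * q)) by ring.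
        replace (4 * (p * p * p)) with (p * (4 * (p * p))) by ring.
        apply Rmult_le_compat_l; [lra|]. nra.
      + replace (4 / p - 4 / q) with (4 * (q - p) / (p * q)) by (field; lra).
        replace (q - p) with (/ (p + q)).
        * field. repeat split; nra.
        * apply Rmult_eq_reg_r with (p + q); [|lra]. rewrite Rinv_l by lra. nra. }
  intros l Hl.
  apply Rle_trans with (rsum (fun n => 2 * / ((1 + INR (zh n)) * sqrt (1 + INR (zh n)))) l).
  - apply rsum_le. intros n _. unfold wt.
    assert (Ha : INR (zh n) <= IZR (Z.abs n)).
    { unfold zh. rewrite INR_IZR_INZ. apply IZR_le. destruct (Z.leb_spec 0 n); lia. }
    pose proof (pos_INR (zh n)) as Hz.
    assert (0 < (1 + INR (zh n)) * sqrt (1 + INR (zh n))).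
    { apply Rmult_lt_0_compat; [lra|]. apply sqrt_lt_R0; lra. }
    apply Rle_trans with (/ ((1 + INR (zh n)) * sqrt (1 + INR (zh n)))).
    + apply Rinv_le_contravar; auto. apply Rmult_le_compat; try lra.
      * apply sqrt_pos.
      * apply sqrt_le_1; lra.
    + assert (0 < / ((1 + INR (zh n)) * sqrt (1 + INR (zh n)))) by (apply Rinv_0_lt_compat; auto). lra.
  - rewrite rsum_scal.
    assert (rsum (fun n => / ((1 + INR (zh n)) * sqrt (1 + INR (zh n)))) l <= 2 * 4); [|lra].
    apply (sum_le_zh (fun n => / ((1 + INR n) * sqrt (1 + INR n))) 4); auto.
    intros n. pose proof (pos_INR n). left. apply Rinv_0_lt_compat, Rmult_lt_0_compat; [lra|].
    apply sqrt_lt_R0; lra.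
Qed.

Lemma Cmod_sqr (z : C) : Cmod z * Cmod z = Re z * Re z + Im z * Im z.
Proof. pose proof (Cmod2_alt z) as H. simpl in H. lra. Qed.

Lemma Im_le_Cmod (z : C) : Rabs (Im z) <= Cmod z.
Proof. eapply Rle_trans; [apply Rmax_r | apply Rmax_Cmod]. Qed.

Lemma Im_pos_nz (z : C) : 0 < Im z -> z <> RtoC 0.
Proof. intros H ->. simpl in H. lra. Qed.

Lemma Im_plus_Z (n : Z) (w : C) : Im (ZtoC n + w)%C = Im w.
Proof. unfold Im; simpl. ring. Qed.

(** Two factors |n + w| are spent on a telescoping sum over the integers, which gives 8/T with T =
    Im w; each of the other k - 2 factors is at least T. *)
Lemma sum_row (w : C) (k : nat) : 1 <= Im w -> (2 <= k)%nat ->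
  sum_le (fun n : Z => / Cmod (ZtoC n + w)%C ^ k) (8 / Im w ^ (k - 1)).
Proof.
  intros HT Hk. set (T := Im w) in *.
  assert (H2 : sum_le (fun n : Z => / Cmod (ZtoC n + w)%C ^ 2) (8 / T)).
  { assert (Hu : sum_le (fun n : nat => 2 / (INR n + T) ^ 2) (2 / (INR 0 + T - / 2))).
    (* The shift by one half makes consecutive differences equal to 2/(x^2 - 1/4), which is at least
       2/x^2. *)
    { apply sum_le_nat with (v := fun n => 2 / (INR n + T - / 2)).
      - intros n. pose proof (pos_INR n). left. apply Rdiv_lt_0_compat; [lra|]. apply pow_lt; lra.
      - intros n. pose proof (pos_INR n). left. apply Rdiv_lt_0_compat; lra.
      - intros n. pose proof (pos_INR n). rewrite S_INR. set (x := INR n + T).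
        assert (1 <= x) by (unfold x; lra).
        replace (INR n + 1 + T - / 2) with (x + / 2) by (unfold x; field).
        replace (2 / (x - / 2) - 2 / (x + / 2)) with (2 / (x ^ 2 - / 4)) by (field; split;
          [|split]; nra).
        apply Rmult_le_compat_l; [lra|]. apply Rinv_le_contravar; nra. }
    simpl INR in Hu.
    (* [up (Re w) - 1] is the floor of Re w. After this translation [zh] of the new index is a lower
       bound for |n + Re w|, and (n + Re w)^2 + T^2 is at least half the square of [zh] plus T. *)
    apply sum_le_inj with (phi := fun n => (n + (up (Re w) - 1))%Z)
      (m' := fun n => (fun n : nat => 2 / (INR n + T) ^ 2) (zh n)).
    - intros n. left. apply Rinv_0_lt_compat, pow_lt, Cmod_gt_0,
      Im_pos_nz. rewrite Im_plus_Z. fold T. lra.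
    - intros n _. pose proof (archimed (Re w)) as Hup.
      set (m := (n + (up (Re w) - 1))%Z).
      assert (HA : INR (zh m) <= Rabs (IZR n + Re w)).
      { unfold zh. destruct (Z.leb_spec 0 m).
        - rewrite INR_IZR_INZ, Z2Nat.id by auto. apply Rle_trans with (IZR n + Re w); [|apply Rle_abs].
          unfold m. rewrite plus_IZR, minus_IZR. lra.
        - rewrite INR_IZR_INZ, Z2Nat.id by lia. rewrite <- Rabs_Ropp.
          apply Rle_trans with (- (IZR n + Re w)); [|apply Rle_abs].
          unfold m. rewrite minus_IZR, opp_IZR, plus_IZR, minus_IZR. lra. }
      pose proof (pos_INR (zh m)).
      replace (Cmod (ZtoC n + w)%C ^ 2) with ((IZR n + Re w) ^ 2 + T ^ 2).
      2: { rewrite Cmod2_alt. destruct w as [a b]. simpl. unfold T; simpl. ring. }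
      assert (HA2 : (INR (zh m)) ^ 2 <= (IZR n + Re w) ^ 2).
      { rewrite <- (pow2_abs (IZR n + Re w)). apply pow_incr; lra. }
      unfold Rdiv. rewrite <- (Rinv_inv 2), <- Rinv_mult.
      assert (0 < (INR (zh m) + T) ^ 2) by (apply pow_lt; lra).
      apply Rinv_le_contravar; [lra|]; pose proof (pow2_ge_0 (INR (zh m) - T)); lra.
    - intros; lia.
    - intros l Hl. apply Rle_trans with (2 * (2 / (0 + T - / 2))).
      + apply (sum_le_zh (fun n : nat => 2 / (INR n + T) ^ 2)); auto.
        intros n. pose proof (pos_INR n). left. apply Rdiv_lt_0_compat; [lra|]. apply pow_lt; lra.
      + unfold Rdiv. assert (/ (0 + T - / 2) <= 2 * / T); [|lra].
        rewrite <- (Rinv_inv 2) at 2. rewrite <- Rinv_mult. apply Rinv_le_contravar; lra. }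
  replace (8 / T ^ (k - 1)) with (/ T ^ (k - 2) * (8 / T)).
  - apply sum_le_mono with (fun n => / T ^ (k - 2) * / Cmod (ZtoC n + w)%C ^ 2).
    + intros n. rewrite <- Rinv_mult.
      assert (HTn : T <= Cmod (ZtoC n + w)%C).
      { eapply Rle_trans; [|apply Im_le_Cmod]. rewrite Im_plus_Z. apply Rle_abs. }
      apply Rinv_le_contravar.
      * apply Rmult_lt_0_compat; apply pow_lt; lra.
      * replace k with ((k - 2) + 2)%nat at 2 by lia. rewrite pow_add.
        apply Rmult_le_compat_r; [apply pow_le, Cmod_ge_0|]. apply pow_incr; lra.
    + apply sum_le_scal; auto. left. apply Rinv_0_lt_compat, pow_lt; lra.
  - replace (k - 1)%nat with (S (k - 2)) by lia. simpl. field. split; [apply pow_nonzero|]; lra.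
Qed.

(** Comparison with height one: |n + w| is at least min(1, Im w) times |n + Re w + i|, uniformly in
    n. *)
Lemma sum_row_ex (w : C) (k : nat) : 0 < Im w -> (2 <= k)%nat ->
  exists M, sum_le (fun n : Z => / Cmod (ZtoC n + w)%C ^ k) M.
Proof.
  intros HT Hk. set (T := Im w) in *. set (w1 := (Re w, 1) : C).
  set (d := Rmin 1 T). assert (Hd : 0 < d) by (apply Rmin_pos; lra).
  exists (/ d ^ k * (8 / 1 ^ (k - 1))).
  apply sum_le_mono with (fun n => / d ^ k * / Cmod (ZtoC n + w1)%C ^ k).
  - intros n. rewrite <- Rinv_mult, <- Rpow_mult_distr.
    assert (H1 : 1 <= Cmod (ZtoC n + w1)%C).
    { eapply Rle_trans; [|apply Im_le_Cmod]. rewrite Im_plus_Z. simpl. apply Rle_abs. }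
    apply Rinv_le_contravar.
    + apply pow_lt, Rmult_lt_0_compat; lra.
    + apply pow_incr. split; [apply Rmult_le_pos; lra|].
      apply Rsqr_incr_0_var; [|apply Cmod_ge_0]. unfold Rsqr.
      replace (d * Cmod (ZtoC n + w1) * (d * Cmod (ZtoC n + w1))) with
        (d * d * (Cmod (ZtoC n + w1) * Cmod (ZtoC n + w1))) by ring.
      rewrite !Cmod_sqr, !Im_plus_Z. fold T. unfold w1. simpl. unfold Re in *.
      assert (d <= 1) by apply Rmin_l. assert (d <= T) by apply Rmin_r.
      assert (d * d <= 1) by nra. assert (d * d <= T * T) by nra.
      assert (0 <= (IZR n + fst w) * (IZR n + fst w)) by apply Rle_0_sqr. nra.
  - apply sum_le_scal; [left; apply Rinv_0_lt_compat, pow_lt; auto|].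
    apply (sum_row w1 k); simpl; auto. lra.
Qed.

(** * Limits and the generating function of the powers *)

Definition tends {U : Type} (F : (U -> Prop) -> Prop) (f : U -> C) (l : C) : Prop :=
  forall eps : R, 0 < eps -> F (fun x => Cmod (f x - l)%C < eps).

Section Tends.
Context {U : Type} (F : (U -> Prop) -> Prop) {FF : Filter F}.

Lemma tends_const (c : C) : tends F (fun _ => c) c.
Proof.
  intros eps He. apply filter_forall. intros _.
  replace (c - c)%C with (RtoC 0) by ring. rewrite Cmod_0; auto.
Qed.

Lemma tends_ext_loc (f g : U -> C) l : F (fun x => f x = g x) -> tends F f l -> tends F g l.
Proof.
  intros E H eps He. generalize (@filter_and _ F FF _ _ E (H eps He)).
  apply filter_imp. intros x [<- Hx]; auto.
Qed.

Lemma tends_plus f g (a b : C) :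
  tends F f a -> tends F g b -> tends F (fun x => f x + g x)%C (a + b)%C.
Proof.
  intros Hf Hg eps He.
  generalize (@filter_and _ F FF _ _ (Hf (eps / 2) ltac:(lra)) (Hg (eps / 2) ltac:(lra))).
  apply filter_imp. intros x [H1 H2].
  replace (f x + g x - (a + b))%C with ((f x - a) + (g x - b))%C by ring.
  eapply Rle_lt_trans; [apply Cmod_triangle | lra].
Qed.

Lemma tends_bound f (a : C) (h : U -> R) (c : R) :
  (forall eps, 0 < eps -> F (fun x => h x < eps)) -> 0 <= c ->
  F (fun x => Cmod (f x - a)%C <= c * h x) -> tends F f a.
Proof.
  intros Hh Hc H eps He.
  assert (He' : 0 < eps / (c + 1)) by (apply Rdiv_lt_0_compat; lra).
  generalize (@filter_and _ F FF _ _ (Hh _ He') H). apply filter_imp. intros x [H1 H2].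
  eapply Rle_lt_trans; [apply H2|]. apply Rle_lt_trans with (c * (eps / (c + 1))).
  - apply Rmult_le_compat_l; lra.
  - apply Rmult_lt_reg_r with (c + 1); [lra|]. field_simplify; lra.
Qed.

Lemma tends_mult f g (a b : C) :
  tends F f a -> tends F g b -> tends F (fun x => f x * g x)%C (a * b)%C.
Proof.
  intros Hf Hg eps He.
  pose proof (Cmod_ge_0 a) as Ha. pose proof (Cmod_ge_0 b) as Hb.
  set (d := Rmin 1 (eps / (Cmod a + Cmod b + 2))).
  assert (Hd : 0 < d) by (apply Rmin_pos; [lra|]; apply Rdiv_lt_0_compat; lra).
  assert (Hd1 : d <= 1) by apply Rmin_l.
  assert (Hd2 : d * (Cmod a + Cmod b + 2) <= eps).
  { apply Rle_trans with (eps / (Cmod a + Cmod b + 2) * (Cmod a + Cmod b + 2)).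
    - apply Rmult_le_compat_r; [lra | apply Rmin_r].
    - right. field. lra. }
  generalize (@filter_and _ F FF _ _ (Hf d Hd) (Hg d Hd)).
  apply filter_imp. intros x [H1 H2].
  replace (f x * g x - a * b)%C with ((f x - a) * (g x - b) + (a * (g x - b) + (f x - a) * b))%C by ring.
  eapply Rle_lt_trans; [apply Cmod_triangle|]. rewrite Cmod_mult.
  assert (Cmod (a * (g x - b) + (f x - a) * b)%C <= Cmod a * d + d * Cmod b).
  { eapply Rle_trans; [apply Cmod_triangle|]. rewrite !Cmod_mult.
    apply Rplus_le_compat; [apply Rmult_le_compat_l | apply Rmult_le_compat_r]; lra. }
  assert (Cmod (f x - a)%C * Cmod (g x - b)%C <= d * 1).
  { apply Rmult_le_compat; try apply Cmod_ge_0; lra. }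
  nra.
Qed.

Lemma tends_pow f (a : C) n : tends F f a -> tends F (fun x => f x ^ n)%C (a ^ n)%C.
Proof.
  intros Hf. induction n as [|n IH]; simpl; [apply tends_const | apply tends_mult; auto].
Qed.

Lemma tends_inv f (a : C) : a <> RtoC 0 -> tends F f a -> tends F (fun x => / f x)%C (/ a)%C.
Proof.
  intros Ha Hf eps He. apply Cmod_gt_0 in Ha.
  set (d := Rmin (Cmod a / 2) (eps * (Cmod a * Cmod a) / 4)).
  assert (Hd : 0 < d).
  { apply Rmin_pos; [lra|]. assert (0 < Cmod a * Cmod a) by nra.
    assert (0 < eps * (Cmod a * Cmod a)) by nra. lra. }
  generalize (Hf d Hd). apply filter_imp. intros x Hx.
  assert (Hd1 : d <= Cmod a / 2) by apply Rmin_l.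
  assert (Hd2 : d <= eps * (Cmod a * Cmod a) / 4) by apply Rmin_r.
  assert (Hfx : Cmod a / 2 <= Cmod (f x)).
  { assert (Cmod a <= Cmod (f x) + Cmod (f x - a)%C); [|lra].
    replace a with (f x + - (f x - a))%C at 1 by ring.
    eapply Rle_trans; [apply Cmod_triangle|]. rewrite Cmod_opp. lra. }
  assert (Hnz : f x <> RtoC 0) by (apply Cmod_gt_0; lra).
  assert (Hnza : a <> RtoC 0) by (apply Cmod_gt_0; lra).
  replace (/ f x - / a)%C with (- (f x - a) / (f x * a))%C by (field; auto).
  rewrite Cmod_div by (apply Cmult_neq_0; auto). rewrite Cmod_opp, Cmod_mult.
  apply Rmult_lt_reg_r with (Cmod (f x) * Cmod a); [nra|].
  unfold Rdiv. rewrite Rmult_assoc, Rinv_l by nra. rewrite Rmult_1_r.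
  assert (eps * (Cmod a * Cmod a) / 2 <= eps * (Cmod (f x) * Cmod a)); [|nra].
  assert (Cmod a / 2 * Cmod a <= Cmod (f x) * Cmod a) by (apply Rmult_le_compat_r; lra).
  nra.
Qed.

Lemma tends_unique {FP : ProperFilter F} f a b : tends F f a -> tends F f b -> a = b.
Proof.
  intros Ha Hb. destruct (Req_dec (Cmod (a - b)%C) 0) as [E|E].
  - apply Cmod_eq_0 in E. replace a with (a - b + b)%C by ring. rewrite E. ring.
  - pose proof (Cmod_ge_0 (a - b)%C).
    destruct (filter_ex (F := F) _ (@filter_and _ F FF _ _ (Ha (Cmod (a - b)%C / 2) ltac:(lra))
      (Hb (Cmod (a - b)%C / 2) ltac:(lra)))) as [x [H1 H2]].
    exfalso. assert (Cmod (a - b)%C <= Cmod (f x - b)%C + Cmod (f x - a)%C); [|lra].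
    replace (a - b)%C with ((f x - b) + - (f x - a))%C by ring.
    eapply Rle_trans; [apply Cmod_triangle|]. rewrite Cmod_opp. lra.
Qed.

End Tends.

(* [bin j m] is the binomial coefficient (m + j choose j). *)
Fixpoint bin (j m : nat) : R :=
  match j with
  | O => 1
  | S j' => (INR m + INR j' + 1) / (INR j' + 1) * bin j' m
  end.

Lemma bin_S j m : bin (S j) m = (INR m + INR j + 1) / (INR j + 1) * bin j m.
Proof. reflexivity. Qed.

Lemma bin_pos j m : 0 < bin j m.
Proof.
  induction j as [|j IH]; simpl; [lra|].
  pose proof (pos_INR m). pose proof (pos_INR j).
  apply Rmult_lt_0_compat; auto. apply Rdiv_lt_0_compat; lra.
Qed.

Lemma bin_0 j : bin j 0 = 1.
Proof.
  induction j as [|j IH]; rewrite ?bin_S; [reflexivity|]. rewrite IH. simpl INR.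
  pose proof (pos_INR j). field; lra.
Qed.

Lemma bin_next j m : (INR m + 1) * bin j (S m) = (INR m + INR j + 1) * bin j m.
Proof.
  induction j as [|j IH]; rewrite ?bin_S; [simpl; lra|].
  pose proof (pos_INR m). pose proof (pos_INR j).
  rewrite !S_INR.
  transitivity ((INR m + 1 + INR j + 1) / (INR j + 1) * ((INR m + 1) * bin j (S m))); [field; lra|].
  rewrite IH. field; lra.
Qed.

Lemma bin_Pascal j m : bin (S j) (S m) = bin (S j) m + bin j (S m).
Proof.
  pose proof (pos_INR m). pose proof (pos_INR j). pose proof (bin_next j m) as E.
  rewrite ?bin_S. rewrite S_INR.
  replace ((INR m + INR j + 1) / (INR j + 1) * bin j m) with
    (/ (INR j + 1) * ((INR m + INR j + 1) * bin j m)) by (field; lra).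
  rewrite <- E. field; lra.
Qed.

Lemma bin_mul j m : INR m * bin j m = (INR j + 1) * (bin (S j) m - bin j m).
Proof. rewrite bin_S. pose proof (pos_INR j). field; lra. Qed.

(** By Pascal's rule, multiplication by 1 - r lowers j by one, up to a boundary term of favourable
    sign. *)
Lemma bin_sum_le j r : 0 <= r < 1 -> sum_le (fun m => bin j m * r ^ m) (/ (1 - r) ^ S j).
Proof.
  intros Hr. induction j as [|j IH].
  - apply sum_le_seq.
    + intros n. simpl. rewrite Rmult_1_l. apply pow_le; lra.
    + intros n. assert (E : (1 - r) * rsum (fun m => bin 0 m * r ^ m) (seq 0 n) = 1 - r ^ n).
      { induction n as [|n IH]; [simpl; ring|].
        rewrite seq_S, rsum_app, Rmult_plus_distr_l, IH. simpl. ring. }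
      apply Rmult_le_reg_l with (1 - r); [lra|]. rewrite E. simpl.
      rewrite Rmult_1_r, Rinv_r by lra. pose proof (pow_le r n ltac:(lra)). lra.
  - apply sum_le_seq.
    + intros n. apply Rmult_le_pos; [left; apply bin_pos | apply pow_le; lra].
    + intros [|n]; [simpl; left; apply Rinv_0_lt_compat; repeat apply Rmult_lt_0_compat; try lra;
        apply pow_lt; lra|].
      assert (E : (1 - r) * rsum (fun m => bin (S j) m * r ^ m) (seq 0 (S n)) =
        rsum (fun m => bin j m * r ^ m) (seq 0 (S n)) - bin (S j) n * r ^ S n).
      { induction n as [|n IHn].
        - cbn [seq rsum]. rewrite (bin_0 j), (bin_0 (S j)). simpl pow. ring.
        - rewrite (seq_S (S n)), !rsum_app, Rmult_plus_distr_l, IHn.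
          change (0 + S n)%nat with (S n). cbn [rsum]. rewrite bin_Pascal. simpl. ring. }
      apply Rmult_le_reg_l with (1 - r); [lra|]. rewrite E.
      replace ((1 - r) * / (1 - r) ^ S (S j)) with (/ (1 - r) ^ S j).
      * specialize (IH (seq 0 (S n)) (seq_NoDup _ _)).
        pose proof (pow_le r (S n) ltac:(lra)). pose proof (bin_pos (S j) n). nra.
      * simpl. field. split; [apply pow_nonzero|]; lra.
Qed.

Lemma pow_le_bin k m : INR m ^ k <= INR (fact k) * bin k m.
Proof.
  induction k as [|k IH]; [simpl; lra|].
  change (fact (S k)) with (S k * fact k)%nat. rewrite mult_INR, S_INR, bin_S. simpl pow.
  pose proof (pos_INR m). pose proof (pos_INR k).
  replace ((INR k + 1) * INR (fact k) * ((INR m + INR k + 1) / (INR k + 1) * bin k m)) with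
    ((INR m + INR k + 1) * (INR (fact k) * bin k m)) by (field; lra).
  apply Rmult_le_compat; try lra. apply pow_le; auto.
Qed.

Lemma pow_geom_sum k r : 0 <= r < 1 -> exists M, sum_le (fun m : nat => INR m ^ k * r ^ m) M.
Proof.
  intros Hr. exists (INR (fact k) * / (1 - r) ^ S k).
  apply sum_le_mono with (fun m => INR (fact k) * (bin k m * r ^ m)).
  - intros m. rewrite <- Rmult_assoc. apply Rmult_le_compat_r; [apply pow_le; lra|].
    apply pow_le_bin.
  - apply sum_le_scal; [apply pos_INR | apply bin_sum_le; auto].
Qed.

Lemma one_minus_nz (u : C) : Cmod u < 1 -> (1 - u)%C <> RtoC 0.
Proof.
  intros H E. assert (u = RtoC 1) as -> by (replace u with (1 - (1 - u))%C by ring; rewrite E; ring).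
  rewrite Cmod_1 in H. lra.
Qed.

Lemma Cmod_INR (n : nat) : Cmod (RtoC (INR n)) = INR n.
Proof. rewrite Cmod_R. apply Rabs_pos_eq, pos_INR. Qed.

(** The negative binomial series. By Pascal's rule the sum s for j + 1 satisfies s - u s =
    (1-u)^(-j-1), the value already known for j. *)
Lemma bin_has_sum j (u : C) : Cmod u < 1 ->
  has_sum (fun m => RtoC (bin j m) * u ^ m)%C (/ (1 - u) ^ S j)%C.
Proof.
  intros Hu. pose proof (one_minus_nz u Hu) as Hnz.
  assert (Hex : forall j, exists s, has_sum (fun m => RtoC (bin j m) * u ^ m)%C s).
  { intros i. apply has_sum_ex with (/ (1 - Cmod u) ^ S i).
    apply sum_le_mono with (fun m => bin i m * Cmod u ^ m).
    - intros m. rewrite Cmod_mult, Cmod_pow, Cmod_R, Rabs_pos_eq; [lra|]. left; apply bin_pos.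
    - apply bin_sum_le. split; auto. apply Cmod_ge_0. }
  assert (Hsh : forall i s, has_sum (fun m => RtoC (bin i m) * u ^ m)%C s ->
     has_sum (fun m => match m with O => RtoC 0 | S m' => RtoC (bin i m') * u ^ m end)%C (u * s)%C).
  { intros i s H. apply has_sum_reindex with
      (f := fun m => (u * (RtoC (bin i m) * u ^ m))%C) (phi := pred) (psi := S).
    - intros m _. split; [simpl; ring | reflexivity].
    - intros [|m] Hm; [congruence|]. split; [simpl; ring | reflexivity].
    - apply has_sum_scal; auto. }
  induction j as [|j IH].
  - destruct (Hex 0%nat) as [s Hs].
    assert (E : (s + RtoC (-1) * (u * s))%C = RtoC 1).
    { eapply has_sum_unique.
      - apply has_sum_plus; [apply Hs | apply has_sum_scal, Hsh, Hs].
      - apply has_sum_ext with (fun m => match m with O => RtoC 1 | S _ => RtoC 0 end).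
        + intros [|m]; simpl; ring.
        + assert (Hfin : has_sum (fun m => match m with O => RtoC 1 | S _ => RtoC 0 end)
            (lsum (fun m => match m with O => RtoC 1 | S _ => RtoC 0 end) [0%nat])).
          { apply has_sum_finite; [repeat constructor; simpl; tauto|].
            intros [|m] Hm; [simpl in Hm; tauto | reflexivity]. }
          simpl lsum in Hfin. rewrite Cplus_0_r in Hfin. exact Hfin. }
    replace (/ (1 - u) ^ 1)%C with s; auto.
    apply Cmult_reg_l with (1 - u)%C; auto.
    transitivity (s + RtoC (-1) * (u * s))%C; [ring|]. rewrite E. simpl. field; auto.
  - destruct (Hex (S j)) as [s Hs].
    assert (E : (s + RtoC (-1) * (u * s))%C = (/ (1 - u) ^ S j)%C).
    { eapply has_sum_unique; [|apply IH].
      apply has_sum_ext with (2 := has_sum_plus _ _ _ _ Hs (has_sum_scal (RtoC (-1)) _ _ (Hsh _ _ Hs))).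
      intros [|m].
      - rewrite !bin_0. ring.
      - rewrite bin_Pascal, RtoC_plus. ring. }
    replace (/ (1 - u) ^ S (S j))%C with s; auto.
    apply Cmult_reg_l with (1 - u)%C; auto.
    transitivity (s + RtoC (-1) * (u * s))%C; [ring|]. rewrite E.
    pose proof (Cpow_nz _ (S j) Hnz). rewrite (Cpow_S _ (S j)). field; auto.
Qed.

(* For j = 0, [A] is the k-th Eulerian polynomial. *)
Lemma Eulerian k j : exists (A : C -> C) (L : R),
  (forall u, Cmod u <= 1 -> Cmod (A u) <= L) /\
  (forall u, Cmod u <= 1 -> Cmod (A u - A (RtoC 1))%C <= L * Cmod (1 - u)%C) /\
  A (RtoC 1) = RtoC (INR (fact (k + j)) / INR (fact j)) /\
  (forall u, Cmod u < 1 -> has_sum (fun m => RtoC (INR m ^ k * bin j m) * u ^ m)%C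
     (A u / (1 - u) ^ S (k + j))%C).
Proof.
  revert j. induction k as [|k IH]; intros j.
  - exists (fun _ => RtoC 1), 1. split; [|split; [|split]].
    + intros. rewrite Cmod_1; lra.
    + intros. replace (RtoC 1 - RtoC 1)%C with (RtoC 0) by ring. rewrite Cmod_0.
      rewrite Rmult_1_l; apply Cmod_ge_0.
    + f_equal. simpl. field. apply INR_fact_neq_0.
    + intros u Hu. simpl Nat.add. replace (RtoC 1 / (1 - u) ^ S j)%C with (/ (1 - u) ^ S j)%C.
      * apply has_sum_ext with (2 := bin_has_sum j u Hu). intros m. simpl pow. rewrite Rmult_1_l; auto.
      * unfold Cdiv; ring.
  - destruct (IH (S j)) as [A1 [L1 [B1 [C1 [D1 E1]]]]]. destruct (IH j) as [A0 [L0 [B0 [C0 [D0 E0]]]]].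
    pose proof (pos_INR j) as Hj.
    (* The recursion comes from m bin(j, m) = (j+1) (bin(j+1, m) - bin(j, m)): a power of m is
       traded for a rise of j, which is why j stays general in the induction. *)
    exists (fun u => RtoC (INR j + 1) * (A1 u - (1 - u) * A0 u))%C, ((INR j + 1) * (L1 + 2 * L0)).
    assert (Hsc : forall z, Cmod (RtoC (INR j + 1) * z)%C = (INR j + 1) * Cmod z).
    { intros z. rewrite Cmod_mult, Cmod_R, Rabs_pos_eq; lra. }
    assert (HL0 : 0 <= L0).
    { eapply Rle_trans; [apply Cmod_ge_0 | apply (B0 (RtoC 1))]. rewrite Cmod_1; lra. }
    split; [|split; [|split]].
    + intros u Hu. rewrite Hsc. apply Rmult_le_compat_l; [lra|].
      replace (A1 u - (1 - u) * A0 u)%C with (A1 u + - ((1 - u) * A0 u))%C by ring.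
      eapply Rle_trans; [apply Cmod_triangle|]. rewrite Cmod_opp, Cmod_mult.
      specialize (B1 u Hu). specialize (B0 u Hu).
      assert (Cmod (1 - u)%C <= 2).
      { replace (1 - u)%C with (1 + - u)%C by ring. eapply Rle_trans; [apply Cmod_triangle|].
        rewrite Cmod_1, Cmod_opp; lra. }
      assert (Cmod (1 - u)%C * Cmod (A0 u) <= 2 * L0); [|lra].
      apply Rmult_le_compat; auto using Cmod_ge_0.
    + intros u Hu.
      replace (RtoC (INR j + 1) * (A1 u - (1 - u) * A0 u) - RtoC (INR j + 1) * (A1 1 - (1 - 1) * A0 1))%C
        with (RtoC (INR j + 1) * ((A1 u - A1 1) + - ((1 - u) * A0 u)))%C by ring.
      rewrite Hsc, Rmult_assoc. apply Rmult_le_compat_l; [lra|].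
      eapply Rle_trans; [apply Cmod_triangle|]. rewrite Cmod_opp, Cmod_mult.
      specialize (C1 u Hu). specialize (B0 u Hu). pose proof (Cmod_ge_0 (1 - u)%C).
      pose proof (Cmod_ge_0 (A0 u)). nra.
    + rewrite D1. transitivity (RtoC (INR j + 1) * RtoC (INR (fact (k + S j)) / INR (fact (S
      j))))%C; [ring|].
      rewrite <- RtoC_mult. f_equal. replace (S k + j)%nat with (k + S j)%nat by lia.
      change (fact (S j)) with (S j * fact j)%nat. rewrite mult_INR, S_INR.
      field. split; [apply INR_fact_neq_0 | lra].
    + intros u Hu. specialize (E1 u Hu). specialize (E0 u Hu).
      pose proof (one_minus_nz u Hu) as Hnz.
      pose proof (has_sum_scal (RtoC (INR j + 1)) _ _ (has_sum_plus _ _ _ _ E1 (has_sum_scal (RtoC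
        (-1)) _ _ E0))) as HH.
      replace (RtoC (INR j + 1) * (A1 u - (1 - u) * A0 u) / (1 - u) ^ S (S k + j))%C with
        (RtoC (INR j + 1) * (A1 u / (1 - u) ^ S (k + S j) + RtoC (-1) * (A0 u / (1 - u) ^ S (k + j))))%C.
      * apply has_sum_ext with (2 := HH). intros m.
        replace (INR m ^ S k * bin j m) with (INR m ^ k * (INR m * bin j m)) by (simpl; ring).
        rewrite bin_mul, !RtoC_mult, RtoC_minus. ring.
      * replace (S (S k + j))%nat with (S (S (k + j))) by lia.
        replace (S (k + S j))%nat with (S (S (k + j))) by lia.
        pose proof (Cpow_nz _ (k + j) Hnz). rewrite !Cpow_S. field; auto.
Qed.

(** The bound 12/5 is that of pi |s| for |s| <= 3/5, using pi <= 4. In this range x - x^3/6 is at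
    least x (1 - 24/25), whence the factor 1/25. *)
Lemma sin_lower (a : R) : Rabs a <= 12 / 5 -> / 25 * Rabs a <= Rabs (sin a).
Proof.
  assert (P : forall x, 0 <= x <= 12 / 5 -> / 25 * x <= sin x).
  { intros x Hx. destruct (pre_sin_bound x 0) as [H _]; [lra | lra|].
    unfold sin_approx, sum_f_R0, sin_term in H. simpl in H.
    assert (x * x <= 144 / 25) by nra.
    assert (x * (x * x) <= x * (144 / 25)) by (apply Rmult_le_compat_l; lra). lra. }
  intros Ha. destruct (Rle_dec 0 a) as [H|H].
  - rewrite (Rabs_pos_eq a) in * by lra. eapply Rle_trans; [apply P; lra | apply Rle_abs].
  - rewrite (Rabs_left a) in * by lra. rewrite <- Rabs_Ropp, <- sin_neg.
    eapply Rle_trans; [apply P; lra | apply Rle_abs].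
Qed.

(** This supplies the majorant for Lipschitz's formula. With w = s + i t and E = e^(-2 pi t), |1 -
    q|^2 = (1-E)^2 + 4 E sin^2(pi s), and the two parts control t and s. A half-width 3/5, larger
    than 1/2, leaves room for the real part of z. *)
Lemma one_minus_qpar_lower (w : C) (y : R) :
  Rabs (Re w) <= 3 / 5 -> 0 <= Im w <= y ->
  exp (- (2 * PI * y)) / 5 * Cmod w <= Cmod (1 - qpar w)%C.
Proof.
  intros Hs Ht. destruct w as [s t]. simpl Re in Hs; simpl Im in Ht.
  pose proof PI_RGT_0 as Hpi. pose proof PI_4 as Hpi4.
  assert (Hpi3 : 3 <= PI) by (pose proof PI2_3_2; lra).
  set (E := exp (- (2 * PI * t))). set (v := 2 * PI * t).
  assert (HE : 0 < E) by apply exp_pos.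
  assert (Hv : 0 <= v) by (unfold v; apply Rmult_le_pos; lra).
  assert (HE1 : E <= 1).
  { unfold E. rewrite <- exp_0. destruct Hv as [Hv|Hv].
    - left. apply exp_increasing. fold v. lra.
    - fold v. rewrite <- Hv, Ropp_0. lra. }
  assert (HE2 : v * E <= 1 - E).
  { pose proof (exp_ineq1_le v). assert (exp v * E = 1).
    { unfold E. fold v. rewrite <- exp_plus, Rplus_opp_r. apply exp_0. }
    nra. }
  assert (HEy : exp (- (2 * PI * y)) <= E).
  { unfold E. destruct (Req_dec y t) as [->|Hne]; [lra|]. left. apply exp_increasing.
    assert (2 * PI * t < 2 * PI * y) by (apply Rmult_lt_compat_l; lra). lra. }
  apply Rle_trans with (E / 5 * Cmod (s, t)).
  { apply Rmult_le_compat_r; [apply Cmod_ge_0 | lra]. }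
  apply Rsqr_incr_0_var; [|apply Cmod_ge_0]. unfold Rsqr.
  replace (E / 5 * Cmod (s, t) * (E / 5 * Cmod (s, t))) with
    (E * E / 25 * (Cmod (s, t) * Cmod (s, t))) by field.
  rewrite !Cmod_sqr, qpar_pair. fold E. simpl Re; simpl Im.
  set (sn := sin (PI * s)).
  assert (Hcos : cos (2 * PI * s) = 1 - 2 * sn * sn).
  { rewrite Rmult_assoc. apply cos_2a_sin. }
  pose proof (sin2_cos2 (2 * PI * s)) as Hsc. unfold Rsqr in Hsc.
  replace ((1 + - (E * cos (2 * PI * s))) * (1 + - (E * cos (2 * PI * s))) +
    (0 + - (E * sin (2 * PI * s))) * (0 + - (E * sin (2 * PI * s)))) with
    (1 - 2 * E * cos (2 * PI * s) + E * E * (sin (2 * PI * s) * sin (2 * PI * s) + cos (2 * PI * s)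
      * cos (2 * PI * s))) by ring.
  rewrite Hsc, Hcos.
  assert (Hsn : / 25 * (PI * Rabs s) <= Rabs sn).
  { rewrite <- (Rabs_pos_eq PI) at 1 by lra. rewrite <- Rabs_mult. apply sin_lower.
    rewrite Rabs_mult, (Rabs_pos_eq PI) by lra. nra. }
  assert (Hsn2 : 9 / 625 * (s * s) <= sn * sn).
  { assert (3 / 25 * Rabs s <= Rabs sn) by (pose proof (Rabs_pos s); nra).
    pose proof (Rabs_pos s).
    assert ((3 / 25 * Rabs s) * (3 / 25 * Rabs s) <= Rabs sn * Rabs sn) by (apply Rmult_le_compat; lra).
    assert (A1 : Rabs s * Rabs s = s * s) by (rewrite <- Rabs_mult; apply Rabs_pos_eq, Rle_0_sqr).
    assert (A2 : Rabs sn * Rabs sn = sn * sn) by (rewrite <- Rabs_mult; apply Rabs_pos_eq, Rle_0_sqr).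
    nra. }
  assert (Hvt : 36 * (t * t) <= v * v).
  { assert (6 * t <= v) by (unfold v; apply Rmult_le_compat_r; lra).
    replace (36 * (t * t)) with (6 * t * (6 * t)) by ring. apply Rmult_le_compat; lra. }
  assert (0 <= v * E) by (apply Rmult_le_pos; lra).
  assert (H1 : (v * E) * (v * E) <= (1 - E) * (1 - E)) by (apply Rmult_le_compat; lra).
  assert (H2 : E * E * (9 / 625 * (s * s)) <= E * (sn * sn)).
  { rewrite Rmult_assoc. apply Rmult_le_compat_l; [lra|].
    assert (0 <= s * s) by apply Rle_0_sqr. nra. }
  assert (H3 : E * E * (36 * (t * t)) <= E * E * (v * v)) by (apply Rmult_le_compat_l; nra).
  assert (0 <= E * E * (t * t)) by (apply Rmult_le_pos; nra).
  assert (0 <= E * E * (s * s)) by (apply Rmult_le_pos; nra).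
  nra.
Qed.

(** * Lipschitz's formula *)

Lemma qser_ex k (z : C) : 0 < Im z ->
  exists s, has_sum (fun m : nat => RtoC (INR m ^ k) * qpar z ^ m)%C s.
Proof.
  intros Hz. destruct (pow_geom_sum k (Cmod (qpar z))) as [M HM].
  - split; [apply Cmod_ge_0 | apply Cmod_qpar_lt_1; auto].
  - apply has_sum_ex with M. apply sum_le_mono with (2 := HM). intros m.
    rewrite Cmod_mult, Cmod_pow, Cmod_R, Rabs_pos_eq; [lra|]. apply pow_le, pos_INR.
Qed.

Lemma INR_C_nz (n : nat) : (0 < n)%nat -> RtoC (INR n) <> RtoC 0.
Proof. intros H E. apply RtoC_inj in E. apply lt_INR in H. simpl in H. lra. Qed.

(** The sum over M-th roots of unity keeps the exponents divisible by M, each with weight M; writing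
    m = M m' contributes the further factor M^k. The shift [c] allows the residues to be centred at
    0. *)
Lemma distribution_relation (G : C -> C) k (M : nat) (c : Z) (z : C) :
  (0 < M)%nat -> 0 < Im z ->
  (forall u, Cmod u < 1 -> has_sum (fun m => RtoC (INR m ^ k) * u ^ m)%C (G u)) ->
  lsum (fun j => G (qpar ((ZtoC (Z.of_nat j - c) + z) / RtoC (INR M)))%C) (seq 0 M)
  = (RtoC (INR M) ^ S k * G (qpar z))%C.
Proof.
  intros HM Hz HG. pose proof (INR_C_nz M HM) as HMz.
  assert (HM0 : 0 < INR M) by (apply lt_0_INR; auto).
  eapply has_sum_unique.
  - apply has_sum_lsum. intros j _. apply HG. apply Cmod_qpar_lt_1.
    destruct z as [x y]. unfold ZtoC, Cdiv. rewrite <- RtoC_inv by lra.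
    replace (Im ((RtoC (IZR (Z.of_nat j - c)) + (x, y)) * RtoC (/ INR M))%C) with (y / INR M).
    + apply Rdiv_lt_0_compat; auto.
    + unfold Im; simpl. field. lra.
  - pose proof (has_sum_scal (RtoC (INR M) ^ S k)%C _ _ (HG _ (Cmod_qpar_lt_1 z Hz))) as H.
    set (g := fun m : nat => if (Z.of_nat m mod Z.of_nat M =? 0)%Z
        then (RtoC (INR M) * RtoC (INR m ^ k) * qpar (RtoC (INR m) * z / RtoC (INR M)))%C
        else RtoC 0).
    apply has_sum_ext with g.
    + intros m. unfold g.
      rewrite (lsum_ext _ (fun j => (RtoC (INR m ^ k) * qpar (RtoC (INR m) * z / RtoC (INR M)) *
         qpar (RtoC (- (IZR c * INR m / INR M)))) * qpar (RtoC (INR j * IZR (Z.of_nat m) / INR M)))%C).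
      * rewrite lsum_scal, unity_sum by auto.
        destruct (Z.eqb_spec (Z.of_nat m mod Z.of_nat M) 0) as [E|E]; [|ring].
        replace (RtoC (- (IZR c * INR m / INR M))) with (ZtoC (- (c * (Z.of_nat m / Z.of_nat M)))).
        -- rewrite qpar_Z. ring.
        -- unfold ZtoC. f_equal. apply Z.div_exact in E; [|lia].
           set (t := (Z.of_nat m / Z.of_nat M)%Z) in *.
           rewrite (INR_IZR_INZ m), E, opp_IZR, !mult_IZR, <- !INR_IZR_INZ. field. lra.
      * intros j _. rewrite qpar_pow, <- !Cmult_assoc, <- !qpar_plus. f_equal. f_equal.
        unfold ZtoC. rewrite minus_IZR, <- !INR_IZR_INZ.
        unfold Rdiv. rewrite RtoC_opp, !RtoC_mult, RtoC_minus, RtoC_inv by lra.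
        field. auto.
    + apply has_sum_reindex with (3 := H) (phi := fun m => (m / M)%nat) (psi := fun m => (M * m)%nat).
      * intros m _. split.
        -- unfold g. rewrite Nat2Z.inj_mul, Z.mul_comm, Z.mod_mul by lia. simpl Z.eqb. cbv iota.
           rewrite qpar_pow, mult_INR, Rpow_mult_distr, !RtoC_mult, Cpow_S, !RtoC_pow.
           replace (RtoC (INR M) * RtoC (INR m) * z / RtoC (INR M))%C with (RtoC (INR m) * z)%C
             by (field; auto). ring.
        -- rewrite Nat.mul_comm. apply Nat.div_mul. lia.
      * intros m. unfold g. destruct (Z.eqb_spec (Z.of_nat m mod Z.of_nat M) 0) as [E|E]; [|congruence].
        intros _. assert (Em : m = (M * (m / M))%nat).
        { apply Nat.Div0.div_exact. rewrite <- Nat2Z.inj_mod in E. lia. }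
        split; [|auto].
        set (m' := (m / M)%nat) in *. rewrite Em.
        rewrite qpar_pow, mult_INR, Rpow_mult_distr, !RtoC_mult, Cpow_S, !RtoC_pow.
        replace (RtoC (INR M) * RtoC (INR m') * z / RtoC (INR M))%C with (RtoC (INR m') * z)%C
             by (field; auto). ring.
Qed.

Lemma tends_nat (f : nat -> C) l (a : R) :
  0 <= a -> (forall n, (1 <= n)%nat -> Cmod (f n - l)%C <= a / INR n) -> tends eventually f l.
Proof.
  intros Ha H. apply tends_bound with (h := fun n => / INR n) (c := a); auto.
  - apply eventually_filter.
  - intros eps He. destruct (archimed_cor1 eps He) as [n [H1 H2]]. exists n. intros m Hm.
    eapply Rle_lt_trans; [|apply H1]. apply Rinv_le_contravar; [apply lt_0_INR;
      auto | apply le_INR; auto].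
  - exists 1%nat. intros n Hn. apply (H n Hn).
Qed.

(** This is minus the derivative at 0 of h -> e(h z), sampled at h = 1/(2N+1). *)
Lemma qpar_diff_quotient (z : C) :
  tends eventually (fun N => RtoC (INR (2 * N + 1)) * (1 - qpar (z / RtoC (INR (2 * N + 1)))))%C
    (RtoC (- (2 * PI)) * Ci * z)%C.
Proof.
  destruct z as [x y].
  set (u := fun t => exp (- (2 * PI * (t * y))) * cos (2 * PI * (t * x))).
  set (v := fun t => exp (- (2 * PI * (t * y))) * sin (2 * PI * (t * x))).
  assert (Hu : derivable_pt_lim u 0 (- (2 * PI * y))).
  { apply is_derive_Reals. unfold u. auto_derive; auto.
    rewrite !Rmult_0_l, !Rmult_0_r, Ropp_0, exp_0, sin_0, cos_0. ring. }
  assert (Hv : derivable_pt_lim v 0 (2 * PI * x)).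
  { apply is_derive_Reals. unfold v. auto_derive; auto.
    rewrite !Rmult_0_l, !Rmult_0_r, Ropp_0, exp_0, sin_0, cos_0. ring. }
  intros eps He.
  destruct (Hu (eps / 2)) as [d1 H1]; [lra|]. destruct (Hv (eps / 2)) as [d2 H2]; [lra|].
  destruct (archimed_cor1 (Rmin d1 d2)) as [n0 [Hn0 Hn0']].
  { apply Rmin_pos; apply cond_pos. }
  exists n0. intros n Hn.
  assert (HM : 0 < INR (2 * n + 1)) by (apply lt_0_INR; lia).
  set (M := INR (2 * n + 1)) in *. set (h := / M).
  assert (Hh : 0 < h) by (apply Rinv_0_lt_compat; auto).
  assert (Hh' : h < Rmin d1 d2).
  { eapply Rle_lt_trans; [|apply Hn0]. apply Rinv_le_contravar; [apply lt_0_INR; auto|].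
    apply le_INR. lia. }
  pose proof (Rmin_l d1 d2). pose proof (Rmin_r d1 d2).
  specialize (H1 h ltac:(lra)). specialize (H2 h ltac:(lra)).
  rewrite Rplus_0_l, Rabs_pos_eq in H1,
    H2 by lra. specialize (H1 ltac:(lra)). specialize (H2 ltac:(lra)).
  assert (Eu0 : u 0 = 1).
  { unfold u. rewrite !Rmult_0_l, !Rmult_0_r, Ropp_0, exp_0, cos_0. ring. }
  assert (Ev0 : v 0 = 0).
  { unfold v. rewrite !Rmult_0_l, !Rmult_0_r, sin_0. ring. }
  rewrite Eu0 in H1. rewrite Ev0 in H2.
  replace ((x, y) / RtoC M)%C with ((h * x, h * y) : C).
  2: { unfold Cdiv. rewrite <- RtoC_inv by lra. fold h. unfold Cmult, RtoC; simpl. f_equal; ring. }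
  rewrite qpar_pair. fold (u h) (v h).
  match goal with |- Cmod ?w < _ => replace w with
    (RtoC (- ((u h - 1) / h - - (2 * PI * y))) + Ci * RtoC (- ((v h - 0) / h - 2 * PI * x)))%C end.
  - eapply Rle_lt_trans; [apply Cmod_triangle|].
    rewrite Cmod_mult, Cmod_Ci, !Cmod_R, !Rabs_Ropp. lra.
  - assert (E : M = / h) by (unfold h; rewrite Rinv_inv; auto).
    rewrite E. unfold Cmult, Cplus, Cminus, Copp, RtoC, Ci; simpl.
    apply injective_projections; simpl; field; lra.
Qed.

Definition Lconst (k : nat) : C := ((RtoC (- (2 * PI)) * Ci) ^ S k / RtoC (INR (fact k)))%C.

Lemma twopi_i_nz : (RtoC (- (2 * PI)) * Ci)%C <> RtoC 0.
Proof.
  apply Cmod_gt_0. rewrite Cmod_mult, Cmod_Ci, Cmod_R, Rabs_Ropp, Rabs_pos_eq; pose proof PI_RGT_0; lra.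
Qed.

Lemma fact_C_nz k : RtoC (INR (fact k)) <> RtoC 0.
Proof. apply INR_C_nz. apply lt_O_fact. Qed.

(* With M = 2N+1, the distribution relation writes the q-series at z as the sum over
   |n| <= N of M^{-k-1} times its values at (z+n)/M, and these tend to a multiple of
   (z+n)^{-k-1}. *)
Lemma Lipschitz k (z s : C) : (1 <= k)%nat -> 0 < Im z ->
  has_sum (fun m : nat => RtoC (INR m ^ k) * qpar z ^ m)%C s ->
  has_sum (fun n : Z => / (ZtoC n + z) ^ S k)%C (Lconst k * s)%C.
Proof.
  intros Hk Hz Hs.
  destruct (Eulerian k 0) as [A [L [HA [HAL [HA1 HAs]]]]].
  set (G := fun u => (A u / (1 - u) ^ S k)%C).
  assert (HG : forall u, Cmod u < 1 -> has_sum (fun m => RtoC (INR m ^ k) * u ^ m)%C (G u)).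
  { intros u Hu. specialize (HAs u Hu). rewrite Nat.add_0_r in HAs.
    apply has_sum_ext with (2 := HAs). intros m. simpl bin. rewrite Rmult_1_r. reflexivity. }
  replace (INR (fact (k + 0)) / INR (fact 0)) with (INR (fact k)) in HA1
    by (rewrite Nat.add_0_r; simpl; field).
  destruct (sum_row_ex z (S k) Hz ltac:(lia)) as [M0 HM0].
  assert (Hnz : forall n, (ZtoC n + z)%C <> RtoC 0).
  { intros n. apply Im_pos_nz. rewrite Im_plus_Z. auto. }
  assert (HM0' : sum_le (fun n : Z => Cmod (/ (ZtoC n + z) ^ S k)%C) M0).
  { apply sum_le_mono with (2 := HM0). intros n.
    rewrite Cmod_inv, Cmod_pow by (apply Cpow_nz; auto). lra. }
  destruct (has_sum_ex _ _ HM0') as [sg Hsg].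
  assert (Es : s = G (qpar z)).
  { eapply has_sum_unique; [apply Hs | apply HG, Cmod_qpar_lt_1; auto]. }
  set (c0 := (RtoC (INR (fact k)) / (RtoC (- (2 * PI)) * Ci) ^ S k)%C).
  pose proof (Cpow_nz _ (S k) twopi_i_nz) as Htp. pose proof (fact_C_nz k) as Hfk.
  replace (Lconst k * s)%C with sg; auto.
  enough (E : s = (c0 * sg)%C) by (rewrite E; unfold Lconst, c0; field; auto).
  set (Mf := fun N => INR (2 * N + 1)).
  set (f := fun (N : nat) (i : Z) => if (Z.abs i <=? Z.of_nat N)%Z then
     (/ RtoC (Mf N) ^ S k * G (qpar ((ZtoC i + z) / RtoC (Mf N))))%C else RtoC 0).
  set (y := Im z) in *. set (b := exp (- (2 * PI * y)) / 5).
  assert (Hb : 0 < b) by (apply Rdiv_lt_0_compat; [apply exp_pos | lra]).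
  assert (HL : 0 <= L).
  { eapply Rle_trans; [apply Cmod_ge_0 | apply (HA (RtoC 1))]. rewrite Cmod_1; lra. }
  assert (Hc0 : Cmod c0 <= L * / b ^ S k + Cmod c0).
  { assert (0 <= L * / b ^ S k); [|lra]. apply Rmult_le_pos;
    auto. left. apply Rinv_0_lt_compat, pow_lt; auto. }
  pose proof (Cmod_ge_0 c0) as Hc00.
  assert (Hcc : 0 <= L * / b ^ S k) by (apply Rmult_le_pos; auto; left;
    apply Rinv_0_lt_compat, pow_lt; auto).
  assert (HMpos : forall N, 0 < Mf N) by (intros N; apply lt_0_INR; lia).
  assert (HMnz : forall N, RtoC (Mf N) <> RtoC 0) by (intros N; apply INR_C_nz; lia).
  assert (Hq : forall N i, Im ((ZtoC i + z) / RtoC (Mf N))%C = y / Mf N /\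
      Re ((ZtoC i + z) / RtoC (Mf N))%C = (IZR i + Re z) / Mf N).
  { intros N i. unfold Cdiv. rewrite <- RtoC_inv by (apply Rgt_not_eq, HMpos).
    unfold ZtoC, y. destruct z as [a d]. unfold Im, Re; simpl. specialize (HMpos N).
    split; field; lra. }
  assert (Hq1 : forall N i, Cmod (qpar ((ZtoC i + z) / RtoC (Mf N)))%C < 1).
  { intros N i. apply Cmod_qpar_lt_1. rewrite (proj1 (Hq N i)). apply Rdiv_lt_0_compat; auto. }
  assert (Hf : forall N i, (/ RtoC (Mf N) ^ S k * G (qpar ((ZtoC i + z) / RtoC (Mf N))))%C =
     (A (qpar ((ZtoC i + z) / RtoC (Mf N))) * / (RtoC (Mf N) * (1 - qpar ((ZtoC i + z) / RtoC (Mf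
       N)))) ^ S k)%C).
  { intros N i. unfold G. rewrite Cpow_mult_l.
    pose proof (Cpow_nz _ (S k) (one_minus_nz _ (Hq1 N i))). pose proof (Cpow_nz _ (S k) (HMnz N)).
    set (u1 := ((1 - qpar ((ZtoC i + z) / RtoC (Mf N))) ^ S k)%C) in *.
    set (u2 := (RtoC (Mf N) ^ S k)%C) in *. field; auto. }
  apply (tends_unique eventually (fun _ : nat => s)).
  { apply tends_const. apply eventually_filter. }
  intros eps He.
  apply (Tannery eventually (@filter_filter _ _ eventually_filter) f (fun _ => s)
    (fun i => c0 * / (ZtoC i + z) ^ S k)%C (c0 * sg)%C
    (fun i => (L * / b ^ S k + Cmod c0) * Cmod (/ (ZtoC i + z) ^ S k)%C)
    ((L * / b ^ S k + Cmod c0) * M0)); auto.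
  - apply sum_le_scal; auto. lra.
  - intros i. rewrite Cmod_mult. apply Rmult_le_compat_r; auto. apply Cmod_ge_0.
  (* From this N on, (i + Re z)/(2N+1) lies in the strip of half-width 3/5 for every |i| <= N, so
     that [one_minus_qpar_lower] applies. *)
  - destruct (INR_unbounded (10 * Rabs (Re z) + 10)) as [N0 HN0]. exists N0. intros N HN i.
    assert (HNN : INR N0 <= INR N) by (apply le_INR; auto).
    assert (Cmod_ge : 0 <= Cmod (/ (ZtoC i + z) ^ S k)%C) by apply Cmod_ge_0.
    unfold f. destruct (Z.leb_spec (Z.abs i) (Z.of_nat N)) as [Hi|Hi].
    + rewrite Hf, Cmod_mult.
      apply Rle_trans with (L * (/ b ^ S k * Cmod (/ (ZtoC i + z) ^ S k)%C)); [|nra].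
      apply Rmult_le_compat; auto using Cmod_ge_0.
      * apply HA. left; auto.
      * rewrite !Cmod_inv, !Cmod_pow, <- Rinv_mult, <- Rpow_mult_distr.
        2: { apply Cpow_nz; auto. }
        2: { apply Cpow_nz, Cmult_neq_0; auto. apply one_minus_nz; auto. }
        assert (0 < Cmod (ZtoC i + z)%C) by (apply Cmod_gt_0; auto).
        apply Rinv_le_contravar; [apply pow_lt, Rmult_lt_0_compat; auto|].
        apply pow_incr. split; [apply Rmult_le_pos; lra|].
        rewrite Cmod_mult, Cmod_R, Rabs_pos_eq by (left; apply HMpos).
        replace (b * Cmod (ZtoC i + z)%C) with (Mf N * (b * Cmod ((ZtoC i + z) / RtoC (Mf N))%C)).
        -- apply Rmult_le_compat_l; [left; apply HMpos|]. apply one_minus_qpar_lower.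
           ++ rewrite (proj2 (Hq N i)). unfold Rdiv. rewrite Rabs_mult.
              rewrite (Rabs_pos_eq (/ Mf N)) by (left; apply Rinv_0_lt_compat, HMpos).
              apply Rmult_le_reg_r with (Mf N); [apply HMpos|].
              rewrite Rmult_assoc, Rinv_l, Rmult_1_r by (apply Rgt_not_eq, HMpos).
              eapply Rle_trans; [apply Rabs_triang|]. rewrite <- abs_IZR.
              assert (IZR (Z.abs i) <= INR N) by (rewrite INR_IZR_INZ; apply IZR_le; auto).
              assert (Mf N = 2 * INR N + 1).
              { unfold Mf. rewrite plus_INR, mult_INR. simpl. ring. }
              pose proof (Rabs_pos (Re z)). lra.
           ++ rewrite (proj1 (Hq N i)). specialize (HMpos N).
              assert (1 <= Mf N).
              { unfold Mf. replace 1 with (INR 1) by reflexivity. apply le_INR. lia. }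
              split; [apply Rdiv_le_0_compat; lra|].
              apply Rmult_le_reg_r with (Mf N); auto. unfold Rdiv.
              rewrite Rmult_assoc, Rinv_l by lra. nra.
        -- rewrite Cmod_div, Cmod_R, Rabs_pos_eq by (auto; left; apply HMpos).
           specialize (HMpos N). field. lra.
    + rewrite Cmod_0. apply Rmult_le_pos; lra.
  - apply filter_forall. intros N.
    set (lN := map (fun j : nat => (Z.of_nat j - Z.of_nat N)%Z) (seq 0 (2 * N + 1))).
    assert (E : lsum (f N) lN = s).
    { unfold lN. rewrite lsum_map.
      rewrite (lsum_ext _ (fun j => (/ RtoC (Mf N) ^ S k * G (qpar ((ZtoC (Z.of_nat j - Z.of_nat N)
        + z) / RtoC (Mf N))))%C)).
      - rewrite lsum_scal. unfold Mf at 2. rewrite (distribution_relation G k); auto; [|lia].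
        fold (Mf N). rewrite Es. pose proof (Cpow_nz _ (S k) (HMnz N)).
        set (u2 := (RtoC (Mf N) ^ S k)%C) in *. field; auto.
      - intros j Hj. apply in_seq in Hj. unfold f.
        destruct (Z.leb_spec (Z.abs (Z.of_nat j - Z.of_nat N)) (Z.of_nat N)); [reflexivity | lia]. }
    rewrite <- E. apply has_sum_finite.
    + apply FinFun.Injective_map_NoDup; [intros a b' Hab; lia | apply seq_NoDup].
    + intros i Hi. unfold f. destruct (Z.leb_spec (Z.abs i) (Z.of_nat N)); auto.
      exfalso. apply Hi. apply in_map_iff. exists (Z.to_nat (i + Z.of_nat N)). split; [lia|].
      apply in_seq. lia.
  - apply has_sum_scal; auto.
  - intros i. pose proof (qpar_diff_quotient (ZtoC i + z)%C) as Hd.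
    set (D := fun N => (RtoC (INR (2 * N + 1)) * (1 - qpar ((ZtoC i + z) / RtoC (INR (2 * N +
      1)))))%C) in Hd.
    set (d := (RtoC (- (2 * PI)) * Ci * (ZtoC i + z))%C) in Hd.
    assert (Hdnz : d <> RtoC 0) by (apply Cmult_neq_0; [apply twopi_i_nz | auto]).
    replace (c0 * / (ZtoC i + z) ^ S k)%C with (A (RtoC 1) * / d ^ S k)%C.
    2: { rewrite HA1. unfold c0, d. rewrite Cpow_mult_l. pose proof (Cpow_nz _ (S k) (Hnz i)).
      set (u1 := ((ZtoC i + z) ^ S k)%C) in *. set (u2 := ((RtoC (- (2 * PI)) * Ci) ^ S k)%C) in *.
      field; auto. }
    change (tends eventually (fun N => f N i) (A (RtoC 1) * / d ^ S k)%C).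
    apply (tends_ext_loc eventually) with
      (f := fun N => (A (qpar ((ZtoC i + z) / RtoC (Mf N))) * / D N ^ S k)%C).
    + exists (Z.to_nat (Z.abs i)). intros N HN. unfold f.
      destruct (Z.leb_spec (Z.abs i) (Z.of_nat N)); [|lia]. symmetry. apply Hf.
    + apply (tends_mult eventually).
      (* [A] is Lipschitz at 1, and its argument tends to 1 because 1 - q is a convergent difference
         quotient divided by 2N+1. *)
      * assert (H1 : tends eventually (fun N => (1 - qpar ((ZtoC i + z) / RtoC (Mf N)))%C) (RtoC 0)).
        { assert (Hinv : tends eventually (fun N => (/ RtoC (Mf N))%C) (RtoC 0)).
          { apply tends_nat with 1; [lra|]. intros n Hn.
            replace (/ RtoC (Mf n) - RtoC 0)%C with (/ RtoC (Mf n))%C by ring.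
            rewrite Cmod_inv, Cmod_R, Rabs_pos_eq by (auto; left; auto).
            unfold Rdiv. rewrite Rmult_1_l. apply Rinv_le_contravar; [apply lt_0_INR; lia|].
            apply le_INR; lia. }
          pose proof (tends_mult eventually _ _ _ _ Hinv Hd) as H.
          replace (RtoC 0 * d)%C with (RtoC 0) in H by ring.
          refine (tends_ext_loc eventually _ _ _ _ H). apply filter_forall. intros N. unfold D.
          fold (Mf N). specialize (HMnz N). set (q := (1 - qpar _)%C). field; auto. }
        intros e He'. assert (He2 : 0 < e / (L + 1)) by (apply Rdiv_lt_0_compat; lra).
        generalize (H1 _ He2). apply filter_imp. intros N HN.
        eapply Rle_lt_trans; [apply HAL; left; auto|].
        replace (1 - qpar ((ZtoC i + z) / RtoC (Mf N)) - RtoC 0)%C with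
          (1 - qpar ((ZtoC i + z) / RtoC (Mf N)))%C in HN by ring.
        apply Rle_lt_trans with (L * (e / (L + 1))); [apply Rmult_le_compat_l; lra|].
        apply Rmult_lt_reg_r with (L + 1); [lra|]. field_simplify; nra.
      * apply (tends_inv eventually); [apply Cpow_nz; auto|]. apply (tends_pow eventually). auto.
Qed.

(** * The kernel forms *)

(* An arbitrary value when [f] has no sum. *)
Definition Sum {I : Type} (f : I -> C) : C := epsilon (inhabits (RtoC 0)) (has_sum f).

Lemma Sum_spec {I : Type} (f : I -> C) M :
  sum_le (fun i => Cmod (f i)) M -> has_sum f (Sum f).
Proof. intros H. exact (epsilon_spec (inhabits (RtoC 0)) (has_sum f) (has_sum_ex f M H)). Qed.

Definition lin (tau : C) (p : Z * Z) : C := (ZtoC (fst p) + ZtoC (snd p) * tau)%C.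

(* The index g = ((a, c), (b, d)) stands for the matrix (a b; c d). *)
Definition det (g : (Z * Z) * (Z * Z)) : Z :=
  (fst (fst g) * snd (snd g) - snd (fst g) * fst (snd g))%Z.

(** Extended by zero off determinant one, so that the sums run over all of Z^4 and changes of index
    are polynomial maps. *)
Definition kern (K : nat) (tau z : C) (g : (Z * Z) * (Z * Z)) : C :=
  if (det g =? 1)%Z then (/ (lin tau (fst g) * z + lin tau (snd g)) ^ K)%C else RtoC 0.

Definition wt2 (p : Z * Z) : R := wt (fst p) * wt (snd p).

Lemma wt2_pos p : 0 < wt2 p.
Proof. apply Rmult_lt_0_compat; apply wt_pos. Qed.

Lemma wt2_sum : sum_le wt2 (16 * 16).
Proof. apply sum_le_mult; auto using wt_sum; intros; left; apply wt_pos. Qed.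

Lemma wt2_wt2_sum : sum_le (fun g : (Z * Z) * (Z * Z) => wt2 (fst g) * wt2 (snd g)) (16 * 16 * (16
  * 16)).
Proof. apply sum_le_mult; auto using wt2_sum; intros; left; apply wt2_pos. Qed.

(** The imaginary part of a + c tau controls c, and then a = (a + c tau) - c tau. The added 1 is
    absorbed because a nonzero integer pair has an entry of absolute value at least 1. *)
Lemma lin_lower (tau : C) : 0 < Im tau -> exists kap, 0 < kap /\ forall p, p <> (0, 0)%Z ->
  1 + IZR (Z.abs (fst p)) <= kap * Cmod (lin tau p) /\
  1 + IZR (Z.abs (snd p)) <= kap * Cmod (lin tau p).
Proof.
  intros Ht. set (Y := Im tau) in *. pose proof (Cmod_ge_0 tau) as Hct.
  set (k0 := / Y + 1 + Cmod tau / Y).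
  assert (HY : 0 < / Y) by (apply Rinv_0_lt_compat; auto).
  assert (HtY : 0 <= Cmod tau / Y) by (apply Rdiv_le_0_compat; auto).
  exists (2 * k0). split; [unfold k0; lra|]. intros [a c] Hp. simpl fst; simpl snd.
  set (l := lin tau (a, c)). pose proof (Cmod_ge_0 l) as Hl.
  assert (Hc : IZR (Z.abs c) <= / Y * Cmod l).
  { apply Rmult_le_reg_l with Y; auto. rewrite <- Rmult_assoc, Rinv_r, Rmult_1_l by lra.
    eapply Rle_trans; [|apply Im_le_Cmod].
    replace (Im l) with (IZR c * Y).
    - rewrite Rabs_mult, <- abs_IZR, (Rabs_pos_eq Y) by lra. lra.
    - unfold l, lin, ZtoC, Y. destruct tau. unfold Im; simpl. ring. }
  assert (Ha : IZR (Z.abs a) <= (1 + Cmod tau / Y) * Cmod l).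
  { apply Rle_trans with (Cmod l + IZR (Z.abs c) * Cmod tau).
    - replace (IZR (Z.abs a)) with (Cmod (l - ZtoC c * tau)%C).
      + replace (l - ZtoC c * tau)%C with (l + - (ZtoC c * tau))%C by ring.
        eapply Rle_trans; [apply Cmod_triangle|]. rewrite Cmod_opp, Cmod_mult.
        unfold ZtoC. rewrite Cmod_R, <- abs_IZR. lra.
      + unfold l, lin. simpl. replace (ZtoC a + ZtoC c * tau - ZtoC c * tau)%C with (ZtoC a) by ring.
        unfold ZtoC. rewrite Cmod_R, <- abs_IZR. auto.
    - assert (IZR (Z.abs c) * Cmod tau <= / Y * Cmod l * Cmod tau) by (apply Rmult_le_compat_r; auto).
      unfold Rdiv. lra. }
  assert (Hk1 : / Y * Cmod l <= k0 * Cmod l) by (apply Rmult_le_compat_r; unfold k0; lra).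
  assert (Hk2 : (1 + Cmod tau / Y) * Cmod l <= k0 * Cmod l) by (apply Rmult_le_compat_r; unfold k0; lra).
  assert (H1 : 1 <= k0 * Cmod l).
  { destruct (Z.eq_dec c 0) as [->|Hc0].
    - assert (1 <= IZR (Z.abs a)); [|lra]. apply IZR_le.
      assert (a <> 0%Z) by congruence. lia.
    - assert (1 <= IZR (Z.abs c)); [|lra]. apply IZR_le. lia. }
  lra.
Qed.

(** Both X = 1+|a| and Y = 1+|c| are at most kap |a + c tau|, so (X Y)^(3/2) is at most its cube; as
    this quantity is at least 1, larger exponents only help. *)
Lemma lin_pow_wt2 (tau : C) (k : nat) : 0 < Im tau -> (3 <= k)%nat -> exists M, 0 <= M /\
  forall p, p <> (0, 0)%Z -> / Cmod (lin tau p) ^ k <= M * wt2 p.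
Proof.
  intros Ht Hk. destruct (lin_lower tau Ht) as [kap [Hkap H]].
  exists (kap ^ k). split; [apply pow_le; lra|]. intros p Hp. destruct (H p Hp) as [H1 H2].
  set (X := 1 + IZR (Z.abs (fst p))) in *. set (Y := 1 + IZR (Z.abs (snd p))) in *.
  assert (HX : 1 <= X) by (unfold X; assert (0 <= IZR (Z.abs (fst p))) by (apply IZR_le; lia); lra).
  assert (HY : 1 <= Y) by (unfold Y; assert (0 <= IZR (Z.abs (snd p))) by (apply IZR_le; lia); lra).
  set (l := Cmod (lin tau p)) in *.
  assert (Hl : 0 < l).
  { apply Rmult_lt_reg_l with kap; lra. }
  unfold wt2, wt. fold X Y. rewrite <- Rinv_mult.
  assert (HsX : 0 < sqrt X) by (apply sqrt_lt_R0; lra).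
  assert (HsY : 0 < sqrt Y) by (apply sqrt_lt_R0; lra).
  assert (Hm : X * sqrt X * (Y * sqrt Y) <= (kap * l) ^ k).
  { apply Rle_trans with ((kap * l) ^ 3); [|apply Rle_pow; auto; lra].
    assert (HXY : sqrt X * sqrt Y <= kap * l).
    { apply Rsqr_incr_0_var; [|lra]. unfold Rsqr.
      replace (sqrt X * sqrt Y * (sqrt X * sqrt Y)) with ((sqrt X * sqrt X) * (sqrt Y * sqrt Y)) by ring.
      rewrite !sqrt_sqrt by lra. apply Rmult_le_compat; lra. }
    replace (X * sqrt X * (Y * sqrt Y)) with (X * (Y * (sqrt X * sqrt Y))) by ring.
    replace ((kap * l) ^ 3) with (kap * l * (kap * l * (kap * l))) by ring.
    assert (0 < sqrt X * sqrt Y) by (apply Rmult_lt_0_compat; auto).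
    apply Rmult_le_compat; try lra; [apply Rmult_le_pos; lra|]. apply Rmult_le_compat; lra. }
  assert (0 < X * sqrt X * (Y * sqrt Y)) by (repeat apply Rmult_lt_0_compat; lra).
  rewrite Rpow_mult_distr in Hm.
  assert (0 < kap ^ k) by (apply pow_lt; auto). assert (0 < l ^ k) by (apply pow_lt; auto).
  apply Rmult_le_reg_r with (l ^ k); auto. rewrite Rinv_l by lra.
  apply Rmult_le_reg_r with (X * sqrt X * (Y * sqrt Y)); auto.
  replace (kap ^ k * / (X * sqrt X * (Y * sqrt Y)) * l ^ k * (X * sqrt X * (Y * sqrt Y)))
    with (kap ^ k * l ^ k) by (field; lra). lra.
Qed.

Lemma det_nz g : det g = 1%Z -> fst g <> (0, 0)%Z /\ snd g <> (0, 0)%Z.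
Proof.
  destruct g as [[a c] [b d]]. unfold det; simpl. intros H. split; intros E; inversion E; subst; lia.
Qed.

Lemma lin_nz tau p : 0 < Im tau -> p <> (0, 0)%Z -> lin tau p <> RtoC 0.
Proof.
  intros Ht Hp. destruct (lin_lower tau Ht) as [kap [Hkap H]]. destruct (H p Hp) as [H1 _].
  apply Cmod_gt_0. apply Rmult_lt_reg_l with kap; auto.
  assert (0 <= IZR (Z.abs (fst p))) by (apply IZR_le; lia). lra.
Qed.

Lemma Im_div (p q : C) : p <> RtoC 0 ->
  Im (q / p)%C = (Im q * Re p - Re q * Im p) / (Cmod p * Cmod p).
Proof.
  intros Hp. pose proof Hp as Hp'. apply Cmod_gt_0 in Hp'.
  assert (0 < Cmod p * Cmod p) by (apply Rmult_lt_0_compat; auto).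
  rewrite Cmod_sqr in *. destruct p as [x y], q as [u v].
  unfold Cdiv, Cinv, Cmult, Im, Re in *; simpl in *. field. nra.
Qed.

Lemma Im_ratio tau g : 0 < Im tau -> det g = 1%Z ->
  0 < Im (lin tau (snd g) / lin tau (fst g))%C.
Proof.
  intros Ht Hg. pose proof (det_nz g Hg) as [Hp _]. pose proof (lin_nz tau _ Ht Hp) as Hnz.
  rewrite Im_div by auto. apply Cmod_gt_0 in Hnz. apply Rdiv_lt_0_compat; [|nra].
  destruct g as [[a c] [b d]]. unfold det in Hg; simpl in Hg. apply (f_equal IZR) in Hg.
  rewrite minus_IZR, !mult_IZR in Hg. destruct tau as [x y]. simpl in *.
  replace (_ - _) with ((IZR a * IZR d - IZR c * IZR b) * y) by ring. rewrite Hg. lra.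
Qed.

(** Since q/p lies in the upper half-plane, |p z + q| = |p| |z + q/p| is at least |p| Im z; the
    bound on q follows by the triangle inequality. *)
Lemma linz_lower tau z g : 0 < Im tau -> 0 < Im z -> det g = 1%Z ->
  Cmod (lin tau (fst g)) * Im z <= Cmod (lin tau (fst g) * z + lin tau (snd g))%C /\
  Cmod (lin tau (snd g)) * Im z <= (Im z + Cmod z) * Cmod (lin tau (fst g) * z + lin tau (snd g))%C.
Proof.
  intros Ht Hz Hg. pose proof (det_nz g Hg) as [Hp _]. pose proof (lin_nz tau _ Ht Hp) as Hnz.
  pose proof (Im_ratio tau g Ht Hg) as Hi.
  set (p := lin tau (fst g)) in *. set (q := lin tau (snd g)) in *.
  assert (H1 : Cmod p * Im z <= Cmod (p * z + q)%C).
  { replace (p * z + q)%C with (p * (z + q / p))%C by (field; auto). rewrite Cmod_mult.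
    apply Rmult_le_compat_l; [apply Cmod_ge_0|].
    eapply Rle_trans; [|apply Im_le_Cmod]. eapply Rle_trans; [|apply Rle_abs].
    replace (Im (z + q / p)%C) with (Im z + Im (q / p)%C) by reflexivity. lra. }
  split; auto.
  assert (H2 : Cmod q <= Cmod (p * z + q)%C + Cmod p * Cmod z).
  { replace q with ((p * z + q) + - (p * z))%C at 1 by ring.
    eapply Rle_trans; [apply Cmod_triangle|]. rewrite Cmod_opp, Cmod_mult. lra. }
  pose proof (Cmod_ge_0 z).
  assert (Cmod p * Im z * Cmod z <= Cmod (p * z + q)%C * Cmod z) by (apply Rmult_le_compat_r; auto).
  nra.
Qed.

Lemma linz_nz tau z g : 0 < Im tau -> 0 < Im z -> det g = 1%Z ->
  (lin tau (fst g) * z + lin tau (snd g))%C <> RtoC 0.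
Proof.
  intros Ht Hz Hg. pose proof (linz_lower tau z g Ht Hz Hg) as [H _].
  pose proof (det_nz g Hg) as [Hp _]. pose proof (lin_nz tau _ Ht Hp) as Hnz.
  apply Cmod_gt_0 in Hnz. apply Cmod_gt_0. eapply Rlt_le_trans; [|apply H].
  apply Rmult_lt_0_compat; auto.
Qed.

(** The exponent is split as 3 + (K - 3), one share for each column of the matrix. Each share has to
    be at least 3, whence K >= 6. The bound is locally uniform in z, as termwise integration
    requires. *)
Lemma kern_bound K tau y0 Z0 : (6 <= K)%nat -> 0 < Im tau -> 0 < y0 -> 0 <= Z0 ->
  exists M, 0 <= M /\ forall z, y0 <= Im z -> Cmod z <= Z0 -> forall g,
  Cmod (kern K tau z g) <= M * (wt2 (fst g) * wt2 (snd g)).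
Proof.
  intros HK Ht Hy HZ.
  destruct (lin_pow_wt2 tau 3 Ht ltac:(lia)) as [M1 [HM1 H1]].
  destruct (lin_pow_wt2 tau (K - 3) Ht ltac:(lia)) as [M2 [HM2 H2]].
  set (b := 1 + Z0 / y0).
  assert (HZy : 0 <= Z0 / y0) by (apply Rdiv_le_0_compat; auto).
  assert (Hb : 0 < b) by (unfold b; lra).
  assert (HC : 0 <= / y0 ^ 3 * b ^ (K - 3)).
  { apply Rmult_le_pos; [left; apply Rinv_0_lt_compat, pow_lt; auto | apply pow_le; lra]. }
  exists (/ y0 ^ 3 * b ^ (K - 3) * (M1 * M2)). split; [apply Rmult_le_pos; auto;
    apply Rmult_le_pos; auto|].
  intros z Hz HzZ g. pose proof (wt2_pos (fst g)). pose proof (wt2_pos (snd g)).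
  unfold kern. destruct (Z.eqb_spec (det g) 1) as [Hg|Hg].
  - pose proof (linz_lower tau z g Ht ltac:(lra) Hg) as [L1 L2].
    pose proof (linz_nz tau z g Ht ltac:(lra) Hg) as Hnz.
    pose proof (det_nz g Hg) as [Hp Hq].
    specialize (H1 _ Hp). specialize (H2 _ Hq).
    pose proof (lin_nz tau _ Ht Hp) as Np. pose proof (lin_nz tau _ Ht Hq) as Nq.
    apply Cmod_gt_0 in Np. apply Cmod_gt_0 in Nq.
    rewrite Cmod_inv, Cmod_pow by (apply Cpow_nz; auto). apply Cmod_gt_0 in Hnz.
    set (p := Cmod (lin tau (fst g))) in *. set (q := Cmod (lin tau (snd g))) in *.
    set (r := Cmod (lin tau (fst g) * z + lin tau (snd g))%C) in *.
    assert (A1 : p * y0 <= r) by nra.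
    assert (A2 : q <= b * r).
    { assert (Cmod z <= Z0 / y0 * Im z).
      { apply Rle_trans with (Z0 / y0 * y0); [|apply Rmult_le_compat_l; auto].
        unfold Rdiv. rewrite Rmult_assoc, Rinv_l; lra. }
      assert (q * Im z <= (b * r) * Im z); [|apply Rmult_le_reg_r with (Im z); lra].
      eapply Rle_trans; [apply L2|]. unfold b.
      replace ((1 + Z0 / y0) * r * Im z) with ((Im z + Z0 / y0 * Im z) * r) by ring.
      apply Rmult_le_compat_r; lra. }
    apply Rle_trans with (/ y0 ^ 3 * b ^ (K - 3) * (/ p ^ 3 * / q ^ (K - 3))).
    + assert (E : (p * y0) ^ 3 * q ^ (K - 3) <= r ^ K * b ^ (K - 3)).
      { replace (r ^ K) with (r ^ 3 * r ^ (K - 3)) by (rewrite <- pow_add; f_equal; lia).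
        rewrite Rmult_assoc, <- Rpow_mult_distr, (Rmult_comm r b).
        apply Rmult_le_compat; try (apply pow_le; nra); apply pow_incr; nra. }
      rewrite Rpow_mult_distr in E.
      assert (0 < p ^ 3) by (apply pow_lt; auto). assert (0 < q ^ (K - 3)) by (apply pow_lt; auto).
      assert (0 < y0 ^ 3) by (apply pow_lt; auto). assert (0 < r ^ K) by (apply pow_lt; auto).
      assert (0 < b ^ (K - 3)) by (apply pow_lt; auto).
      set (P3 := p ^ 3) in *. set (Q3 := q ^ (K - 3)) in *. set (Y3 := y0 ^ 3) in *.
      set (RK := r ^ K) in *. set (B3 := b ^ (K - 3)) in *.
      clearbody P3 Q3 Y3 RK B3.
      apply Rmult_le_reg_r with (RK * (Y3 * (P3 * Q3))); [repeat apply Rmult_lt_0_compat; auto|].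
      replace (/ RK * (RK * (Y3 * (P3 * Q3)))) with (P3 * Y3 * Q3) by (field; lra).
      replace (/ Y3 * B3 * (/ P3 * / Q3) * (RK * (Y3 * (P3 * Q3)))) with (RK * B3) by (field; lra).
      lra.
    + replace (/ y0 ^ 3 * b ^ (K - 3) * (M1 * M2) * (wt2 (fst g) * wt2 (snd g))) with
        (/ y0 ^ 3 * b ^ (K - 3) * ((M1 * wt2 (fst g)) * (M2 * wt2 (snd g)))) by ring.
      apply Rmult_le_compat_l; auto.
      apply Rmult_le_compat; auto; left; apply Rinv_0_lt_compat, pow_lt; auto.
  - rewrite Cmod_0.
    apply Rmult_le_pos; [apply Rmult_le_pos; [auto | apply Rmult_le_pos;
      auto] | apply Rmult_le_pos; lra].
Qed.

Definition kernel_form (K : nat) (tau z : C) : C := Sum (kern K tau z).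

Lemma kern_sum_le K tau z : (6 <= K)%nat -> 0 < Im tau -> 0 < Im z ->
  exists M, sum_le (fun g => Cmod (kern K tau z g)) M.
Proof.
  intros HK Ht Hz. destruct (kern_bound K tau (Im z) (Cmod z) HK Ht Hz (Cmod_ge_0 z)) as [M [HM H]].
  exists (M * (16 * 16 * (16 * 16))).
  apply sum_le_mono with (fun g => M * (wt2 (fst g) * wt2 (snd g))).
  - intros g. apply H; lra.
  - apply sum_le_scal; auto. apply wt2_wt2_sum.
Qed.

Lemma kernel_form_sum K tau z : (6 <= K)%nat -> 0 < Im tau -> 0 < Im z -> has_sum (kern K tau z)
  (kernel_form K tau z).
Proof. intros HK Ht Hz. destruct (kern_sum_le K tau z HK Ht Hz) as [M HM]. apply Sum_spec with M;
  auto. Qed.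

Lemma IZR_eq1 (a b c d : Z) : (a * d - b * c = 1)%Z -> IZR a * IZR d - IZR b * IZR c = 1.
Proof. intros H. rewrite <- !mult_IZR, <- minus_IZR. now f_equal. Qed.

(** The substitution replaces the columns (p, q) by (a p + c q, b p + d q), a bijection of the index
    set that preserves the determinant and has inverse [psi]. Clearing the denominator produces the
    factor of automorphy. *)
Lemma kernel_form_modular K tau : (6 <= K)%nat -> 0 < Im tau -> forall a b c d : Z,
  (a * d - b * c = 1)%Z ->
  forall z : C, 0 < Im z ->
  kernel_form K tau ((ZtoC a * z + ZtoC b) / (ZtoC c * z + ZtoC d))%C = ((ZtoC c * z + ZtoC d) ^ K
    * kernel_form K tau z)%C.
Proof.
  intros HK Ht a b c d Hd z Hz.
  pose proof (IZR_eq1 _ _ _ _ Hd) as HdR.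
  assert (Hj : (ZtoC c * z + ZtoC d)%C <> RtoC 0).
  { intros E. assert (E1 := f_equal Im E). assert (E2 := f_equal Re E).
    destruct z as [x y]. unfold ZtoC in *. simpl in E1, E2, Hz.
    assert (Ec : IZR c * y = 0) by lra. apply Rmult_integral in Ec. destruct Ec as [Ec|Ec]; [|lra].
    rewrite Ec in *. assert (IZR d = 0) by lra. rewrite H in HdR. lra. }
  set (j := (ZtoC c * z + ZtoC d)%C) in *.
  assert (Hz' : 0 < Im ((ZtoC a * z + ZtoC b) / j)%C).
  { rewrite Im_div by auto. pose proof Hj as Hj'. apply Cmod_gt_0 in Hj'. apply Rdiv_lt_0_compat; [|nra].
    unfold j, ZtoC. destruct z as [x y]. simpl in *.
    replace (_ - _) with ((IZR a * IZR d - IZR b * IZR c) * y) by ring. rewrite HdR; lra. }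
  eapply has_sum_unique; [apply kernel_form_sum; auto|].
  set (phi := fun g : (Z * Z) * (Z * Z) =>
    let '((p1, p2), (q1, q2)) := g in ((a * p1 + c * q1, a * p2 + c * q2), (b * p1 + d * q1,
      b * p2 + d * q2))%Z).
  set (psi := fun g : (Z * Z) * (Z * Z) =>
    let '((p1, p2), (q1, q2)) := g in ((d * p1 - c * q1, d * p2 - c * q2), (a * q1 - b * p1,
      a * q2 - b * p2))%Z).
  assert (H12 : forall g, phi (psi g) = g).
  { intros [[p1 p2] [q1 q2]]. unfold phi, psi. repeat apply f_equal2.
    - transitivity ((a * d - b * c) * p1)%Z; [ring | rewrite Hd; ring].
    - transitivity ((a * d - b * c) * p2)%Z; [ring | rewrite Hd; ring].
    - transitivity ((a * d - b * c) * q1)%Z; [ring | rewrite Hd; ring].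
    - transitivity ((a * d - b * c) * q2)%Z; [ring | rewrite Hd; ring]. }
  assert (H21 : forall g, psi (phi g) = g).
  { intros [[p1 p2] [q1 q2]]. unfold phi, psi. repeat apply f_equal2.
    - transitivity ((a * d - b * c) * p1)%Z; [ring | rewrite Hd; ring].
    - transitivity ((a * d - b * c) * p2)%Z; [ring | rewrite Hd; ring].
    - transitivity ((a * d - b * c) * q1)%Z; [ring | rewrite Hd; ring].
    - transitivity ((a * d - b * c) * q2)%Z; [ring | rewrite Hd; ring]. }
  apply has_sum_ext with (fun g => (j ^ K * kern K tau z (phi g))%C).
  - intros g. unfold kern.
    assert (Hdet : det (phi g) = det g).
    { destruct g as [[p1 p2] [q1 q2]]. unfold phi, det; simpl.
      transitivity ((a * d - b * c) * (p1 * q2 - p2 * q1))%Z; [ring | rewrite Hd; ring]. }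
    rewrite Hdet. destruct (Z.eqb_spec (det g) 1) as [Hg|Hg]; [|ring].
    assert (E : (lin tau (fst (phi g)) * z + lin tau (snd (phi g)))%C =
      (j * (lin tau (fst g) * ((ZtoC a * z + ZtoC b) / j) + lin tau (snd g)))%C).
    { replace (j * (lin tau (fst g) * ((ZtoC a * z + ZtoC b) / j) + lin tau (snd g)))%C
        with (lin tau (fst g) * (ZtoC a * z + ZtoC b) + j * lin tau (snd g))%C by (field; auto).
      destruct g as [[p1 p2] [q1 q2]]. unfold phi, lin, j, ZtoC; simpl.
      rewrite !plus_IZR, !mult_IZR, !RtoC_plus, !RtoC_mult. ring. }
    rewrite E, Cpow_mult_l.
    pose proof (Cpow_nz _ K Hj). pose proof (Cpow_nz _ K (linz_nz tau _ g Ht Hz' Hg)).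
    set (u := ((lin tau (fst g) * ((ZtoC a * z + ZtoC b) / j) + lin tau (snd g)) ^ K)%C) in *.
    set (v := (j ^ K)%C) in *. field; auto.
  - apply has_sum_scal.
    apply has_sum_reindex with (f := kern K tau z) (phi := phi) (psi := psi).
    + intros g _. rewrite H12. auto.
    + intros g _. auto.
    + apply kernel_form_sum; auto.
Qed.

(** * Holomorphy of the kernel forms *)

Lemma inv_pow_quad K : exists M, 0 <= M /\ forall s : C, Cmod s <= 1 / 2 ->
  Cmod (/ (1 + s) ^ K - 1 + RtoC (INR K) * s)%C <= M * (Cmod s * Cmod s).
Proof.
  induction K as [|K [M [HM IH]]].
  - exists 0. split; [lra|]. intros s Hs. simpl.
    replace (/ 1 - 1 + 0 * s)%C with (RtoC 0) by (field). rewrite Cmod_0. lra.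
  - exists (2 * M + 2 * (INR K + 1)). pose proof (pos_INR K). split; [lra|]. intros s Hs.
    specialize (IH s Hs).
    assert (H1 : 1 / 2 <= Cmod (1 + s)%C).
    { assert (Cmod (RtoC 1) <= Cmod (1 + s)%C + Cmod s).
      { replace (RtoC 1) with ((1 + s) + - s)%C at 1 by ring.
        eapply Rle_trans; [apply Cmod_triangle|]. rewrite Cmod_opp. lra. }
      rewrite Cmod_1 in H0. lra. }
    assert (Hnz : (1 + s)%C <> RtoC 0) by (apply Cmod_gt_0; lra).
    pose proof (Cpow_nz _ K Hnz).
    replace (/ (1 + s) ^ S K - 1 + RtoC (INR (S K)) * s)%C with
      ((/ (1 + s) ^ K - 1 + RtoC (INR K) * s + RtoC (INR K + 1) * (s * s)) * / (1 + s))%C.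
    2: { rewrite S_INR, !RtoC_plus, Cpow_S. set (u := ((1 + s) ^ K)%C) in *. field. auto. }
    rewrite Cmod_mult, Cmod_inv by auto.
    assert (Hi : / Cmod (1 + s)%C <= 2).
    { rewrite <- (Rinv_inv 2). apply Rinv_le_contravar; lra. }
    assert (Ht : Cmod (/ (1 + s) ^ K - 1 + RtoC (INR K) * s + RtoC (INR K + 1) * (s * s))%C <=
      M * (Cmod s * Cmod s) + (INR K + 1) * (Cmod s * Cmod s)).
    { eapply Rle_trans; [apply Cmod_triangle|]. rewrite !Cmod_mult, Cmod_R, Rabs_pos_eq by lra. lra. }
    replace ((2 * M + 2 * (INR K + 1)) * (Cmod s * Cmod s)) with
      ((M * (Cmod s * Cmod s) + (INR K + 1) * (Cmod s * Cmod s)) * 2) by ring.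
    apply Rmult_le_compat; auto; [apply Cmod_ge_0|]. left. apply Rinv_0_lt_compat; lra.
Qed.

Lemma is_derive_quad (f : C -> C) (z l : C) (d M : R) : 0 < d -> 0 <= M ->
  (forall h, Cmod h < d -> Cmod (f (z + h) - f z - h * l)%C <= M * (Cmod h * Cmod h)) ->
  is_derive (K := C_AbsRing) (V := C_NormedModule) f z l.
Proof.
  intros Hd HM H. split; [apply is_linear_scal_l|].
  assert (R1 : forall w : C, (z + (w - z))%C = w) by (intros; ring).
  intros x Hx eps. assert (E : z = x) by exact (is_filter_lim_locally_unique (V :=
    AbsRing_NormedModule C_AbsRing) z x Hx). subst x.
  assert (He : 0 < Rmin d (eps / (M + 1))).
  { apply Rmin_pos; auto. apply Rdiv_lt_0_compat; [apply cond_pos | lra]. }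
  exists (mkposreal _ He). intros w Hw.
  change (Cmod (w - z)%C < Rmin d (eps / (M + 1))) in Hw.
  pose proof (Rmin_l d (eps / (M + 1))). pose proof (Rmin_r d (eps / (M + 1))).
  specialize (H (w - z)%C ltac:(lra)). rewrite R1 in H.
  change (Cmod (f w - f z - (w - z) * l)%C <= eps * Cmod (w - z)%C).
  eapply Rle_trans; [apply H|]. rewrite <- Rmult_assoc. apply Rmult_le_compat_r; [apply Cmod_ge_0|].
  pose proof (Cmod_ge_0 (w - z)%C). pose proof (cond_pos eps).
  apply Rle_trans with (M * (eps / (M + 1))); [apply Rmult_le_compat_l; lra|].
  apply Rmult_le_reg_r with (M + 1); [lra|]. field_simplify; nra.
Qed.

(** Replacing z by z + h multiplies p z + q by 1 + s with s = p h / (p z + q), where |s| <= |h| / Im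
    z. The quadratic Taylor remainder of (1+s)^(-K) is uniform in the matrix, hence summable against
    the kernel itself. *)
Lemma kernel_form_derive K tau z : (6 <= K)%nat -> 0 < Im tau -> 0 < Im z ->
  ex_derive (K := C_AbsRing) (V := C_NormedModule) (kernel_form K tau) z.
Proof.
  intros HK Ht Hz. set (y := Im z) in *.
  destruct (kern_sum_le K tau z HK Ht Hz) as [M0 HM0].
  assert (HM0' : 0 <= M0) by (apply (HM0 nil); constructor).
  destruct (inv_pow_quad K) as [B [HB Hq]].
  set (u := fun g => (/ (lin tau (fst g) * z + lin tau (snd g)))%C).
  set (k' := fun g => (RtoC (- INR K) * (kern K tau z g * (lin tau (fst g) * u g)))%C).
  assert (Hpu : forall g, det g = 1%Z -> Cmod (lin tau (fst g) * u g)%C <= / y).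
  { intros g Hg. pose proof (linz_lower tau z g Ht Hz Hg) as [L1 _]. fold y in L1.
    pose proof (linz_nz tau z g Ht Hz Hg) as Hnz. unfold u. rewrite Cmod_mult, Cmod_inv by auto.
    apply Cmod_gt_0 in Hnz.
    apply Rmult_le_reg_r with y; auto. rewrite Rinv_l by lra.
    apply Rmult_le_reg_r with (Cmod (lin tau (fst g) * z + lin tau (snd g))%C); auto.
    rewrite Rmult_1_l. eapply Rle_trans; [|apply L1]. right. field. lra. }
  assert (Hk' : has_sum k' (Sum k')).
  { apply Sum_spec with (INR K * / y * M0).
    apply sum_le_mono with (fun g => INR K * / y * Cmod (kern K tau z g)).
    - intros g. unfold k'. rewrite !Cmod_mult, Cmod_R, Rabs_Ropp, Rabs_pos_eq by apply pos_INR.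
      rewrite Rmult_assoc. apply Rmult_le_compat_l; [apply pos_INR|].
      unfold kern. destruct (Z.eqb_spec (det g) 1) as [Hg|Hg].
      + rewrite Rmult_comm. apply Rmult_le_compat_r; [apply Cmod_ge_0|]. rewrite <- Cmod_mult. auto.
      + rewrite Cmod_0. lra.
    - apply sum_le_scal; auto. apply Rmult_le_pos; [apply pos_INR|]. left; apply Rinv_0_lt_compat;
      auto. }
  exists (Sum k').
  assert (Hyi : 0 < / y) by (apply Rinv_0_lt_compat; auto).
  (* The radius y/2 keeps |s| <= 1/2 and z + h in the upper half-plane. *)
  apply is_derive_quad with (y / 2) (B * (/ y * / y) * M0).
  - lra.
  - repeat apply Rmult_le_pos; auto; lra.
  - intros h Hh.
    assert (Hzh : 0 < Im (z + h)%C).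
    { change (0 < Im z + Im h). fold y. pose proof (Im_le_Cmod h) as Hi.
      apply Rabs_le_between in Hi. lra. }
    replace (B * (/ y * / y) * M0 * (Cmod h * Cmod h)) with
      (B * (/ y * / y) * (Cmod h * Cmod h) * M0) by ring.
    apply has_sum_bound with (f := fun g => (kern K tau (z + h) g + (RtoC (-1) * kern K tau z g +
      RtoC (-1) * (h * k' g)))%C).
    + apply sum_le_mono with (fun g => B * (/ y * / y) * (Cmod h * Cmod h) * Cmod (kern K tau z g)).
      * intros g. unfold k', kern. destruct (Z.eqb_spec (det g) 1) as [Hg|Hg].
        -- pose proof (linz_nz tau z g Ht Hz Hg) as Hnz. pose proof (linz_nz tau _ g Ht Hzh Hg) as Hnzh.
           set (s := (lin tau (fst g) * u g * h)%C).
           assert (Hs : Cmod s <= / y * Cmod h).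
           { unfold s. rewrite Cmod_mult. apply Rmult_le_compat_r; [apply Cmod_ge_0 | auto]. }
           assert (Hs2 : Cmod s <= 1 / 2).
           { eapply Rle_trans; [apply Hs|]. apply Rmult_le_reg_l with y; auto.
             rewrite <- Rmult_assoc, Rinv_r; lra. }
           specialize (Hq s Hs2).
           assert (E : (lin tau (fst g) * (z + h) + lin tau (snd g))%C =
             ((lin tau (fst g) * z + lin tau (snd g)) * (1 + s))%C).
           { unfold s, u. field. auto. }
           assert (H1s : (1 + s)%C <> RtoC 0).
           { intros E0. rewrite E, E0 in Hnzh. apply Hnzh. ring. }
           rewrite E, Cpow_mult_l.
           match goal with |- Cmod ?w <= _ => replace w with
             (/ (lin tau (fst g) * z + lin tau (snd g)) ^ K * (/ (1 + s) ^ K - 1 + RtoC (INR K) *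
               s))%C end.
           ++ rewrite Cmod_mult, Rmult_comm. apply Rmult_le_compat_r; [apply Cmod_ge_0|].
              eapply Rle_trans; [apply Hq|]. rewrite Rmult_assoc. apply Rmult_le_compat_l; auto.
              replace (/ y * / y * (Cmod h * Cmod h)) with (/ y * Cmod h * (/ y * Cmod h)) by ring.
              apply Rmult_le_compat; auto using Cmod_ge_0.
           ++ pose proof (Cpow_nz _ K Hnz). pose proof (Cpow_nz _ K H1s).
              unfold s at 2. set (v := ((lin tau (fst g) * z + lin tau (snd g)) ^ K)%C) in *.
              set (v1 := ((1 + s) ^ K)%C) in *. rewrite RtoC_opp. field. auto.
        -- rewrite Cmod_0. match goal with |- Cmod ?w <= _ => replace w with (RtoC 0) by ring end.
           rewrite Cmod_0. lra.
      * apply sum_le_scal; auto. repeat apply Rmult_le_pos; auto using Cmod_ge_0; lra.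
    + replace (kernel_form K tau (z + h) - kernel_form K tau z - h * Sum k')%C with
        (kernel_form K tau (z + h) + (RtoC (-1) * kernel_form K tau z + RtoC (-1) * (h * Sum
          k')))%C by ring.
      apply has_sum_plus; [apply kernel_form_sum; auto|].
      apply has_sum_plus; apply has_sum_scal; [apply kernel_form_sum; auto | apply has_sum_scal; auto].
Qed.

(** * Fourier expansion of the kernel forms *)

Definition primitive_pair (p : Z * Z) : Prop := exists q, det (p, q) = 1%Z.

(** One chosen second column for the first column [p]. All others are obtained from it by adding
    integer multiples of [p], which is the coset decomposition modulo z -> z + 1. *)
Definition completion (p : Z * Z) : Z * Z := epsilon (inhabits (0, 0)%Z) (fun q => det (p, q) = 1%Z).

Lemma completion_spec p : primitive_pair p -> det (p, completion p) = 1%Z.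
Proof. intros H. exact (epsilon_spec (inhabits (0, 0)%Z) (fun q => det (p, q) = 1%Z) H). Qed.

(** A term of the Poincare series of index m in the variable tau. Another completion changes the
    argument of [qpar] by an integer, so the value does not depend on the choice. *)
Definition poincare_term (K : nat) (tau : C) (m : nat) (p : Z * Z) : C :=
  if excluded_middle_informative (primitive_pair p)
  then (/ lin tau p ^ K * qpar (lin tau (completion p) / lin tau p) ^ m)%C else RtoC 0.

Definition kernel_coef (K : nat) (tau : C) (m : nat) : C :=
  (Lconst (K - 1) * RtoC (INR m ^ (K - 1)) * Sum (poincare_term K tau m))%C.

Lemma Cmod_qpar_le_1 (z : C) : 0 <= Im z -> Cmod (qpar z) <= 1.
Proof.
  intros [H|H]; [left; apply Cmod_qpar_lt_1; auto|].
  rewrite Cmod_qpar, <- H, Rmult_0_r, Ropp_0, exp_0. lra.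
Qed.

(** By Lipschitz's formula in each row, the matrix sum [G] and the double series [h] over pairs (p,
    m) have the same row sums [row]; hence their totals agree. Summing [h] over p before m then
    gives the coefficients. *)
Lemma kernel_form_qexp K tau z : (6 <= K)%nat -> 0 < Im tau -> 0 < Im z ->
  has_sum (fun m : nat => kernel_coef K tau m * qpar z ^ m)%C (kernel_form K tau z).
Proof.
  intros HK Ht Hz.
  set (k := (K - 1)%nat). assert (HKk : K = S k) by (unfold k; lia).
  destruct (lin_pow_wt2 tau K Ht ltac:(lia)) as [M1 [HM1 H1]].
  set (G := fun x : (Z * Z) * Z => let '(p, n) := x in
    if excluded_middle_informative (primitive_pair p)
    then (/ (lin tau p * z + lin tau (completion p) + ZtoC n * lin tau p) ^ K)%C else RtoC 0).
  assert (HG : has_sum G (kernel_form K tau z)).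
  { apply has_sum_reindex with (f := kern K tau z)
      (phi := fun x : (Z * Z) * Z => let '(p, n) := x in
         (p, (fst (completion p) + n * fst p, snd (completion p) + n * snd p)%Z))
      (psi := fun g : (Z * Z) * (Z * Z) => (fst g,
        (snd (completion (fst g)) * fst (snd g) - fst (completion (fst g)) * snd (snd g))%Z)).
    - intros [p q] Hk0. unfold kern in Hk0. destruct (Z.eqb_spec (det (p, q)) 1) as [Hg|Hg];
      [|congruence].
      assert (Hc : primitive_pair p) by (exists q; auto). pose proof (completion_spec p Hc) as Hq0.
      cbn [fst snd]. set (n := (snd (completion p) * fst q - fst (completion p) * snd q)%Z).
      assert (Eq : (fst (completion p) + n * fst p, snd (completion p) + n * snd p)%Z = q).
      { unfold n, det in *. destruct p as [a c], q as [b d]. destruct (completion (a, c)) as [b0 d0].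
        cbn [fst snd] in *. f_equal.
        - transitivity (b0 + (a * d0 - c * b0) * b - b0 * (a * d - c * b))%Z;
          [ring|]. rewrite Hq0, Hg. ring.
        - transitivity (d0 + (a * d0 - c * b0) * d - d0 * (a * d - c * b))%Z;
          [ring|]. rewrite Hq0, Hg. ring. }
      split; [|rewrite Eq; auto].
      unfold G, kern. destruct (excluded_middle_informative (primitive_pair p)); [|tauto].
      destruct (Z.eqb_spec (det (p, q)) 1); [|tauto]. cbn [fst snd].
      replace (lin tau q) with (lin tau (completion p) + ZtoC n * lin tau p)%C;
        [rewrite Cplus_assoc; reflexivity|].
      transitivity (lin tau (fst (completion p) + n * fst p, snd (completion p) + n * snd p)%Z);
        [|rewrite Eq; auto].
      clearbody n. unfold lin, ZtoC; simpl fst; simpl snd.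
      rewrite !plus_IZR, !mult_IZR, !RtoC_plus, !RtoC_mult. ring.
    - intros [p n]. unfold G. destruct (excluded_middle_informative (primitive_pair p)) as [Hc|];
      [|tauto]. intros _.
      pose proof (completion_spec p Hc) as Hq0. cbn [fst snd].
      split.
      + unfold kern.
        assert (Hdet : det (p, (fst (completion p) + n * fst p,
          snd (completion p) + n * snd p)%Z) = 1%Z).
        { rewrite <- Hq0. unfold det; simpl. ring. }
        rewrite Hdet. simpl Z.eqb. cbv iota. cbn [fst snd]. do 2 f_equal.
        unfold lin, ZtoC; simpl fst; simpl snd.
        rewrite !plus_IZR, !mult_IZR, !RtoC_plus, !RtoC_mult. ring.
      + f_equal. unfold det in Hq0. cbn [fst snd] in Hq0.
        transitivity (n * (fst p * snd (completion p) - snd p * fst (completion p)))%Z;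
          [ring|]. rewrite Hq0. ring.
    - apply kernel_form_sum; auto. }
  set (h := fun x : (Z * Z) * nat =>
    (Lconst k * RtoC (INR (snd x) ^ k) * qpar z ^ snd x * poincare_term K tau (snd x) (fst x))%C).
  assert (HPb : forall p m, Cmod (poincare_term K tau m p) <= M1 * wt2 p).
  { intros p m. unfold poincare_term. pose proof (wt2_pos p).
    destruct (excluded_middle_informative (primitive_pair p)) as [Hc|]; [|rewrite Cmod_0; nra].
    pose proof (completion_spec p Hc) as Hq0. pose proof (Im_ratio tau _ Ht Hq0) as Hi.
      cbn [fst snd] in Hi.
    destruct (det_nz _ Hq0) as [Hp _]. cbn [fst] in Hp. pose proof (lin_nz tau p Ht Hp) as Np.
    rewrite Cmod_mult, Cmod_inv, !Cmod_pow by (apply Cpow_nz; auto).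
    specialize (H1 p Hp). rewrite <- (Rmult_1_r (M1 * wt2 p)). apply Rmult_le_compat; auto.
    - left. apply Rinv_0_lt_compat, pow_lt, Cmod_gt_0; auto.
    - apply pow_le, Cmod_ge_0.
    - rewrite <- (pow1 m). apply pow_incr. split; [apply Cmod_ge_0|]. apply Cmod_qpar_le_1. lra. }
  assert (HPs : forall m, has_sum (poincare_term K tau m) (Sum (poincare_term K tau m))).
  { intros m. apply Sum_spec with (M1 * (16 * 16)). apply sum_le_mono with (fun p => M1 * wt2 p); auto.
    apply sum_le_scal; auto. apply wt2_sum. }
  destruct (pow_geom_sum k (Cmod (qpar z))) as [M2 HM2].
  { split; [apply Cmod_ge_0 | apply Cmod_qpar_lt_1; auto]. }
  assert (Hh : exists s, has_sum h s).
  { apply has_sum_ex with (Cmod (Lconst k) * M1 * (M2 * (16 * 16))).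
    apply sum_le_mono with (fun x => Cmod (Lconst k) * M1 * (wt2 (fst x) * (INR (snd x) ^ k * Cmod
      (qpar z) ^ snd x))).
    - intros [p m]. unfold h. cbn [fst snd]. rewrite !Cmod_mult, Cmod_pow, Cmod_R.
      rewrite (Rabs_pos_eq (INR m ^ k)) by apply pow_le, pos_INR.
      replace (Cmod (Lconst k) * M1 * (wt2 p * (INR m ^ k * Cmod (qpar z) ^ m))) with
        (Cmod (Lconst k) * INR m ^ k * Cmod (qpar z) ^ m * (M1 * wt2 p)) by ring.
      apply Rmult_le_compat_l; auto.
      apply Rmult_le_pos; [|apply pow_le, Cmod_ge_0].
      apply Rmult_le_pos; [apply Cmod_ge_0 | apply pow_le, pos_INR].
    - apply sum_le_scal; [apply Rmult_le_pos; auto; apply Cmod_ge_0|].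
      apply (sum_le_mult wt2 (fun m : nat => INR m ^ k * Cmod (qpar z) ^ m)); auto using wt2_sum.
      + intros; left; apply wt2_pos.
      + intros m. apply Rmult_le_pos; apply pow_le; [apply pos_INR | apply Cmod_ge_0]. }
  destruct Hh as [T HT].
  set (row := fun p => if excluded_middle_informative (primitive_pair p)
     then (/ lin tau p ^ K * (Lconst k * Sum (fun m : nat => RtoC (INR m ^ k) * qpar (z + lin tau
       (completion p) / lin tau p) ^ m)))%C
     else RtoC 0).
  assert (Hrow0 : forall p, primitive_pair p -> 0 < Im (z + lin tau (completion p) / lin tau p)%C
    /\ lin tau p <> RtoC 0).
  { intros p Hc. pose proof (completion_spec p Hc) as Hq0.
    pose proof (Im_ratio tau _ Ht Hq0) as Hi. cbn [fst snd] in Hi.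
    destruct (det_nz _ Hq0) as [Hp _]. cbn [fst] in Hp. split; [|apply lin_nz; auto].
    change (0 < Im z + Im (lin tau (completion p) / lin tau p)%C). lra. }
  assert (HS : forall w, 0 < Im w -> has_sum (fun m : nat => RtoC (INR m ^ k) * qpar w ^ m)%C (Sum
    (fun m : nat => RtoC (INR m ^ k) * qpar w ^ m)%C)).
  { intros w Hw. unfold Sum. apply epsilon_spec. apply qser_ex; auto. }
  assert (HrowF : has_sum row (kernel_form K tau z)).
  { apply has_sum_Fubini with (f := G); auto. intros p. unfold G, row.
    destruct (excluded_middle_informative (primitive_pair p)) as [Hc|]; [|apply has_sum_zero].
    destruct (Hrow0 p Hc) as [Hw Np].
    pose proof (Lipschitz k _ _ ltac:(lia) Hw (HS _ Hw)) as HL.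
    apply has_sum_ext with (2 := has_sum_scal (/ lin tau p ^ K)%C _ _ HL).
    intros n. rewrite <- HKk.
    assert (Nn : (ZtoC n + (z + lin tau (completion p) / lin tau p))%C <> RtoC 0).
    { apply Im_pos_nz. rewrite Im_plus_Z. auto. }
    replace (lin tau p * z + lin tau (completion p) + ZtoC n * lin tau p)%C with
      (lin tau p * (ZtoC n + (z + lin tau (completion p) / lin tau p)))%C by (field; auto).
    rewrite Cpow_mult_l. pose proof (Cpow_nz _ K Np). pose proof (Cpow_nz _ K Nn).
    set (u := (lin tau p ^ K)%C) in *.
      set (v := ((ZtoC n + (z + lin tau (completion p) / lin tau p)) ^ K)%C) in *.
    field; auto. }
  assert (HrowT : has_sum row T).
  { apply has_sum_Fubini with (f := h); auto. intros p. unfold h, row, poincare_term. cbn [fst snd].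
    destruct (excluded_middle_informative (primitive_pair p)) as [Hc|].
    - destruct (Hrow0 p Hc) as [Hw Np].
      apply has_sum_ext with (2 := has_sum_scal (/ lin tau p ^ K)%C _ _ (has_sum_scal (Lconst k) _
        _ (HS _ Hw))).
      intros m. rewrite qpar_plus, Cpow_mult_l. ring.
    - apply has_sum_ext with (2 := has_sum_zero). intros m. ring. }
  rewrite (has_sum_unique _ _ _ HrowF HrowT).
  refine (has_sum_Fubini _ _ _ (has_sum_swap h T HT) _). intros m.
  replace (kernel_coef K tau m * qpar z ^ m)%C with
    (Lconst k * RtoC (INR m ^ k) * qpar z ^ m * Sum (poincare_term K tau m))%C by (unfold
      kernel_coef; fold k; ring).
  exact (has_sum_scal (Lconst k * RtoC (INR m ^ k) * qpar z ^ m)%C _ _ (HPs m)).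
Qed.

(** The expansion is stated again as an unconditional sum beside the form, because the field
    [cf_qexp] records ordered convergence while the computation of the twist works with
    [has_sum]. *)
Lemma kernel_cusp_form K tau : (6 <= K)%nat -> 0 < Im tau -> exists f : cusp_form K,
  forall z, 0 < Im z -> has_sum (fun m : nat => cf_coef f m * qpar z ^ m)%C (kernel_form K tau z).
Proof.
  intros HK Ht.
  unshelve eexists (Build_cusp_form K (kernel_form K tau) (kernel_coef K tau) _ _ _ _).
  - intros z Hz. apply kernel_form_derive; auto.
  - apply kernel_form_modular; auto.
  - unfold kernel_coef. replace (K - 1)%nat with (S (K - 2)) by lia. simpl. rewrite Rmult_0_l. ring.
  - intros z Hz. apply has_sum_is_series. apply kernel_form_qexp; auto.
  - intros z Hz. simpl. apply kernel_form_qexp; auto.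
Qed.

Lemma CSeries_has_sum (u : nat -> C) s : has_sum u s -> CSeries u = s.
Proof.
  intros H. apply has_sum_is_series in H. unfold is_series in H.
  assert (E1 : forall n, Re (sum_n (G := C_AbelianMonoid) u n) = sum_n (fun i => Re (u i)) n).
  { induction n as [|n IH]; [rewrite !sum_O; auto|]. rewrite !sum_Sn, <- IH. reflexivity. }
  assert (E2 : forall n, Im (sum_n (G := C_AbelianMonoid) u n) = sum_n (fun i => Im (u i)) n).
  { induction n as [|n IH]; [rewrite !sum_O; auto|]. rewrite !sum_Sn, <- IH. reflexivity. }
  unfold CSeries. destruct s as [s1 s2].
  pose proof (proj1 (filterlim_locally (U := C_UniformSpace) _ _) H) as H'.
  f_equal; apply is_series_unique; apply filterlim_locally; intros eps.
  - generalize (H' eps). apply filter_imp. intros n [B1 _]. rewrite <- E1. exact B1.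
  - generalize (H' eps). apply filter_imp. intros n [_ B2]. rewrite <- E2. exact B2.
Qed.

(** Multiplying the coefficients by an additive character n -> e(n r / D) amounts to translating z
    by r / D; [chi] is expanded in such characters. *)
Lemma twist_sum K tau (f : cusp_form K) (D : nat) (chi : Z -> C) (psi : nat -> C) z : (0 < D)%nat ->
  (forall w, 0 < Im w -> has_sum (fun m : nat => cf_coef f m * qpar w ^ m)%C (kernel_form K tau w))
    -> 0 < Im z ->
  (forall n : nat, chi (Z.of_nat n) = lsum (fun r => psi r * qpar (RtoC (INR n * INR r / INR D)))%C
    (seq 0 D)) ->
  twist chi f z = lsum (fun r => psi r * kernel_form K tau (z + RtoC (INR r / INR D)))%C (seq 0 D).
Proof.
  intros HD Hf Hz Hchi. apply CSeries_has_sum.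
  assert (H : forall r, In r (seq 0 D) -> has_sum
    (fun m : nat => psi r * (cf_coef f m * qpar (z + RtoC (INR r / INR D)) ^ m))%C (psi r *
      kernel_form K tau (z + RtoC (INR r / INR D)))%C).
  { intros r _. apply has_sum_scal, Hf. change (0 < Im z + 0). lra. }
  apply has_sum_ext with (2 := has_sum_lsum _ _ _ H). intros m.
  rewrite Hchi. rewrite <- Cmult_assoc, (Cmult_comm _ (cf_coef f m * qpar z ^ m)), <- lsum_scal.
  apply lsum_ext. intros r _. rewrite !qpar_pow, Cmult_plus_distr_l, qpar_plus.
  replace (RtoC (INR m) * RtoC (INR r / INR D))%C with (RtoC (INR m * INR r / INR D)).
  - ring.
  - rewrite <- RtoC_mult. f_equal. unfold Rdiv. ring.
Qed.

(** * Calculus of complex valued functions of a real variable *)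

(** Componentwise, so that real differentiation and the real fundamental theorem of calculus
    apply. *)
Definition is_derive_RC (f : R -> C) (t : R) (l : C) : Prop :=
  is_derive (fun s => Re (f s)) t (Re l) /\ is_derive (fun s => Im (f s)) t (Im l).

Lemma is_derive_RC_eq f t l l' : l = l' -> is_derive_RC f t l -> is_derive_RC f t l'.
Proof. intros ->; auto. Qed.

Lemma is_derive_RC_const c t : is_derive_RC (fun _ => c) t (RtoC 0).
Proof. split; apply (is_derive_const (V := R_NormedModule)). Qed.

Lemma is_derive_RC_lin (c : C) t : is_derive_RC (fun s => Ci * RtoC s * c)%C t (Ci * c)%C.
Proof. destruct c as [x y]. split; simpl; auto_derive; auto; ring. Qed.

Lemma is_derive_RC_plus f g t (a b : C) : is_derive_RC f t a -> is_derive_RC g t b -> is_derive_RC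
  (fun s => f s + g s)%C t (a + b)%C.
Proof.
  intros [H1 H2] [H3 H4]. split.
  - apply (is_derive_plus (V := R_NormedModule) (fun s => Re (f s)) (fun s => Re (g s))); auto.
  - apply (is_derive_plus (V := R_NormedModule) (fun s => Im (f s)) (fun s => Im (g s))); auto.
Qed.

Lemma is_derive_RC_mult f g t (a b : C) :
  is_derive_RC f t a -> is_derive_RC g t b -> is_derive_RC (fun s => f s * g s)%C t (a * g t + f t
    * b)%C.
Proof.
  assert (P : forall (u v w x : R -> R) a b c d, is_derive u t a -> is_derive v t b ->
    is_derive w t c -> is_derive x t d ->
    is_derive (fun s => u s * v s + w s * x s) t (a * v t + u t * b + (c * x t + w t * d))).
  { intros u v w x a' b' c d H1 H2 H3 H4. auto_derive; [repeat split; eexists; eauto|].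
    rewrite (is_derive_unique (fun x : R => u x) _ _ H1), (is_derive_unique (fun x : R => v x) _ _ H2),
      (is_derive_unique (fun x : R => w x) _ _ H3), (is_derive_unique (fun s : R => x s) _ _ H4). ring. }
  intros [H1 H2] [H3 H4]. split.
  - pose proof (is_derive_opp (V := R_NormedModule) (fun s => Im (f s)) t (Im a) H2) as H2'.
    apply (is_derive_ext (fun s => Re (f s) * Re (g s) + - Im (f s) * Im (g s))).
    + intros s. simpl. unfold Re, Im. ring.
    + replace (Re (a * g t + f t * b)%C) with
        (Re a * Re (g t) + Re (f t) * Re b + (- Im a * Im (g t) + - Im (f t) * Im b))
        by (simpl; unfold Re, Im; ring).
      exact (P _ _ _ _ _ _ _ _ H1 H3 H2' H4).
  - apply (is_derive_ext (fun s => Re (f s) * Im (g s) + Im (f s) * Re (g s))).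
    + intros s. simpl. unfold Re, Im. ring.
    + replace (Im (a * g t + f t * b)%C) with
        (Re a * Im (g t) + Re (f t) * Im b + (Im a * Re (g t) + Im (f t) * Re b))
        by (simpl; unfold Re, Im; ring).
      exact (P _ _ _ _ _ _ _ _ H1 H4 H2 H3).
Qed.

Lemma is_derive_RC_inv f t (a : C) : f t <> RtoC 0 -> is_derive_RC f t a -> is_derive_RC (fun s =>
  / f s)%C t (- a / (f t * f t))%C.
Proof.
  assert (P : forall (u v : R -> R) a b, u t ^ 2 + v t ^ 2 <> 0 -> is_derive u t a -> is_derive v t b ->
    is_derive (fun s => u s / (u s ^ 2 + v s ^ 2)) t
      ((a * (v t ^ 2 - u t ^ 2) - 2 * u t * v t * b) / (u t ^ 2 + v t ^ 2) ^ 2) /\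
    is_derive (fun s => - v s / (u s ^ 2 + v s ^ 2)) t
      ((b * (v t ^ 2 - u t ^ 2) + 2 * u t * v t * a) / (u t ^ 2 + v t ^ 2) ^ 2)).
  { intros u v a' b' HN H1 H2. split; (auto_derive;
      [repeat split; try (eexists; eauto); intros Hc; apply HN; simpl; lra|]);
      rewrite (is_derive_unique (fun x : R => u x) _ _ H1), (is_derive_unique (fun x : R => v x) _ _ H2);
      field; simpl in HN; intros Hc; apply HN; simpl; lra. }
  intros Hnz [H1 H2].
  assert (HN : Re (f t) ^ 2 + Im (f t) ^ 2 <> 0).
  { rewrite <- Cmod2_alt. apply Cmod_gt_0 in Hnz. apply pow_nonzero. lra. }
  assert (E : (- a / (f t * f t))%C =
    ((Re a * (Im (f t) ^ 2 - Re (f t) ^ 2) - 2 * Re (f t) * Im (f t) * Im a) / (Re (f t) ^ 2 + Im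
      (f t) ^ 2) ^ 2,
     (Im a * (Im (f t) ^ 2 - Re (f t) ^ 2) + 2 * Re (f t) * Im (f t) * Re a) / (Re (f t) ^ 2 + Im
       (f t) ^ 2) ^ 2)).
  { destruct (f t) as [x y], a as [u v]. unfold Re, Im in *. cbn [fst snd] in *.
    assert (HN4 : (x * x - y * y) ^ 2 + (x * y + y * x) ^ 2 <> 0).
    { replace ((x * x - y * y) ^ 2 + (x * y + y * x) ^ 2) with ((x ^ 2 + y ^ 2) ^ 2) by ring.
      apply pow_nonzero; auto. }
    unfold Cdiv, Cinv, Cmult, Copp. cbn [fst snd].
    apply injective_projections; cbn [fst snd]; field; auto. }
  destruct (P _ _ _ _ HN H1 H2) as [P1 P2]. split; rewrite E; [exact P1 | exact P2].
Qed.

Lemma is_derive_RC_pow f t (a : C) n : is_derive_RC f t a -> is_derive_RC (fun s => f s ^ S n)%C t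
  (RtoC (INR (S n)) * f t ^ n * a)%C.
Proof.
  intros H. induction n as [|n IH].
  - eapply is_derive_RC_eq; [|apply (is_derive_RC_mult f (fun _ => RtoC 1) t a (RtoC 0) H
    (is_derive_RC_const _ _))].
    simpl. ring.
  - eapply is_derive_RC_eq; [|apply (is_derive_RC_mult f (fun s => f s ^ S n)%C t _ _ H IH)].
    rewrite (S_INR (S n)), RtoC_plus. cbn [Cpow]. ring.
Qed.

Lemma is_derive_RC_pow_ex f t (a : C) n : is_derive_RC f t a -> exists l,
  is_derive_RC (fun s => f s ^ n)%C t l.
Proof.
  intros H. destruct n as [|n].
  - exists (RtoC 0). exact (is_derive_RC_const (RtoC 1) t).
  - eexists. exact (is_derive_RC_pow f t a n H).
Qed.

Lemma is_RInt_derive_RC (f df : R -> C) (a b : R) : a <= b ->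
  (forall t, a <= t <= b -> is_derive_RC f t (df t)) -> (forall t, a <= t <= b -> exists l,
    is_derive_RC df t l) ->
  is_RInt (V := C_R_NormedModule) df a b (f b - f a)%C.
Proof.
  intros Hab H Hc. apply (is_RInt_fct_extend_pair (U := R_NormedModule) (V := R_NormedModule)).
  - apply (is_RInt_derive (V := R_CompleteNormedModule) (fun s => Re (f s)) (fun s => Re (df s)));
      rewrite Rmin_left, Rmax_right by auto; intros t Ht.
    + apply H; auto.
    + destruct (Hc t Ht) as [l [Hl _]].
      exact (ex_derive_continuous (K := R_AbsRing) (V := R_NormedModule) _ t (ex_intro _ _ Hl)).
  - apply (is_RInt_derive (V := R_CompleteNormedModule) (fun s => Im (f s)) (fun s => Im (df s)));
      rewrite Rmin_left, Rmax_right by auto; intros t Ht.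
    + apply H; auto.
    + destruct (Hc t Ht) as [l [_ Hl]].
      exact (ex_derive_continuous (K := R_AbsRing) (V := R_NormedModule) _ t (ex_intro _ _ Hl)).
Qed.

(* A primitive of [s^(l-1) (1-s)^m] with value at 1 the Beta integral B(l, m+1), together
   with the chain rule along curves. *)
Lemma Beta_primitive m : forall l, (1 <= l)%nat -> exists (Phi : C -> C) (b M : R),
  0 < b /\ Phi (RtoC 0) = RtoC 0 /\ Phi (RtoC 1) = RtoC b /\ 0 <= M /\
  (forall s, Cmod s <= 1 -> Cmod (Phi s) <= M) /\
  (forall x t x', is_derive_RC x t x' -> is_derive_RC (fun s => Phi (x s)) t (x t ^ (l - 1) * (1 -
    x t) ^ m * x')%C) /\
  (forall (F : (R -> Prop) -> Prop) (FF : Filter F) (x : R -> C) a,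
    tends F x a -> tends F (fun s => Phi (x s)) (Phi a)).
Proof.
  induction m as [|m IH]; intros l Hl; assert (HlR : 0 < INR l) by (apply lt_0_INR; lia);
    assert (HlC : RtoC (INR l) <> RtoC 0) by (apply INR_C_nz; lia).
  - exists (fun s => / RtoC (INR l) * s ^ l)%C, (/ INR l), (/ INR l).
    assert (Hil : 0 < / INR l) by (apply Rinv_0_lt_compat; auto).
    split; [auto|].
    split; [destruct l; [lia|]; rewrite Cpow_S; ring|].
    split; [rewrite Cpow_1_l, RtoC_inv by lra; ring|].
    split; [lra|].
    split; [|split].
    + intros s Hs. rewrite Cmod_mult, Cmod_inv, Cmod_INR, Cmod_pow by auto.
      rewrite <- (Rmult_1_r (/ INR l)) at 2. apply Rmult_le_compat_l; [lra|].
      rewrite <- (pow1 l). apply pow_incr. split; auto; apply Cmod_ge_0.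
    + intros x t x' H. destruct l as [|l]; [lia|]. pose proof (is_derive_RC_pow x t x' l H) as H1.
      pose proof (is_derive_RC_mult _ _ t _ _ (is_derive_RC_const (/ RtoC (INR (S l)))%C t) H1) as H2.
      eapply is_derive_RC_eq; [|apply H2]. cbv beta. replace (S l - 1)%nat with l by lia. cbn [Cpow].
      field. auto.
    + intros F FF x a Hx. apply (tends_mult F); [apply (tends_const F) | apply (tends_pow F); auto].
  - destruct (IH (S l) ltac:(lia)) as [Phi [b [M [Hb [H0 [H1 [HM [HB [HD HT]]]]]]]]].
    pose proof (pos_INR m) as Hm.
    (* Integration by parts: l s^(l-1) (1-s)^(m+1) is the derivative of s^l (1-s)^(m+1) plus (m+1)
       s^l (1-s)^m, the integrand for l + 1 and m. This is why [l] is quantified inside the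
       induction. *)
    exists (fun s => / RtoC (INR l) * (s ^ l * (1 - s) ^ S m + RtoC (INR m + 1) * Phi s))%C,
      ((INR m + 1) * b / INR l), ((2 ^ S m + (INR m + 1) * M) / INR l).
    assert (Hil : 0 < / INR l) by (apply Rinv_0_lt_compat; auto).
    assert (H2m : 0 < 2 ^ S m) by (apply pow_lt; lra).
    split; [apply Rdiv_lt_0_compat; nra|].
    split; [rewrite H0; destruct l; [lia|]; rewrite !Cpow_S; ring|].
    split.
    { rewrite H1. unfold Rdiv. rewrite !RtoC_mult, RtoC_inv by lra. rewrite Cpow_S. ring. }
    split; [apply Rdiv_le_0_compat; auto; nra|].
    split.
    { intros s Hs. rewrite Cmod_mult, Cmod_inv, Cmod_INR by auto. unfold Rdiv. rewrite Rmult_comm.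
      apply Rmult_le_compat_r; [lra|]. eapply Rle_trans; [apply Cmod_triangle|].
      rewrite !Cmod_mult, !Cmod_pow, Cmod_R, Rabs_pos_eq by lra.
      assert (Cmod (1 - s)%C <= 2).
      { replace (1 - s)%C with (1 + - s)%C by ring. eapply Rle_trans; [apply Cmod_triangle|].
        rewrite Cmod_1, Cmod_opp. lra. }
      apply Rplus_le_compat.
      - rewrite <- (Rmult_1_l (2 ^ S m)). apply Rmult_le_compat; try (apply pow_le, Cmod_ge_0).
        + rewrite <- (pow1 l). apply pow_incr. split; auto; apply Cmod_ge_0.
        + apply pow_incr. split; auto; apply Cmod_ge_0.
      - apply Rmult_le_compat_l; [lra | auto]. }
    split.
    + intros x t x' Hx. destruct l as [|l]; [lia|].
      assert (H1x : is_derive_RC (fun s => 1 - x s)%C t (- x')%C).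
      { eapply is_derive_RC_eq; [|apply (is_derive_RC_plus (fun _ => RtoC 1) (fun s => - x s)%C t
        (RtoC 0) (- x')%C)].
        - ring.
        - apply is_derive_RC_const.
        - destruct Hx as [Hx1 Hx2]. split.
          + apply (is_derive_opp (V := R_NormedModule) (fun s => Re (x s)) t (Re x')); auto.
          + apply (is_derive_opp (V := R_NormedModule) (fun s => Im (x s)) t (Im x')); auto. }
      pose proof (is_derive_RC_pow _ t _ l Hx) as P1. pose proof (is_derive_RC_pow _ t _ m H1x) as P2.
      pose proof (is_derive_RC_mult _ _ t _ _ P1 P2) as P3. cbv beta in P3.
      pose proof (is_derive_RC_mult _ _ t _ _ (is_derive_RC_const (RtoC (INR m + 1)) t) (HD x t x'
        Hx)) as P4. cbv beta in P4.
      pose proof (is_derive_RC_mult _ _ t _ _ (is_derive_RC_const (/ RtoC (INR (S l)))%C t)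
        (is_derive_RC_plus _ _ t _ _ P3 P4)) as P5.
      eapply is_derive_RC_eq; [|apply P5]. cbv beta. replace (S (S l) - 1)%nat with (S l) by lia.
      replace (S l - 1)%nat with l by lia. rewrite (S_INR m), !Cpow_S.
      set (u := (x t ^ l)%C). set (v := ((1 - x t) ^ m)%C). field. auto.
    + intros F FF x a Hx. apply (tends_mult F); [apply (tends_const F)|]. apply (tends_plus F).
      * apply (tends_mult F); apply (tends_pow F); auto.
        assert (E : tends F (fun s => RtoC 1 + RtoC (-1) * x s)%C (RtoC 1 + RtoC (-1) * a)%C).
        { apply (tends_plus F); [apply (tends_const F)|]. apply (tends_mult F);
          auto. apply (tends_const F). }
        replace (1 - a)%C with (RtoC 1 + RtoC (-1) * a)%C by ring.
        refine (tends_ext_loc F _ _ _ _ E). apply filter_forall. intros s. ring.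
      * apply (tends_mult F); [apply (tends_const F) | apply HT; auto].
Qed.

Lemma is_RInt_lsum {I : Type} (f : I -> R -> C) (J : I -> C) (a b : R) (l : list I) :
  (forall i, is_RInt (V := C_R_NormedModule) (f i) a b (J i)) ->
  is_RInt (V := C_R_NormedModule) (fun t => lsum (fun i => f i t) l) a b (lsum J l).
Proof.
  intros H. induction l as [|i l IH]; simpl.
  - pose proof (is_RInt_const (V := C_R_NormedModule) a b (RtoC 0)) as E.
    assert (E0 : scal (b - a) (RtoC 0 : C_R_NormedModule) = (RtoC 0 : C_R_NormedModule));
      [|rewrite E0 in E; exact E].
    unfold scal; simpl. unfold prod_scal; simpl. unfold scal; simpl. unfold mult; simpl.
    unfold RtoC. f_equal; ring.
  - apply (is_RInt_plus (V := C_R_NormedModule) (f i)); auto.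
Qed.

Lemma Cmod_lt_ball (x y : C) eps : Cmod (y - x)%C < eps -> ball (M := C_UniformSpace) x eps y.
Proof. apply C_NormedModule_mixin_compat1. Qed.

(** Termwise integration under one summable majorant for the terms and their integrals. The theorem
    on uniform limits is applied to partial sums over lists [L n] whose tails are at most 1/(n+1), a
    single sequence serving both series. *)
Lemma is_RInt_has_sum {I : Type} (f : I -> R -> C) (S : R -> C) (J : I -> C) s (m : I -> R) M (a b : R) :
  a <= b -> sum_le m M -> (forall i t, a <= t <= b -> Cmod (f i t) <= m i) ->
  (forall i, Cmod (J i) <= m i) ->
  (forall i, is_RInt (V := C_R_NormedModule) (f i) a b (J i)) ->
  (forall t, a <= t <= b -> has_sum (fun i => f i t) (S t)) -> has_sum J s ->
  is_RInt (V := C_R_NormedModule) S a b s.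
Proof.
  intros Hab HM Hf HJ HI HS Hs.
  assert (Hm : forall i, 0 <= m i) by (intros i; eapply Rle_trans; [apply Cmod_ge_0 | apply (HJ i)]).
  assert (Hch : forall n : nat, exists l0, NoDup l0 /\
    forall l, NoDup l -> (forall i, In i l -> ~ In i l0) -> rsum m l <= / INR (n + 1)).
  { intros n. apply (sum_le_tail m M Hm HM). apply Rinv_0_lt_compat, lt_0_INR. lia. }
  set (L := fun n => epsilon (inhabits nil) (fun l0 => NoDup l0 /\
    forall l, NoDup l -> (forall i, In i l -> ~ In i l0) -> rsum m l <= / INR (n + 1))).
  assert (HL : forall n, NoDup (L n) /\
    forall l, NoDup l -> (forall i, In i l -> ~ In i (L n)) -> rsum m l <= / INR (n + 1)).
  { intros n. unfold L. apply epsilon_spec. apply Hch. }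
  assert (Hev : forall eps, 0 < eps -> eventually (fun n => / INR (n + 1) < eps)).
  { intros eps He. destruct (archimed_cor1 eps He) as [n0 [H1 H2]]. exists n0. intros n Hn.
    eapply Rle_lt_trans; [|apply H1]. apply Rinv_le_contravar; [apply lt_0_INR;
      auto | apply le_INR; lia]. }
  (* The limit theorem used below asks for uniform convergence on the whole line, hence the
     functions are cut to zero off [a, b]. *)
  set (cut := fun (g : R -> C) t => if excluded_middle_informative (a <= t <= b) then g t else RtoC 0).
  assert (Hcut : forall g t, a < t < b -> cut g t = g t).
  { intros g t Ht. unfold cut. destruct (excluded_middle_informative (a <= t <= b)); [auto | lra]. }
  destruct (filterlim_RInt (V := C_R_CompleteNormedModule)
    (fun n => cut (fun t => lsum (fun i => f i t) (L n))) a b eventually eventually_filter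
    (cut S) (fun n => lsum J (L n))) as [If [H1 H2]].
  - intros n. apply (is_RInt_ext (V := C_R_NormedModule) (fun t => lsum (fun i => f i t) (L n))).
    + rewrite Rmin_left, Rmax_right by auto. intros t Ht. rewrite Hcut; auto.
    + apply is_RInt_lsum; auto.
  - apply filterlim_locally. intros eps. generalize (Hev eps (cond_pos eps)). apply filter_imp.
    intros n Hn t. apply Cmod_lt_ball. unfold cut.
    destruct (excluded_middle_informative (a <= t <= b)) as [Ht|Ht].
    + eapply Rle_lt_trans; [|apply Hn]. destruct (HL n) as [N1 N2].
      apply has_sum_tail with (m := m); auto.
    + replace (RtoC 0 - RtoC 0)%C with (RtoC 0) by ring. rewrite Cmod_0. apply cond_pos.
  - replace s with (If : C).
    + apply (is_RInt_ext (V := C_R_NormedModule) (cut S)); auto.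
      rewrite Rmin_left, Rmax_right by auto. intros t Ht. rewrite Hcut; auto.
    + apply (filterlim_locally_unique (K := R_AbsRing) (V := C_R_NormedModule) (F := eventually)
      (fun n => lsum J (L n))).
      * exact H1.
      * apply filterlim_locally. intros eps. generalize (Hev eps (cond_pos eps)). apply filter_imp.
        intros n Hn. apply Cmod_lt_ball. eapply Rle_lt_trans; [|apply Hn]. destruct (HL n) as [N1 N2].
        apply has_sum_tail with (m := m); auto.
Qed.

(** * Twisted periods of the kernel forms *)

Definition wvec (r D : nat) (g : (Z * Z) * (Z * Z)) : Z * Z :=
  (Z.of_nat r * fst (fst g) + Z.of_nat D * fst (snd g),
   Z.of_nat r * snd (fst g) + Z.of_nat D * snd (snd g))%Z.

Definition period_term (l n : nat) (tau : C) (r D : nat) (g : (Z * Z) * (Z * Z)) : C :=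
  if (det g =? 1)%Z then (/ (lin tau (fst g) ^ l * lin tau (wvec r D g) ^ n))%C else RtoC 0.

Lemma det_wvec r D g : det (fst g, wvec r D g) = (Z.of_nat D * det g)%Z.
Proof. unfold det, wvec; simpl. ring. Qed.

Lemma wvec_nz r D g : (0 < D)%nat -> det g = 1%Z -> wvec r D g <> (0, 0)%Z.
Proof.
  intros HD Hg E. pose proof (det_wvec r D g) as H. rewrite Hg, E in H.
  unfold det in H; simpl in H. lia.
Qed.

Lemma wvec_inj r D g g' : (0 < D)%nat -> (fst g, wvec r D g) = (fst g', wvec r D g') -> g = g'.
Proof.
  intros HD E. destruct g as [[a c] [b d]], g' as [[a' c'] [b' d']]. unfold wvec in E;
    cbn [fst snd] in E.
  inversion E as [[E1 E2 E3 E4]]. subst a' c'.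
  assert (b = b') by nia. assert (d = d') by nia. congruence.
Qed.

Lemma lin_wvec tau r D g :
  lin tau (wvec r D g) = (RtoC (INR r) * lin tau (fst g) + RtoC (INR D) * lin tau (snd g))%C.
Proof.
  unfold lin, wvec, ZtoC; cbn [fst snd]. rewrite !plus_IZR, !mult_IZR, <- !INR_IZR_INZ, !RtoC_plus,
    !RtoC_mult. ring.
Qed.

(** The pair (p, w) determines the matrix, so the sum is dominated by a product of two lattice sums
    with exponents l and n, both at least 3. *)
Lemma period_term_sum_le l n tau r D : (3 <= l)%nat -> (3 <= n)%nat -> (0 < D)%nat -> 0 < Im tau ->
  exists M, sum_le (fun g => Cmod (period_term l n tau r D g)) M.
Proof.
  intros Hl Hn HD Ht.
  destruct (lin_pow_wt2 tau l Ht Hl) as [M1 [HM1 H1]].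
    destruct (lin_pow_wt2 tau n Ht Hn) as [M2 [HM2 H2]].
  exists (M1 * M2 * (16 * 16 * (16 * 16))).
  apply sum_le_inj with (phi := fun g => (fst g,
    wvec r D g)) (m' := fun g => M1 * M2 * (wt2 (fst g) * wt2 (snd g))).
  - intros; apply Cmod_ge_0.
  - intros g Hg. unfold period_term in *. cbn [fst snd]. destruct (Z.eqb_spec (det g) 1) as [E|E];
    [|rewrite Cmod_0 in Hg; lra].
    pose proof (wvec_nz r D g HD E) as Hw. destruct (det_nz g E) as [Hp _].
    pose proof (lin_nz tau _ Ht Hp) as Np. pose proof (lin_nz tau _ Ht Hw) as Nw.
    rewrite Cmod_inv by (apply Cmult_neq_0; apply Cpow_nz; auto).
    rewrite Cmod_mult, !Cmod_pow, Rinv_mult.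
    replace (M1 * M2 * (wt2 (fst g) * wt2 (wvec r D g))) with ((M1 * wt2 (fst g)) * (M2 * wt2 (wvec
      r D g))) by ring.
    apply Rmult_le_compat; auto; left; apply Rinv_0_lt_compat, pow_lt, Cmod_gt_0; auto.
  - intros g g' _ _ E. apply (wvec_inj r D); auto.
  - apply sum_le_scal; [nra | apply wt2_wt2_sum].
Qed.

(** Includes integrability on [a, b] and the order 0 < a < b, so that sums, multiples and equality
    on the positive axis can be treated before passing to [RInt_gen]. *)
Definition is_improper_RInt (f : R -> C) (s : C) : Prop := forall eps, 0 < eps ->
  filter_prod (at_right 0) (Rbar_locally p_infty) (fun ab => 0 < fst ab < snd ab /\
    exists z : C, is_RInt (V := C_R_NormedModule) f (fst ab) (snd ab) z /\ Cmod (z - s)%C < eps).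

Lemma improper_RInt_gen f s : is_improper_RInt f s ->
  RInt_gen (V := C_R_CompleteNormedModule) f (at_right 0) (Rbar_locally p_infty) = s.
Proof.
  intros H. apply is_RInt_gen_unique. apply filterlimi_locally. intros eps.
  generalize (H eps (cond_pos eps)). apply filter_imp. intros ab [_ [z [H1 H2]]].
  exists z. split; auto. apply Cmod_lt_ball. auto.
Qed.

Lemma improper_RInt_ext f g s : (forall t,
  0 < t -> f t = g t) -> is_improper_RInt f s -> is_improper_RInt g s.
Proof.
  intros E H eps He. generalize (H eps He). apply filter_imp. intros ab [H0 [z [H1 H2]]].
  split; auto. exists z. split; auto. apply (is_RInt_ext (V := C_R_NormedModule) f); auto.
  rewrite Rmin_left, Rmax_right by lra. intros t Ht. apply E. lra.
Qed.

Lemma filter_prod_inter01 : filter_prod (at_right 0) (Rbar_locally p_infty) (fun ab => 0 < fst ab <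
  snd ab).
Proof.
  apply Filter_prod with (fun a => 0 < a < 1) (fun b => 1 < b).
  - exists (mkposreal 1 Rlt_0_1). intros y Hy Hy'. unfold ball in Hy; simpl in Hy.
    unfold AbsRing_ball, abs, minus, plus, opp in Hy; simpl in Hy.
    rewrite Ropp_0, Rplus_0_r, Rabs_pos_eq in Hy; lra.
  - exists 1. auto.
  - simpl. intros; lra.
Qed.

Lemma improper_RInt_zero : is_improper_RInt (fun _ => RtoC 0) (RtoC 0).
Proof.
  intros eps He. generalize filter_prod_inter01. apply filter_imp. intros ab Hab. split; auto.
  exists (RtoC 0). split.
  - refine (is_RInt_lsum (fun (i : Empty_set) t => RtoC 0) (fun _ => RtoC 0) (fst ab) (snd ab) nil _).
    intros [].
  - replace (RtoC 0 - RtoC 0)%C with (RtoC 0) by ring. rewrite Cmod_0. auto.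
Qed.

Lemma improper_RInt_plus f g s t : is_improper_RInt f s -> is_improper_RInt g t -> is_improper_RInt
  (fun x => f x + g x)%C (s + t)%C.
Proof.
  intros Hf Hg eps He.
  generalize (filter_and (F := filter_prod (at_right 0) (Rbar_locally p_infty)) _ _
    (Hf (eps / 2) ltac:(lra)) (Hg (eps / 2) ltac:(lra))).
  apply filter_imp. intros ab [[H0 [z [H1 H2]]] [_ [w [H3 H4]]]]. split; auto.
  exists (z + w)%C. split; [apply (is_RInt_plus (V := C_R_NormedModule) f g); auto|].
  replace (z + w - (s + t))%C with ((z - s) + (w - t))%C by ring.
  eapply Rle_lt_trans; [apply Cmod_triangle | lra].
Qed.

Lemma is_RInt_Cscal (c : C) f a b z : is_RInt (V := C_R_NormedModule) f a b z ->
  is_RInt (V := C_R_NormedModule) (fun x => c * f x)%C a b (c * z)%C.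
Proof.
  intros H.
  pose proof (is_RInt_fct_extend_fst (U := R_NormedModule) (V := R_NormedModule) f a b z H) as H1.
  pose proof (is_RInt_fct_extend_snd (U := R_NormedModule) (V := R_NormedModule) f a b z H) as H2.
  apply (is_RInt_fct_extend_pair (U := R_NormedModule) (V := R_NormedModule)).
  - apply (is_RInt_minus (V := R_NormedModule) (fun x => fst c * fst (f x)) (fun x => snd c * snd
    (f x)));
      apply (is_RInt_scal (V := R_NormedModule)); auto.
  - apply (is_RInt_plus (V := R_NormedModule) (fun x => fst c * snd (f x)) (fun x => snd c * fst (f x)));
      apply (is_RInt_scal (V := R_NormedModule)); auto.
Qed.

Lemma improper_RInt_scal (c : C) f s : is_improper_RInt f s -> is_improper_RInt (fun x => c * f
  x)%C (c * s)%C.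
Proof.
  intros Hf eps He. pose proof (Cmod_ge_0 c).
  assert (He' : 0 < eps / (Cmod c + 1)) by (apply Rdiv_lt_0_compat; lra).
  generalize (Hf _ He'). apply filter_imp. intros ab [H0 [z [H1 H2]]]. split; auto.
  exists (c * z)%C. split; [apply is_RInt_Cscal; auto|].
  replace (c * z - c * s)%C with (c * (z - s))%C by ring. rewrite Cmod_mult.
  apply Rle_lt_trans with (Cmod c * (eps / (Cmod c + 1))); [apply Rmult_le_compat_l; lra|].
  apply Rmult_lt_reg_r with (Cmod c + 1); [lra|]. field_simplify; lra.
Qed.

Lemma improper_RInt_lsum {I : Type} (f : I -> R -> C) (s : I -> C) l : (forall i,
  In i l -> is_improper_RInt (f i) (s i)) ->
  is_improper_RInt (fun t => lsum (fun i => f i t) l) (lsum s l).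
Proof.
  induction l as [|i l IH]; intros H; simpl; [apply improper_RInt_zero|].
  apply (improper_RInt_plus (f i)); [apply H; left; auto | apply IH; intros; apply H; right; auto].
Qed.

Lemma tends_at_right_id (f : R -> C) (M : R) : 0 <= M ->
  (forall t, 0 < t -> Cmod (f t) <= M * t) -> tends (at_right 0) f (RtoC 0).
Proof.
  intros HM H. apply tends_bound with (h := fun t => t) (c := M); auto.
  - exact (@filter_filter _ _ (at_right_proper_filter 0)).
  - intros eps He. exists (mkposreal eps He). intros y Hy Hy'. unfold ball in Hy; simpl in Hy.
    unfold AbsRing_ball, abs, minus, plus, opp in Hy; simpl in Hy.
    rewrite Ropp_0, Rplus_0_r, Rabs_pos_eq in Hy; lra.
  - exists (mkposreal 1 Rlt_0_1). intros y _ Hy'. replace (f y - RtoC 0)%C with (f y) by ring. auto.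
Qed.

(** On the line over r/D one has p z + q = i t p + w/D. Put x = i t p / (i t p + w/D), which runs
    from 0 to 1; each term then has the primitive D^n p^(-l) w^(-n) Phi(x). Since |x| <= 1, these
    primitives are dominated uniformly in t, and the limits at both ends may be taken term by
    term. *)
Lemma kernel_form_period l n D : (3 <= l)%nat -> (3 <= n)%nat -> (0 < D)%nat -> exists b : R,
  0 < b /\ forall tau r, 0 < Im tau ->
  is_improper_RInt (fun t => kernel_form (l + n) tau (Ci * RtoC t + RtoC (INR r / INR D)) * (Ci *
    RtoC t) ^ (l - 1) * Ci)%C
    (RtoC b * RtoC (INR D) ^ n * Sum (period_term l n tau r D))%C.
Proof.
  intros Hl Hn HD.
  (* Here b is B(l, n). It depends on neither tau nor r, and so becomes a common factor of the whole
     relation. *)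
  destruct (Beta_primitive (n - 1) l ltac:(lia)) as [Phi [b [MP [Hb [P0 [P1 [HMP [HPb [HPD HPT]]]]]]]]].
  exists b. split; auto. intros tau r Ht.
  pose proof (INR_C_nz D HD) as HDz. assert (HDR : 0 < INR D) by (apply lt_0_INR; auto).
  destruct (period_term_sum_le l n tau r D Hl Hn HD Ht) as [MT HMT].
  pose proof (Sum_spec _ _ HMT) as HT.
  set (c0 := RtoC (INR r / INR D)).
  set (zt := fun t : R => (Ci * RtoC t + c0)%C).
  assert (Hzt : forall t, Im (zt t) = t) by (intros t; unfold zt, c0; simpl; ring).
  set (num := fun (g : (Z * Z) * (Z * Z)) (t : R) => (Ci * RtoC t * lin tau (fst g))%C).
  set (q := fun g : (Z * Z) * (Z * Z) => (lin tau (wvec r D g) / RtoC (INR D))%C).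
  set (den := fun (g : (Z * Z) * (Z * Z)) (t : R) => (num g t + q g)%C).
  assert (Hden : forall g t, den g t = (lin tau (fst g) * zt t + lin tau (snd g))%C).
  { intros g t. unfold den, num, q, zt, c0. rewrite lin_wvec. unfold Rdiv. rewrite RtoC_mult,
    RtoC_inv by lra.
    field. auto. }
  assert (Hdnz : forall g t, 0 < t -> det g = 1%Z -> den g t <> RtoC 0).
  { intros g t Htp Hg. rewrite Hden. apply linz_nz; auto. rewrite Hzt. auto. }
  assert (Hpq : forall g, det g = 1%Z -> lin tau (fst g) <> RtoC 0 /\ q g <> RtoC 0 /\ lin tau
    (wvec r D g) <> RtoC 0).
  { intros g Hg. destruct (det_nz g Hg) as [Hp _].
    assert (Nw : lin tau (wvec r D g) <> RtoC 0) by (apply lin_nz; auto; apply wvec_nz; auto).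
    split; [apply lin_nz; auto|]. split; auto. unfold q. apply Cmult_neq_0; auto.
    intros E. apply Nw. replace (lin tau (wvec r D g)) with
      (RtoC (INR D) * (lin tau (wvec r D g) * / RtoC (INR D)))%C by (field; auto). rewrite E. ring. }
  set (x := fun (g : (Z * Z) * (Z * Z)) (t : R) => (num g t * / den g t)%C).
  set (G := fun (t : R) (g : (Z * Z) * (Z * Z)) => (RtoC (INR D) ^ n * (period_term l n tau r D g *
    Phi (x g t)))%C).
  assert (Hnum : forall g t, 0 < t -> Cmod (num g t) = Cmod (lin tau (fst g)) * t).
  { intros g t Htp. unfold num. rewrite !Cmod_mult, Cmod_Ci, Cmod_R, Rabs_pos_eq; lra. }
  assert (Hnd : forall g t, 0 < t -> det g = 1%Z -> Cmod (num g t) <= Cmod (den g t)).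
  { intros g t Htp Hg. rewrite Hden, Hnum by auto.
    pose proof (linz_lower tau (zt t) g Ht ltac:(rewrite Hzt; auto) Hg) as [L1 _].
    rewrite Hzt in L1. auto. }
  assert (Hx1 : forall g t, 0 < t -> det g = 1%Z -> Cmod (x g t) <= 1).
  { intros g t Htp Hg. pose proof (Hdnz g t Htp Hg) as Nd. unfold x.
    rewrite Cmod_mult, Cmod_inv by auto. apply Cmod_gt_0 in Nd.
    apply Rmult_le_reg_r with (Cmod (den g t)); auto.
    rewrite Rmult_assoc, Rinv_l, Rmult_1_r, Rmult_1_l by lra. auto. }
  assert (HGb : forall t g, 0 < t -> Cmod (G t g) <= INR D ^ n * MP * Cmod (period_term l n tau r D g)).
  { intros t g Htp. unfold G. rewrite !Cmod_mult, Cmod_pow, Cmod_INR, Rmult_assoc.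
    apply Rmult_le_compat_l; [apply pow_le; lra|]. rewrite Rmult_comm.
    unfold period_term. destruct (Z.eqb_spec (det g) 1) as [Hg|Hg]; [|rewrite Cmod_0; lra].
    apply Rmult_le_compat_r; [apply Cmod_ge_0|]. auto. }
  assert (HDMP : 0 <= INR D ^ n * MP) by (apply Rmult_le_pos; auto; apply pow_le; lra).
  assert (HGs : forall t, 0 < t -> has_sum (G t) (Sum (G t))).
  { intros t Htp. apply Sum_spec with (INR D ^ n * MP * MT).
    apply sum_le_mono with (fun g => INR D ^ n * MP * Cmod (period_term l n tau r D g)).
    - intros; auto.
    - apply sum_le_scal; auto. }
  set (f := fun (g : (Z * Z) * (Z * Z)) (t : R) => (kern (l + n) tau (zt t) g * (Ci * RtoC t) ^ (l
    - 1) * Ci)%C).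
  assert (HRd : forall g t, 0 < t -> is_derive_RC (fun s => G s g) t (f g t) /\ exists k,
    is_derive_RC (f g) t k).
  { intros g t Htp. unfold G, f, kern, period_term. destruct (Z.eqb_spec (det g) 1) as [Hg|Hg].
    - destruct (Hpq g Hg) as [Np [Nq Nw]]. pose proof (Hdnz g t Htp Hg) as Nd.
      assert (D1 : is_derive_RC (num g) t (Ci * lin tau (fst g))%C) by apply is_derive_RC_lin.
      assert (D2 : is_derive_RC (den g) t (Ci * lin tau (fst g))%C).
      { eapply is_derive_RC_eq; [|apply (is_derive_RC_plus (num g) (fun _ => q g) t _ _ D1
        (is_derive_RC_const _ _))]. ring. }
      assert (D3 : is_derive_RC (x g) t (Ci * lin tau (fst g) * q g / (den g t * den g t))%C).
      { eapply is_derive_RC_eq; [|apply (is_derive_RC_mult (num g) (fun s => / den g s)%C t _ _ D1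
        (is_derive_RC_inv _ _ _ Nd D2))].
        unfold den in *. field. auto. }
      split.
      + pose proof (HPD (x g) t _ D3) as D4.
        pose proof (is_derive_RC_mult _ _ t _ _ (is_derive_RC_const (/ (lin tau (fst g) ^ l * lin
          tau (wvec r D g) ^ n))%C t) D4) as D5.
        pose proof (is_derive_RC_mult _ _ t _ _ (is_derive_RC_const (RtoC (INR D) ^ n)%C t) D5) as D6.
        eapply is_derive_RC_eq; [|apply D6]. cbv beta. rewrite <- Hden.
        (* In x^(l-1) (1-x)^(n-1) x' the denominators combine to the power l + n, and the powers of
           p and w cancel against D^n times [period_term]. *)
        assert (E1 : (1 - x g t)%C = (q g * / den g t)%C) by (unfold x, den in *; field; auto).
        rewrite E1. unfold x.
        replace (lin tau (wvec r D g)) with (RtoC (INR D) * q g)%C by (unfold q; field; auto).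
        unfold num. rewrite !Cpow_mult_l, !Cpow_inv by auto.
        assert (El : forall z : C, (z ^ l)%C = (z * z ^ (l - 1))%C)
          by (intros z; rewrite <- Cpow_S; f_equal; lia).
        assert (En : forall z : C, (z ^ n)%C = (z * z ^ (n - 1))%C)
          by (intros z; rewrite <- Cpow_S; f_equal; lia).
        rewrite !Cpow_add_r, !El, !En.
        pose proof (Cpow_nz _ (l - 1) Np). pose proof (Cpow_nz _ (n - 1) Nq).
        pose proof (Cpow_nz _ (l - 1) Nd). pose proof (Cpow_nz _ (n - 1) Nd).
          pose proof (Cpow_nz _ (n - 1) HDz).
        set (u1 := (lin tau (fst g) ^ (l - 1))%C) in *. set (u2 := (q g ^ (n - 1))%C) in *.
        set (u3 := (den g t ^ (l - 1))%C) in *. set (u4 := (den g t ^ (n - 1))%C) in *.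
        set (u5 := (RtoC (INR D) ^ (n - 1))%C) in *. field. repeat split; auto.
      + destruct (is_derive_RC_pow_ex (den g) t _ (l + n) D2) as [k1 K1].
        assert (K2 := is_derive_RC_inv (fun s => den g s ^ (l + n))%C t k1 (Cpow_nz _ _ Nd) K1).
        assert (Dl : is_derive_RC (fun s => Ci * RtoC s)%C t Ci) by (split; simpl; auto_derive;
          auto; ring).
        destruct (is_derive_RC_pow_ex _ t _ (l - 1) Dl) as [k3 K3].
        pose proof (is_derive_RC_mult _ _ t _ _ (is_derive_RC_mult _ _ t _ _ K2 K3)
          (is_derive_RC_const Ci t)) as K4. cbv beta in K4.
        eexists. destruct K4 as [K5 K6]. split.
        * refine (is_derive_ext _ _ _ _ _ K5). intros s. cbv beta. rewrite Hden. reflexivity.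
        * refine (is_derive_ext _ _ _ _ _ K6). intros s. cbv beta. rewrite Hden. reflexivity.
    - split; [|exists (RtoC 0)].
      + destruct (is_derive_RC_const (RtoC 0) t) as [K5 K6]. split.
        * replace (Re _) with (Re (RtoC 0)) by (rewrite Cmult_0_l; simpl; ring).
          refine (is_derive_ext _ _ _ _ _ K5). intros s. cbv beta. rewrite Cmult_0_l,
            Cmult_0_r. reflexivity.
        * replace (Im _) with (Im (RtoC 0)) by (rewrite Cmult_0_l; simpl; ring).
          refine (is_derive_ext _ _ _ _ _ K6). intros s. cbv beta. rewrite Cmult_0_l,
            Cmult_0_r. reflexivity.
      + destruct (is_derive_RC_const (RtoC 0) t) as [K5 K6]. split.
        * refine (is_derive_ext _ _ _ _ _ K5). intros s. cbv beta. rewrite !Cmult_0_l. reflexivity.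
        * refine (is_derive_ext _ _ _ _ _ K6). intros s. cbv beta. rewrite !Cmult_0_l. reflexivity. }
  assert (HI : forall a b', 0 < a < b' -> is_RInt (V := C_R_NormedModule)
     (fun t => kernel_form (l + n) tau (zt t) * (Ci * RtoC t) ^ (l - 1) * Ci)%C a b' (Sum (G b') -
       Sum (G a))%C).
  { intros a b' Hab.
    destruct (kern_bound (l + n) tau a (b' + Cmod c0) ltac:(lia) Ht ltac:(lra)) as [MK [HMK HK]].
    { pose proof (Cmod_ge_0 c0). lra. }
    (* The majorant adds a bound for the integrands on [a, b'] and twice the uniform bound for the
       primitives, so that it serves for terms and integrals alike. *)
    apply is_RInt_has_sum with (f := f) (J := fun g => (G b' g - G a g)%C)
      (m := fun g => MK * b' ^ (l - 1) * (wt2 (fst g) * wt2 (snd g)) + 2 * (INR D ^ n * MP) * Cmod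
        (period_term l n tau r D g))
      (M := MK * b' ^ (l - 1) * (16 * 16 * (16 * 16)) + 2 * (INR D ^ n * MP) * MT).
    - lra.
    - assert (0 <= b' ^ (l - 1)) by (apply pow_le; lra).
      apply sum_le_plus; apply sum_le_scal; auto using wt2_wt2_sum; nra.
    - intros g t Htab. unfold f. rewrite !Cmod_mult, Cmod_pow, Cmod_mult, Cmod_Ci, Cmod_R,
      Rabs_pos_eq by lra.
      rewrite Rmult_1_l, Rmult_1_r.
      assert (B1 : Cmod (kern (l + n) tau (zt t) g) <= MK * (wt2 (fst g) * wt2 (snd g))).
      { apply HK; [rewrite Hzt; lra|]. unfold zt. eapply Rle_trans; [apply Cmod_triangle|].
        rewrite Cmod_mult, Cmod_Ci, Cmod_R, Rabs_pos_eq; lra. }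
      assert (B2 : t ^ (l - 1) <= b' ^ (l - 1)) by (apply pow_incr; lra).
      assert (B3 : 0 <= t ^ (l - 1)) by (apply pow_le; lra).
      assert (0 <= 2 * (INR D ^ n * MP) * Cmod (period_term l n tau r D g)).
      { apply Rmult_le_pos; [lra | apply Cmod_ge_0]. }
      assert (Cmod (kern (l + n) tau (zt t) g) * t ^ (l - 1) <= MK * (wt2 (fst g) * wt2 (snd g)) *
        b' ^ (l - 1)).
      { apply Rmult_le_compat; auto; apply Cmod_ge_0. }
      lra.
    - intros g. replace (G b' g - G a g)%C with (G b' g + - G a g)%C by ring.
      eapply Rle_trans; [apply Cmod_triangle|]. rewrite Cmod_opp.
      pose proof (HGb b' g ltac:(lra)). pose proof (HGb a g ltac:(lra)).
      assert (0 <= MK * b' ^ (l - 1) * (wt2 (fst g) * wt2 (snd g))); [|lra].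
      pose proof (wt2_pos (fst g)). pose proof (wt2_pos (snd g)).
      apply Rmult_le_pos; [apply Rmult_le_pos; auto; apply pow_le; lra | nra].
    - intros g. apply (is_RInt_derive_RC (fun t => G t g)); [lra | |]; intros t Htab; apply HRd; lra.
    - intros t Htab. pose proof (kernel_form_sum (l + n) tau (zt t) ltac:(lia) Ht ltac:(rewrite
      Hzt; lra)) as HF.
      replace (kernel_form (l + n) tau (zt t) * (Ci * RtoC t) ^ (l - 1) * Ci)%C with
        ((Ci * RtoC t) ^ (l - 1) * Ci * kernel_form (l + n) tau (zt t))%C by ring.
      apply has_sum_ext with (2 := has_sum_scal ((Ci * RtoC t) ^ (l - 1) * Ci)%C _ _ HF).
      intros g. unfold f. ring.
    - replace (Sum (G b') - Sum (G a))%C with (Sum (G b') + RtoC (-1) * Sum (G a))%C by ring.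
      apply has_sum_ext with (fun g => G b' g + RtoC (-1) * G a g)%C; [intros; ring|].
      apply has_sum_plus; [|apply has_sum_scal]; apply HGs; lra. }
  assert (Hpos0 : at_right 0 (fun t => 0 < t)).
  { exists (mkposreal 1 Rlt_0_1). intros y _ Hy. auto. }
  assert (HposI : Rbar_locally p_infty (fun t => 0 < t)) by (exists 0; auto).
  assert (T0 : tends (at_right 0) (fun t => Sum (G t)) (RtoC 0)).
  { unfold tends. apply (Tannery (at_right 0) (@filter_filter _ _ (at_right_proper_filter 0)) G
    (fun t => Sum (G t)) (fun _ => RtoC 0) (RtoC 0)
      (fun g => INR D ^ n * MP * Cmod (period_term l n tau r D g)) (INR D ^ n * MP * MT)).
    - apply sum_le_scal; auto.
    - intros g. rewrite Cmod_0. apply Rmult_le_pos; auto. apply Cmod_ge_0.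
    - generalize Hpos0. apply filter_imp. intros; auto.
    - generalize Hpos0. apply filter_imp. intros; auto.
    - apply has_sum_zero.
    - intros g. change (tends (at_right 0) (fun t => G t g) (RtoC 0)). unfold G.
      replace (RtoC 0) with (RtoC (INR D) ^ n * (period_term l n tau r D g * Phi (RtoC 0)))%C by
        (rewrite P0; ring).
      apply (tends_mult (at_right 0)); [apply (tends_const (at_right 0))|].
      unfold period_term. destruct (Z.eqb_spec (det g) 1) as [Hg|Hg].
      + apply (tends_mult (at_right 0)); [apply (tends_const (at_right 0))|].
        apply (HPT (at_right 0)); [exact (@filter_filter _ _ (at_right_proper_filter 0))|].
        destruct (Hpq g Hg) as [Np [Nq Nw]].
        assert (Tn : tends (at_right 0) (num g) (RtoC 0)).
        { apply tends_at_right_id with (M := Cmod (lin tau (fst g))); auto using Cmod_ge_0.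
          intros t Htp. rewrite Hnum by auto. lra. }
        replace (RtoC 0) with (RtoC 0 * / (RtoC 0 + q g))%C by ring.
        apply (tends_mult (at_right 0)); auto. apply (tends_inv (at_right 0)).
        * rewrite Cplus_0_l. auto.
        * apply (tends_plus (at_right 0)); auto. apply (tends_const (at_right 0)).
      + refine (tends_ext_loc (at_right 0) (fun _ => RtoC 0 * Phi (RtoC 0))%C _ _ _ (tends_const
        (at_right 0) _)).
        apply filter_forall. intros t. ring. }
  assert (T1 : tends (Rbar_locally p_infty) (fun t => Sum (G t)) (RtoC b * RtoC (INR D) ^ n * Sum
    (period_term l n tau r D))%C).
  { unfold tends. apply (Tannery (Rbar_locally p_infty) (@filter_filter _ _ (Rbar_locally_filter
    p_infty)) G (fun t => Sum (G t))
      (fun g => RtoC b * RtoC (INR D) ^ n * period_term l n tau r D g)%C _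
      (fun g => (INR D ^ n * MP + b * INR D ^ n) * Cmod (period_term l n tau r D g)) ((INR D ^ n *
        MP + b * INR D ^ n) * MT)).
    - apply sum_le_scal; auto. assert (0 <= b * INR D ^ n); [apply Rmult_le_pos;
      [lra | apply pow_le; lra] | lra].
    - intros g. rewrite !Cmod_mult, Cmod_pow, Cmod_INR, Cmod_R, Rabs_pos_eq by lra.
      apply Rmult_le_compat_r; [apply Cmod_ge_0 | lra].
    - generalize HposI. apply filter_imp. intros t Htp g. eapply Rle_trans; [apply HGb; auto|].
      apply Rmult_le_compat_r; [apply Cmod_ge_0|].
      assert (0 <= b * INR D ^ n); [apply Rmult_le_pos; [lra | apply pow_le; lra] | lra].
    - generalize HposI. apply filter_imp. intros; auto.
    - apply has_sum_scal; auto.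
    - intros g. change (tends (Rbar_locally p_infty) (fun t => G t g) (RtoC b * RtoC (INR D) ^ n *
      period_term l n tau r D g)%C). unfold G.
      replace (RtoC b * RtoC (INR D) ^ n * period_term l n tau r D g)%C with
        (RtoC (INR D) ^ n * (period_term l n tau r D g * Phi (RtoC 1)))%C by (rewrite P1; ring).
      apply (tends_mult (Rbar_locally p_infty)); [apply (tends_const (Rbar_locally p_infty))|].
      unfold period_term. destruct (Z.eqb_spec (det g) 1) as [Hg|Hg].
      + apply (tends_mult (Rbar_locally p_infty)); [apply (tends_const (Rbar_locally p_infty))|].
        apply (HPT (Rbar_locally p_infty)); [exact (@filter_filter _ _ (Rbar_locally_filter p_infty))|].
        destruct (Hpq g Hg) as [Np [Nq Nw]]. pose proof Np as Np'. apply Cmod_gt_0 in Np'.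
        apply (tends_bound (Rbar_locally p_infty)) with (h := fun t => / t) (c := Cmod (q g) / Cmod
          (lin tau (fst g))).
        * intros eps He. exists (/ eps). intros t Hte. rewrite <- (Rinv_inv eps).
          assert (0 < / eps) by (apply Rinv_0_lt_compat; auto).
          apply Rinv_lt_contravar; auto. apply Rmult_lt_0_compat; lra.
        * apply Rdiv_le_0_compat; auto. apply Cmod_ge_0.
        * generalize HposI. apply filter_imp. intros t Htp. pose proof (Hdnz g t Htp Hg) as Nd.
          replace (x g t - 1)%C with (- (q g) / den g t)%C by (unfold x, den in *; field; auto).
          rewrite Cmod_div, Cmod_opp by auto. unfold Rdiv. rewrite Rmult_assoc, <- Rinv_mult.
          apply Rmult_le_compat_l; [apply Cmod_ge_0|]. apply Rinv_le_contravar;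
            [apply Rmult_lt_0_compat; auto|].
          rewrite <- Hnum by auto. auto.
      + refine (tends_ext_loc (Rbar_locally p_infty) (fun _ => RtoC 0 * Phi (RtoC 1))%C _ _ _
        (tends_const (Rbar_locally p_infty) _)).
        apply filter_forall. intros t. ring. }
  intros eps He.
  apply Filter_prod with (fun a => Cmod (Sum (G a) - RtoC 0)%C < eps / 2 /\ 0 < a < 1)
    (fun b' => Cmod (Sum (G b') - RtoC b * RtoC (INR D) ^ n * Sum (period_term l n tau r D))%C <
      eps / 2 /\ 1 < b').
  - apply filter_and; [apply T0; lra|].
    exists (mkposreal 1 Rlt_0_1). intros y Hy Hy'. unfold ball in Hy; simpl in Hy.
    unfold AbsRing_ball, abs, minus, plus, opp in Hy; simpl in Hy.
    rewrite Ropp_0, Rplus_0_r, Rabs_pos_eq in Hy; lra.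
  - apply filter_and; [apply T1; lra|]. exists 1; auto.
  - intros a b' [A1 A2] [B1 B2]. cbn [fst snd]. split; [lra|].
    exists (Sum (G b') - Sum (G a))%C. split; [apply HI; lra|].
    set (S0 := Sum (G a)) in *. set (S1 := Sum (G b')) in *.
    set (S2 := (RtoC b * RtoC (INR D) ^ n * Sum (period_term l n tau r D))%C) in *.
    replace (S1 - S0 - S2)%C with ((S1 - S2) + - (S0 - RtoC 0))%C by ring.
    eapply Rle_lt_trans; [apply Cmod_triangle|]. rewrite Cmod_opp. lra.
Qed.

Lemma kernel_form_twisted_period l n D : (3 <= l)%nat -> (3 <= n)%nat -> (0 < D)%nat -> exists b :
  R, 0 < b /\ forall tau (f : cusp_form (l + n)) (chi : Z -> C) (psi : nat -> C), 0 < Im tau ->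
  (forall w, 0 < Im w -> has_sum (fun m : nat => cf_coef f m * qpar w ^ m)%C (kernel_form (l + n)
    tau w)) ->
  (forall n : nat, chi (Z.of_nat n) = lsum (fun r => psi r * qpar (RtoC (INR n * INR r / INR D)))%C
    (seq 0 D)) ->
  twisted_period (l - 1) chi f =
    (RtoC b * RtoC (INR D) ^ n * lsum (fun r => psi r * Sum (period_term l n tau r D)) (seq 0 D))%C.
Proof.
  intros Hl Hn HD. destruct (kernel_form_period l n D Hl Hn HD) as [b [Hb H]]. exists b. split; auto.
  intros tau f chi psi Ht Hf Hchi. unfold twisted_period. apply improper_RInt_gen.
  rewrite <- lsum_scal.
  apply improper_RInt_ext with (fun t => lsum (fun r => psi r * (kernel_form (l + n) tau (Ci * RtoC
    t + RtoC (INR r / INR D)) * (Ci * RtoC t) ^ (l - 1) * Ci))%C (seq 0 D)).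
  - intros t Htp. rewrite (twist_sum (l + n) tau f D chi psi); auto; [|simpl; lra].
    rewrite (Cmult_comm (lsum _ _)), <- lsum_scal, (Cmult_comm (lsum _ _)), <- lsum_scal.
    apply lsum_ext. intros r _. ring.
  - rewrite (lsum_ext _ (fun r => psi r * (RtoC b * RtoC (INR D) ^ n * Sum (period_term l n tau r D)))%C)
      by (intros; ring).
    apply (improper_RInt_lsum (fun r t => psi r * (kernel_form (l + n) tau (Ci * RtoC t + RtoC (INR
      r / INR D)) * (Ci * RtoC t) ^ (l - 1) * Ci))%C).
    intros r _. apply improper_RInt_scal. apply H; auto.
Qed.

(** * Finite Fourier transform of primitive characters *)

Lemma lsum_residues (f : nat -> C) (h : nat -> nat) (D : nat) :
  (forall b, (b < D)%nat -> (h b < D)%nat) ->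
  (forall a b, (a < D)%nat -> (b < D)%nat -> h a = h b -> a = b) ->
  lsum (fun b => f (h b)) (seq 0 D) = lsum f (seq 0 D).
Proof.
  intros Hr Hi. rewrite <- lsum_map. apply lsum_perm. apply NoDup_Permutation_bis.
  - assert (H : forall l, NoDup l -> (forall b, In b l -> (b < D)%nat) -> NoDup (map h l)).
    { induction l as [|b l IH]; intros Hn Hb; simpl; [constructor|]. inversion Hn; subst. constructor.
      - rewrite in_map_iff. intros [a [E Ha]]. assert (a = b); [|congruence].
        apply Hi; auto; apply Hb; simpl; auto.
      - apply IH; auto. intros; apply Hb; simpl; auto. }
    apply H; [apply seq_NoDup|]. intros b Hb. apply in_seq in Hb. lia.
  - rewrite length_map. lia.
  - intros x Hx. apply in_map_iff in Hx. destruct Hx as [b [<- Hb]]. apply in_seq in Hb. apply in_seq.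
    specialize (Hr b). lia.
Qed.

Lemma lsum_single {I : Type} (f : I -> C) (i0 : I) (l : list I) :
  NoDup l -> In i0 l -> (forall i, In i l -> i <> i0 -> f i = RtoC 0) -> lsum f l = f i0.
Proof.
  intros Hn. induction Hn as [|i l Hi Hn IH]; simpl; intros Hin H; [tauto|].
  destruct Hin as [->|Hin].
  - rewrite (lsum_zero f l); [ring|]. intros j Hj. apply H; auto. congruence.
  - rewrite IH, H; auto; [ring | congruence].
Qed.

(** By the pigeonhole principle two of D + 1 powers of a agree modulo D, and the smaller one can be
    cancelled because it is prime to D. *)
Lemma pow_eq_1_mod (a : Z) (D : nat) : (0 < D)%nat -> Z.gcd a (Z.of_nat D) = 1%Z ->
  exists N, (1 <= N)%nat /\ (Z.of_nat D | a ^ Z.of_nat N - 1)%Z.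
Proof.
  intros HD Ha. set (m := Z.of_nat D).
  set (h := fun j : nat => Z.to_nat (a ^ Z.of_nat j mod m)).
  assert (Hh : forall j, (h j < D)%nat).
  { intros j. unfold h. pose proof (Z.mod_pos_bound (a ^ Z.of_nat j) m ltac:(lia)). lia. }
  destruct (classic (exists i j, (i < j)%nat /\ h i = h j)) as [[i [j [Hij E]]]|Hn].
  - exists (j - i)%nat. split; [lia|].
    assert (E' : (a ^ Z.of_nat i mod m = a ^ Z.of_nat j mod m)%Z).
    { unfold h in E. pose proof (Z.mod_pos_bound (a ^ Z.of_nat i) m ltac:(lia)).
      pose proof (Z.mod_pos_bound (a ^ Z.of_nat j) m ltac:(lia)). lia. }
    assert (Hdv : (m | a ^ Z.of_nat i * (a ^ Z.of_nat (j - i) - 1))%Z).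
    { replace (a ^ Z.of_nat i * (a ^ Z.of_nat (j - i) - 1))%Z with (a ^ Z.of_nat j - a ^ Z.of_nat i)%Z.
      - apply Z.mod_divide; [lia|]. rewrite Zminus_mod, E', Z.sub_diag. apply Z.mod_0_l. lia.
      - rewrite Z.mul_sub_distr_l, <- Z.pow_add_r by lia.
        replace (Z.of_nat i + Z.of_nat (j - i))%Z with (Z.of_nat j) by lia. ring. }
    apply Gauss with (a ^ Z.of_nat i)%Z; auto. apply rel_prime_sym.
    clear -Ha. induction i as [|i IH]; [apply rel_prime_1|].
    rewrite Nat2Z.inj_succ, Z.pow_succ_r by lia. apply rel_prime_sym, rel_prime_mult;
      apply rel_prime_sym; auto.
    apply Zgcd_1_rel_prime. auto.
  - exfalso. assert (HN : NoDup (map h (seq 0 (S D)))).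
    { generalize (seq_NoDup (S D) 0). generalize (seq 0 (S D)).
      induction l as [|b l IH]; intros Hnd; simpl; [constructor|]. inversion Hnd;
        subst. constructor; auto.
      rewrite in_map_iff. intros [c [E Hc]]. apply Hn.
      destruct (Nat.lt_trichotomy b c) as [Hlt|[Heq|Hlt]]; [eauto | congruence | eauto]. }
    assert (Hinc : incl (map h (seq 0 (S D))) (seq 0 D)).
    { intros x Hx. apply in_map_iff in Hx. destruct Hx as [b [<- _]]. apply in_seq.
      specialize (Hh b). lia. }
    pose proof (NoDup_incl_length HN Hinc) as HL. rewrite length_map, !length_seq in HL. lia.
Qed.

(** The representative in [0, D) is taken, so that inversion is a self-map on the residues that
    index the sums. *)
Definition inv_mod (D : nat) (r : Z) : Z := epsilon (inhabits 0%Z)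
  (fun s => (0 <= s < Z.of_nat D)%Z /\ (Z.of_nat D | r * s - 1)%Z).

Lemma inv_mod_spec D r : (0 < D)%nat -> Z.gcd r (Z.of_nat D) = 1%Z ->
  (0 <= inv_mod D r < Z.of_nat D)%Z /\ (Z.of_nat D | r * inv_mod D r - 1)%Z.
Proof.
  intros HD Hr. unfold inv_mod. apply epsilon_spec.
  apply Zgcd_1_rel_prime, rel_prime_bezout in Hr. destruct Hr as [u v E].
  exists (u mod Z.of_nat D)%Z. split; [apply Z.mod_pos_bound; lia|].
  exists (- v - r * (u / Z.of_nat D))%Z.
  pose proof (Z.div_mod u (Z.of_nat D) ltac:(lia)) as Hu.
  replace (u mod Z.of_nat D)%Z with (u - Z.of_nat D * (u / Z.of_nat D))%Z by lia.
  rewrite <- E. ring.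
Qed.

Lemma gcd_of_inverse (m a b : Z) : (m | a * b - 1)%Z -> Z.gcd a m = 1%Z.
Proof.
  intros [k Hk]. apply Zgcd_1_rel_prime. apply bezout_rel_prime.
  apply Bezout_intro with b (- k)%Z. nia.
Qed.

Section Characters.
Context (D : nat) (chi : Z -> C).
Context (HD : (0 < D)%nat).
Context (Hchi : dirichlet_char D chi).

Lemma chi_congr a b : (Z.of_nat D | a - b)%Z -> chi a = chi b.
Proof.
  intros [k Hk].
  assert (P : forall (j : nat) x, chi (x + Z.of_nat j * Z.of_nat D)%Z = chi x).
  { induction j as [|j IH]; intros x; [f_equal; lia|].
    rewrite <- (IH x), <- (dc_periodic _ _ Hchi (x + Z.of_nat j * Z.of_nat D)%Z). f_equal. lia. }
  destruct (Z.le_ge_cases 0 k) as [H|H].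
  - rewrite <- (P (Z.to_nat k) b). f_equal. rewrite Z2Nat.id by auto. lia.
  - rewrite <- (P (Z.to_nat (- k)) a). f_equal. rewrite Z2Nat.id by lia. lia.
Qed.

Lemma chi_1 : chi 1%Z = RtoC 1.
Proof.
  assert (H : chi 1%Z <> RtoC 0) by (apply (dc_unit _ _ Hchi); apply Z.gcd_1_l).
  apply Cmult_reg_l with (chi 1%Z); auto. rewrite <- (dc_mul _ _ Hchi). simpl. ring.
Qed.

Lemma chi_pow a (N : nat) : chi (a ^ Z.of_nat N)%Z = (chi a ^ N)%C.
Proof.
  induction N as [|N IH]; [apply chi_1|].
  rewrite Nat2Z.inj_succ, Z.pow_succ_r, (dc_mul _ _ Hchi), IH by lia. reflexivity.
Qed.

(** Some power of a is 1 modulo D, so chi(a) is a root of unity. *)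
Lemma Cmod_chi a : Z.gcd a (Z.of_nat D) = 1%Z -> Cmod (chi a) = 1.
Proof.
  intros Ha. destruct (pow_eq_1_mod a D HD Ha) as [N [HN Hd]].
  assert (E : (chi a ^ N)%C = RtoC 1) by (rewrite <- chi_pow, <- chi_1; apply chi_congr; auto).
  apply (f_equal Cmod) in E. rewrite Cmod_pow, Cmod_1 in E.
  pose proof (Cmod_ge_0 (chi a)) as H0.
  destruct (Rtotal_order (Cmod (chi a)) 1) as [H|[H|H]]; auto; exfalso.
  - pose proof (pow_lt_1_compat (Cmod (chi a)) N ltac:(lra) ltac:(lia)). lra.
  - pose proof (Rlt_pow_R1 (Cmod (chi a)) N H ltac:(lia)). lra.
Qed.

Definition chi_hat (r : Z) : C := (/ RtoC (INR D) *
  lsum (fun b => chi (Z.of_nat b) * qpar (RtoC (- (IZR (Z.of_nat b) * IZR r / INR D)))) (seq 0 D))%C.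

Lemma qpar_congr (a b : Z) : (Z.of_nat D | a - b)%Z ->
  qpar (RtoC (IZR a / INR D)) = qpar (RtoC (IZR b / INR D)).
Proof.
  intros [k Hk]. rewrite <- (qpar_shift (RtoC (IZR b / INR D)) k). f_equal. unfold ZtoC.
  rewrite <- RtoC_plus. f_equal. assert (0 < INR D) by (apply lt_0_INR; auto).
  replace a with (b + k * Z.of_nat D)%Z by lia. rewrite plus_IZR, mult_IZR, <- INR_IZR_INZ. field. lra.
Qed.

Lemma chi_hat_congr r r' : (Z.of_nat D | r - r')%Z -> chi_hat r = chi_hat r'.
Proof.
  intros H. unfold chi_hat. f_equal. apply lsum_ext. intros b _. f_equal.
  assert (E : forall x, - (IZR (Z.of_nat b) * IZR x / INR D) = IZR (- (Z.of_nat b * x)) / INR D).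
  { intros x. rewrite opp_IZR, mult_IZR. unfold Rdiv. ring. }
  rewrite !E. apply qpar_congr.
  replace (- (Z.of_nat b * r) - - (Z.of_nat b * r'))%Z with ((r - r') * - Z.of_nat b)%Z by ring.
  apply Z.divide_mul_l. auto.
Qed.

(** Substitute b -> b u, a permutation of the residues modulo D. *)
Lemma chi_hat_twist r u : Z.gcd u (Z.of_nat D) = 1%Z -> (chi u * chi_hat (r * u)%Z)%C = chi_hat r.
Proof.
  intros Hu. set (h := fun b : nat => Z.to_nat (Z.of_nat b * u mod Z.of_nat D)).
  assert (Hh : forall b, Z.of_nat (h b) = (Z.of_nat b * u mod Z.of_nat D)%Z).
  { intros b. unfold h. pose proof (Z.mod_pos_bound (Z.of_nat b * u) (Z.of_nat D) ltac:(lia)). lia. }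
  unfold chi_hat.
  rewrite <- (lsum_residues (fun b => chi (Z.of_nat b) * qpar (RtoC (- (IZR (Z.of_nat b) * IZR r /
    INR D))))%C h D).
  - rewrite Cmult_comm, <- Cmult_assoc. f_equal. rewrite Cmult_comm, <- lsum_scal. apply lsum_ext.
    intros b _. rewrite Hh.
    assert (Hd : (Z.of_nat D | Z.of_nat b * u mod Z.of_nat D - Z.of_nat b * u)%Z).
    { exists (- (Z.of_nat b * u / Z.of_nat D))%Z.
      pose proof (Z.div_mod (Z.of_nat b * u) (Z.of_nat D) ltac:(lia)). lia. }
    rewrite (chi_congr _ _ Hd), (dc_mul _ _ Hchi).
    assert (E : qpar (RtoC (- (IZR (Z.of_nat b * u mod Z.of_nat D) * IZR r / INR D))) =
      qpar (RtoC (- (IZR (Z.of_nat b) * IZR (r * u) / INR D)))).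
    { transitivity (qpar (RtoC (IZR (- (Z.of_nat b * u mod Z.of_nat D * r)) / INR D))).
      - f_equal. f_equal. rewrite opp_IZR, mult_IZR. unfold Rdiv. ring.
      - transitivity (qpar (RtoC (IZR (- (Z.of_nat b * u * r)) / INR D))).
        + apply qpar_congr.
          replace (- (Z.of_nat b * u mod Z.of_nat D * r) - - (Z.of_nat b * u * r))%Z with
            ((Z.of_nat b * u mod Z.of_nat D - Z.of_nat b * u) * - r)%Z by ring.
          apply Z.divide_mul_l. auto.
        + f_equal. f_equal. rewrite opp_IZR, !mult_IZR. unfold Rdiv. ring. }
    rewrite E. ring.
  - intros b _. pose proof (Z.mod_pos_bound (Z.of_nat b * u) (Z.of_nat D) ltac:(lia)).
    specialize (Hh b). lia.
  - intros a b Ha Hb E. apply (f_equal Z.of_nat) in E. rewrite !Hh in E.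
    assert (Hd : (Z.of_nat D | u * (Z.of_nat a - Z.of_nat b))%Z).
    { apply Z.mod_divide; [lia|]. replace (u * (Z.of_nat a - Z.of_nat b))%Z with (Z.of_nat a * u -
      Z.of_nat b * u)%Z by ring.
      rewrite Zminus_mod, E, Z.sub_diag. apply Z.mod_0_l. lia. }
    apply Gauss in Hd; [|apply rel_prime_sym, Zgcd_1_rel_prime; auto].
    destruct Hd as [k Hk]. assert (k = 0)%Z by nia. nia.
Qed.

Lemma chi_expansion (n : nat) :
  chi (Z.of_nat n) = lsum (fun r => chi_hat (Z.of_nat r) * qpar (RtoC (INR n * INR r / INR D)))%C
    (seq 0 D).
Proof.
  assert (HDR : 0 < INR D) by (apply lt_0_INR; auto). pose proof (INR_C_nz D HD) as HDz.
  unfold chi_hat.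
  rewrite (lsum_ext _ (fun r => / RtoC (INR D) * lsum (fun b => chi (Z.of_nat b) *
    qpar (RtoC (INR r * IZR (Z.of_nat n - Z.of_nat b) / INR D))) (seq 0 D))%C).
  - rewrite lsum_scal, lsum_swap.
    rewrite (lsum_ext _ (fun b => chi (Z.of_nat b) * (if (Z.of_nat n - Z.of_nat b) mod Z.of_nat D
      =? 0 then RtoC (INR D) else RtoC 0)%Z)%C).
    2: { intros b _. rewrite lsum_scal, unity_sum by auto. reflexivity. }
    set (b0 := (n mod D)%nat). assert (Hb0 : (b0 < D)%nat) by (apply Nat.mod_upper_bound; lia).
    assert (Hb0' : (Z.of_nat D | Z.of_nat n - Z.of_nat b0)%Z).
    { unfold b0. rewrite Nat2Z.inj_mod. exists (Z.of_nat n / Z.of_nat D)%Z.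
      pose proof (Z.div_mod (Z.of_nat n) (Z.of_nat D) ltac:(lia)). lia. }
    rewrite (lsum_single _ b0).
    + assert (Ez : ((Z.of_nat n - Z.of_nat b0) mod Z.of_nat D = 0)%Z) by (apply Z.mod_divide;
      [lia | auto]).
      rewrite Ez. simpl Z.eqb. cbv iota.
      rewrite (chi_congr _ _ Hb0'). field. auto.
    + apply seq_NoDup.
    + apply in_seq. lia.
    + intros b Hi Hb. apply in_seq in Hi.
      destruct (Z.eqb_spec ((Z.of_nat n - Z.of_nat b) mod Z.of_nat D) 0) as [E0|]; [|ring].
      exfalso. apply Hb. apply Z.mod_divide in E0; [|lia].
      assert (Hd : (Z.of_nat D | Z.of_nat b0 - Z.of_nat b)%Z).
      { replace (Z.of_nat b0 - Z.of_nat b)%Z with ((Z.of_nat n - Z.of_nat b) - (Z.of_nat n -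
        Z.of_nat b0))%Z by ring.
        apply Z.divide_sub_r; auto. }
      destruct Hd as [k Hk]. assert (Hkb : (- Z.of_nat D < k * Z.of_nat D < Z.of_nat D)%Z) by lia.
      assert (k = 0)%Z by nia. subst k. lia.
  - intros r _. rewrite <- Cmult_assoc. f_equal. rewrite Cmult_comm,
    <- lsum_scal. apply lsum_ext. intros b _.
    transitivity (chi (Z.of_nat b) * (qpar (RtoC (- (IZR (Z.of_nat b) * IZR (Z.of_nat r) / INR D)))
      * qpar (RtoC (INR n * INR r / INR D))))%C; [ring|].
    rewrite <- qpar_plus, <- RtoC_plus. f_equal. f_equal. f_equal.
    rewrite minus_IZR, <- !INR_IZR_INZ. field. lra.
Qed.

End Characters.

(** Let g = gcd(r, D) > 1 and D = d g. If chi were trivial on all units congruent to 1 modulo d, it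
    would be induced from d < D. So some such unit u has chi(u) different from 1; since r u = r
    modulo D, the coefficient equals chi(u) times itself and vanishes. *)
Lemma chi_hat_primitive D chi r : (0 < D)%nat -> squarefree D -> primitive_char D chi ->
  Z.gcd r (Z.of_nat D) <> 1%Z -> chi_hat D chi r = RtoC 0.
Proof.
  intros HD Hsf [Hchi Hprim] Hr.
  set (m := Z.of_nat D) in *. set (g := Z.gcd r m) in *.
  assert (Hg0 : (0 < g)%Z).
  { assert (0 <= g)%Z by apply Z.gcd_nonneg. assert (g <> 0)%Z; [|lia].
    intros E. apply Z.gcd_eq_0_r in E. lia. }
  destruct (Z.gcd_divide_r r m) as [d Hd]. fold g in Hd.
  destruct (Z.gcd_divide_l r m) as [r' Hr']. fold g in Hr'.
  assert (Hd0 : (0 < d)%Z) by nia.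
  assert (Hdm : (d < m)%Z) by nia.
  assert (Hdn : Z.of_nat (Z.to_nat d) = d) by lia.
  assert (Hcop : Z.gcd d g = 1%Z).
  { set (e := Z.gcd d g). assert (He : (0 <= e)%Z) by apply Z.gcd_nonneg.
    destruct (Z.gcd_divide_l d g) as [x Hx]. destruct (Z.gcd_divide_r d g) as [y Hy]. fold e in Hx, Hy.
    assert (Hx0 : (0 <= x)%Z) by nia. assert (Hy0 : (0 <= y)%Z) by nia.
    assert (Z.to_nat e = 1%nat); [|lia]. apply Hsf. exists (Z.to_nat (x * y)).
    apply Nat2Z.inj. rewrite !Nat2Z.inj_mul, !Z2Nat.id by nia. fold m. rewrite Hd.
    transitivity ((x * e) * (y * e))%Z; [rewrite <- Hx, <- Hy; reflexivity | ring]. }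
  destruct (classic (forall u, Z.gcd u m = 1%Z -> (d | u - 1)%Z -> chi u = RtoC 1)) as [Hall|Hex].
  - exfalso. apply (Hprim (Z.to_nat d)).
    + exists (Z.to_nat g). apply Nat2Z.inj. rewrite Nat2Z.inj_mul, !Z2Nat.id by lia. fold m. lia.
    + lia.
    + apply Zgcd_1_rel_prime, rel_prime_bezout in Hcop. destruct Hcop as [u0 v0 Huv].
      (* Chinese remainder theorem: [lift n] is n modulo d and 1 modulo g, with d and g coprime
         because D is square-free. The character modulo d that would induce chi is n -> chi(lift
         n). *)
      set (lift := fun n => (n * (v0 * g) + u0 * d)%Z).
      assert (Hgcd : forall n, Z.gcd (lift n) m = 1%Z <-> Z.gcd n d = 1%Z).
      { intros n. rewrite !Zgcd_1_rel_prime. split; intros H.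
        - apply rel_prime_bezout in H. destruct H as [s t E]. apply bezout_rel_prime.
          apply Bezout_intro with s (s * (1 - n) * u0 + t * g)%Z.
          transitivity (s * lift n + t * m)%Z; [|exact E]. unfold lift. rewrite Hd.
          replace (v0 * g)%Z with (1 - u0 * d)%Z by lia. ring.
        - rewrite Hd. apply rel_prime_mult.
          + apply rel_prime_bezout in H. destruct H as [s t E]. apply bezout_rel_prime.
            apply Bezout_intro with s (t - s * (1 - n) * u0)%Z.
            transitivity (s * n + t * d)%Z; [|exact E]. unfold lift.
            replace (v0 * g)%Z with (1 - u0 * d)%Z by lia. ring.
          + apply bezout_rel_prime. apply Bezout_intro with 1%Z ((1 - n) * v0)%Z. unfold lift.
            transitivity (u0 * d + v0 * g)%Z; [ring | auto]. }
      exists (fun n => chi (lift n)). split; [constructor|].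
      * intros n. apply (chi_congr D chi HD Hchi). unfold lift. rewrite Hdn. fold m. exists v0.
        rewrite Hd. ring.
      * intros a b. rewrite <- (dc_mul _ _ Hchi). apply (chi_congr D chi HD Hchi). fold m.
        exists (u0 * v0 * (a * b - a - b + 1))%Z. unfold lift. rewrite Hd.
        assert (E1 : (v0 * g)%Z = (1 - u0 * d)%Z) by lia.
        replace (u0 * v0 * (a * b - a - b + 1) * (d * g))%Z with (u0 * d * (v0 * g) * (a * b - a -
          b + 1))%Z by ring.
        rewrite E1. ring.
      * intros n. rewrite Hdn. rewrite <- Hgcd. apply (dc_unit _ _ Hchi).
      * intros n Hn. fold m in Hn.
        assert (Hln : Z.gcd (lift n) m = 1%Z).
        { apply Hgcd. apply Zgcd_1_rel_prime. apply Zgcd_1_rel_prime in Hn. rewrite Hd in Hn.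
          apply rel_prime_bezout in Hn. destruct Hn as [s t E]. apply bezout_rel_prime.
          apply Bezout_intro with s (t * g)%Z. rewrite <- E. ring. }
        destruct (inv_mod_spec D n HD Hn) as [_ Hinv]. set (ni := inv_mod D n) in *. fold m in Hinv.
        assert (Hni : Z.gcd ni m = 1%Z) by (apply gcd_of_inverse with n; rewrite Z.mul_comm; auto).
        (* [lift n] times the inverse of n is a unit congruent to 1 modulo d, so chi takes the same
           value at [lift n] and n. *)
        assert (Hu : chi (lift n * ni)%Z = RtoC 1).
        { apply Hall.
          - apply Zgcd_1_rel_prime. apply rel_prime_sym, rel_prime_mult; apply rel_prime_sym;
            apply Zgcd_1_rel_prime; auto.
          - assert (Hdi : (d | n * ni - 1)%Z) by (eapply Z.divide_trans; [|apply Hinv]; rewrite Hd;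
            exists g; ring).
            replace (lift n * ni - 1)%Z with ((n * ni - 1) + (1 - n) * u0 * ni * d)%Z.
            + apply Z.divide_add_r; auto. exists ((1 - n) * u0 * ni)%Z. ring.
            + unfold lift. replace (v0 * g)%Z with (1 - u0 * d)%Z by lia. ring. }
        assert (Hu2 : chi (n * ni)%Z = RtoC 1).
        { rewrite <- (chi_1 D chi Hchi). apply (chi_congr D chi HD Hchi). auto. }
        rewrite (dc_mul _ _ Hchi) in Hu, Hu2.
        apply Cmult_reg_l with (chi ni); [apply (dc_unit _ _ Hchi); auto|].
        rewrite (Cmult_comm _ (chi n)), (Cmult_comm _ (chi (lift n))), Hu, Hu2. reflexivity.
  - apply not_all_ex_not in Hex. destruct Hex as [u Hu]. apply imply_to_and in Hu.
    destruct Hu as [Hu1 Hu].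
    apply imply_to_and in Hu. destruct Hu as [Hu2 Hu3].
    pose proof (chi_hat_twist D chi HD Hchi r u Hu1) as E.
    rewrite (chi_hat_congr D chi HD (r * u) r) in E.
    + assert (Hz : (1 - chi u)%C <> RtoC 0).
      { intros E'. apply Hu3. replace (chi u) with (1 - (1 - chi u))%C by ring. rewrite E'. ring. }
      apply Cmult_reg_l with (1 - chi u)%C; auto.
      transitivity (chi_hat D chi r - chi u * chi_hat D chi r)%C; [ring|]. rewrite E. ring.
    + fold m. destruct Hu2 as [k Hk]. exists (r' * k)%Z.
      replace (r * u - r)%Z with (r * (u - 1))%Z by ring. rewrite Hk, Hr', Hd. ring.
Qed.

Lemma chi_hat_unit D chi r : (0 < D)%nat -> dirichlet_char D chi -> Z.gcd r (Z.of_nat D) = 1%Z ->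
  chi_hat D chi r = (chi_hat D chi 1 * chi (inv_mod D r))%C.
Proof.
  intros HD Hchi Hr. destruct (inv_mod_spec D r HD Hr) as [_ Hi].
  assert (Hri : (chi (inv_mod D r) * chi r)%C = RtoC 1).
  { rewrite <- (dc_mul _ _ Hchi),
    <- (chi_1 D chi Hchi). apply (chi_congr D chi HD Hchi). rewrite Z.mul_comm. auto. }
  rewrite <- (chi_hat_twist D chi HD Hchi 1 r Hr). rewrite Z.mul_1_l.
  transitivity (chi (inv_mod D r) * chi r * chi_hat D chi r)%C; [rewrite Hri; ring | ring].
Qed.

(** In the expansion of 1 = chi(1) each of the D terms has modulus |chi_hat(1)| at a unit and 0
    elsewhere. The bound keeps the weights chi_hat(1) attached to a relation from degenerating. *)
Lemma chi_hat_1_lower D chi : (0 < D)%nat -> squarefree D -> primitive_char D chi ->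
  1 <= INR D * Cmod (chi_hat D chi 1).
Proof.
  intros HD Hsf Hp. pose proof (proj1 Hp) as Hchi.
  pose proof (chi_expansion D chi HD Hchi 1) as E. change (Z.of_nat 1) with 1%Z in E.
  rewrite (chi_1 D chi Hchi) in E. apply (f_equal Cmod) in E. rewrite Cmod_1 in E. rewrite E.
  eapply Rle_trans; [apply Cmod_lsum|].
  replace (INR D * Cmod (chi_hat D chi 1)) with (rsum (fun _ : nat => Cmod (chi_hat D chi 1)) (seq 0 D))
    by (rewrite rsum_const, length_seq; reflexivity).
  apply rsum_le. intros r _. rewrite Cmod_mult, Cmod_qpar_R, Rmult_1_r.
  destruct (Z.eq_dec (Z.gcd (Z.of_nat r) (Z.of_nat D)) 1) as [Hr|Hr].
  - rewrite chi_hat_unit by auto. rewrite Cmod_mult,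
    (Cmod_chi D chi HD Hchi (inv_mod D (Z.of_nat r))); [lra|].
    destruct (inv_mod_spec D _ HD Hr) as [_ Hi]. apply gcd_of_inverse with (Z.of_nat r).
      rewrite Z.mul_comm; auto.
  - rewrite chi_hat_primitive by auto. rewrite Cmod_0. apply Cmod_ge_0.
Qed.

(** * Main term and error term *)

Definition sign (b : bool) : Z := if b then 1%Z else (-1)%Z.

Lemma ZtoC_sg_pow b K : Nat.Even K -> (ZtoC (sign b) ^ K)%C = RtoC 1.
Proof.
  intros [m ->]. rewrite Cpow_mult_r.
  replace (ZtoC (sign b) ^ 2)%C with (RtoC 1); [apply Cpow_1_l|].
  destruct b; unfold ZtoC, sign; simpl; [ring|].
  rewrite <- !RtoC_mult. f_equal. ring.
Qed.

(* The terms with w = (w1, 0): there w1 = s = 1 or -1, and the first column of the matrix is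
   s (r* - D m, -D), where r* is inverse to r modulo D. *)
Lemma main_sum l n tau (r D : nat) (rs k : Z) s :
  (3 <= l)%nat -> (3 <= n)%nat -> (0 < D)%nat -> Nat.Even (l + n) -> 0 < Im tau ->
  (Z.of_nat r * rs + Z.of_nat D * k = 1)%Z ->
  has_sum (fun m : nat => RtoC (INR m ^ (l - 1)) * qpar (tau + RtoC (- (IZR rs / INR D))) ^ m)%C s ->
  has_sum (fun g => if (snd (wvec r D g) =? 0)%Z then period_term l n tau r D g else RtoC 0)
    (RtoC 2 * (/ RtoC (- INR D) ^ l * (Lconst (l - 1) * s)))%C.
Proof.
  intros Hl Hn HD HK Ht Hrs Hs.
  set (z := (tau + RtoC (- (IZR rs / INR D)))%C) in *.
  assert (HDR : 0 < INR D) by (apply lt_0_INR; auto).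
  assert (HDz : RtoC (- INR D) <> RtoC 0) by (intros E; apply RtoC_inj in E; lra).
  assert (Hz : 0 < Im z) by (unfold z; change (0 < Im tau + 0); lra).
  pose proof (Lipschitz (l - 1) z s ltac:(lia) Hz Hs) as HL. replace (S (l - 1)) with l in HL by lia.
  set (f := fun g => if (snd (wvec r D g) =? 0)%Z then period_term l n tau r D g else RtoC 0).
  destruct (period_term_sum_le l n tau r D Hl Hn HD Ht) as [M HM].
  assert (Hf : has_sum f (Sum f)).
  { apply Sum_spec with M. apply sum_le_mono with (2 := HM). intros g. unfold f.
    destruct (snd (wvec r D g) =? 0)%Z; [lra|]. rewrite Cmod_0. apply Cmod_ge_0. }
  set (G := fun x : bool * Z => (/ RtoC (- INR D) ^ l * / (ZtoC (snd x) + z) ^ l)%C).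
  (* The second column comes from r rs + D k = 1, which makes the determinant equal to 1 and w equal
     to (s, 0). *)
  set (phi := fun x : bool * Z => let s := sign (fst x) in let m := snd x in
    ((s * (rs - Z.of_nat D * m), - s * Z.of_nat D), (s * k + s * Z.of_nat r * m, s * Z.of_nat r))%Z).
  set (ps := fun g : (Z * Z) * (Z * Z) => let w := fst (wvec r D g) in
    ((0 <? w)%Z, (- (w * (k * fst (fst g) - rs * fst (snd g))))%Z)).
  assert (Hphi : forall x, det (phi x) = 1%Z /\ wvec r D (phi x) = (sign (fst x), 0%Z)).
  { intros [b m]. unfold phi, det, wvec; cbn [fst snd].
    assert (Hs2 : (sign b * sign b = 1)%Z) by (destruct b; reflexivity).
    split; [|f_equal].
    - transitivity ((sign b * sign b) * (Z.of_nat r * rs + Z.of_nat D * k))%Z;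
      [ring | rewrite Hs2, Hrs; reflexivity].
    - transitivity (sign b * (Z.of_nat r * rs + Z.of_nat D * k))%Z; [ring | rewrite Hrs; ring].
    - ring. }
  assert (Hval : forall x, f (phi x) = G x).
  { intros [b m]. destruct (Hphi (b, m)) as [H1 H2]. unfold f, period_term. rewrite H1,
    H2. cbn [fst snd Z.eqb].
    unfold G. cbn [snd].
    assert (E1 : lin tau (fst (phi (b, m))) = (ZtoC (sign b) * (RtoC (- INR D) * (ZtoC m + z)))%C).
    { unfold lin, phi, z, ZtoC; cbn [fst snd].
      rewrite !mult_IZR, !opp_IZR, minus_IZR, mult_IZR, <- INR_IZR_INZ.
      rewrite !RtoC_mult, !RtoC_opp, RtoC_minus, RtoC_mult. unfold Rdiv. rewrite RtoC_mult,
        RtoC_inv by lra.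
      field. apply INR_C_nz; auto. }
    assert (E2 : lin tau (sign b, 0%Z) = ZtoC (sign b)).
    { unfold lin, ZtoC; cbn [fst snd]. ring. }
    rewrite E1, E2, !Cpow_mult_l.
    assert (Nm : (ZtoC m + z)%C <> RtoC 0) by (apply Im_pos_nz; rewrite Im_plus_Z; auto).
    pose proof (Cpow_nz _ l Nm). pose proof (Cpow_nz _ l HDz).
    (* The sign enters to the even power l + n, so both signs contribute equally; this is the factor
       2 in the result. *)
    pose proof (ZtoC_sg_pow b (l + n) HK) as HS. rewrite Cpow_add_r in HS.
    transitivity (/ ((ZtoC (sign b) ^ l * ZtoC (sign b) ^ n) * (RtoC (- INR D) ^ l * (ZtoC m + z) ^
      l)))%C.
    - cbn [Pos.eqb]. cbv iota. f_equal. ring.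
    - rewrite HS. set (u := (RtoC (- INR D) ^ l)%C) in *. set (v := ((ZtoC m + z) ^ l)%C) in *.
      field; auto. }
  assert (HG : has_sum G (Sum f)).
  { apply has_sum_reindex with (f := f) (phi := phi) (psi := ps); auto.
    - intros g Hg. assert (E : phi (ps g) = g); [|rewrite <- Hval, E; auto].
      unfold f, period_term in Hg. destruct (Z.eqb_spec (snd (wvec r D g)) 0) as [Hw|]; [|congruence].
      destruct (Z.eqb_spec (det g) 1) as [Hd|]; [|congruence]. clear Hg.
      pose proof (det_wvec r D g) as Hdw. rewrite Hd in Hdw.
      unfold ps, phi, wvec, det in *; cbn [fst snd] in *. destruct g as [[a c] [b d]];
        cbn [fst snd] in *.
      set (m := Z.of_nat D) in *. set (rz := Z.of_nat r) in *. set (w := (rz * a + m * b)%Z) in *.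
      (* Vanishing of the second entry of w makes c a multiple of D, and det(p, w) = D then forces
         the first entry of w to be 1 or -1. *)
      assert (Hc : c = (m * (k * c - d * rs))%Z).
      { transitivity (c * (rz * rs + m * k))%Z; [rewrite Hrs; ring|].
        transitivity ((rz * c + m * d) * rs + m * (k * c - d * rs))%Z; [ring | rewrite Hw; ring]. }
      set (c' := (k * c - d * rs)%Z) in *. clearbody c'.
      assert (Hcw : (- c' * w = 1)%Z).
      { apply Z.mul_reg_l with m; [lia|]. rewrite Hw, Hc in Hdw. lia. }
      assert (Hw1 : w = 1%Z \/ w = (-1)%Z).
      { apply Z.divide_1_r. exists (- c')%Z. lia. }
      assert (Hsg : sign (0 <? w)%Z = w) by (destruct Hw1 as [-> | ->]; reflexivity).
      rewrite Hsg. assert (Hww : (w * w = 1)%Z) by (destruct Hw1 as [-> | ->]; reflexivity).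
      assert (Hc'w : c' = (- w)%Z) by nia.
      f_equal; f_equal.
      + transitivity (w * rs + (w * w) * m * (k * a - rs * b))%Z; [ring|]. rewrite Hww. unfold w.
        transitivity (a * (rz * rs + m * k))%Z; [ring | rewrite Hrs; ring].
      + rewrite Hc, Hc'w. ring.
      + transitivity (w * k - (w * w) * rz * (k * a - rs * b))%Z; [ring|]. rewrite Hww. unfold w.
        transitivity (b * (rz * rs + m * k))%Z; [ring | rewrite Hrs; ring].
      + apply Z.mul_reg_l with m; [lia|]. rewrite Hc, Hc'w in Hw. lia.
    - intros x _. split; [apply Hval|]. destruct x as [b m]. destruct (Hphi (b, m)) as [_ H2].
      unfold ps. rewrite H2. cbn [fst]. f_equal.
      + destruct b; reflexivity.
      + unfold phi; cbn [fst snd]. assert (Hs2 : (sign b * sign b = 1)%Z) by (destruct b; reflexivity).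
        transitivity ((sign b * sign b) * (m * (Z.of_nat r * rs + Z.of_nat D * k)))%Z; [ring|].
        rewrite Hs2, Hrs. ring. }
  assert (HX : has_sum (fun _ : bool => / RtoC (- INR D) ^ l * (Lconst (l - 1) * s))%C (Sum f)).
  { apply has_sum_Fubini with (1 := HG). intros b. unfold G. cbn [snd]. apply has_sum_scal. auto. }
  assert (HX2 := has_sum_finite (fun _ : bool => / RtoC (- INR D) ^ l * (Lconst (l - 1) * s))%C
    [true; false]
    ltac:(repeat constructor; simpl; intuition congruence) ltac:(intros [|] Hb; simpl in Hb; tauto)).
  rewrite (has_sum_unique _ _ _ HX HX2) in Hf.
  match goal with |- has_sum _ ?x => replace x with (lsum (fun _ : bool => / RtoC (- INR D) ^ l *
    (Lconst (l - 1) * s))%C [true; false]) end; auto.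
  simpl. ring.
Qed.

(** * Lattice sums and the error term *)

Lemma lin_opp tau x y : lin tau (- x, - y)%Z = (- lin tau (x, y))%C.
Proof. unfold lin, ZtoC; cbn [fst snd]. rewrite !opp_IZR, !RtoC_opp. ring. Qed.

(** For fixed c this is a row of integers translated by a point at height |c| Im tau; for c < 0 the
    pair is replaced by its negative. *)
Lemma row_sum (tau : C) (c : Z) (l : nat) : 1 <= Im tau -> (2 <= l)%nat -> c <> 0%Z ->
  sum_le (fun a : Z => / Cmod (lin tau (a, c)) ^ l) (8 / (IZR (Z.abs c) * Im tau) ^ (l - 1)).
Proof.
  intros Ht Hl Hc.
  assert (P : forall c, (0 < c)%Z -> sum_le (fun a : Z => / Cmod (lin tau (a,
    c)) ^ l) (8 / (IZR c * Im tau) ^ (l - 1))).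
  { intros c' Hc'. assert (1 <= IZR c') by (apply IZR_le; lia).
    assert (E : Im (ZtoC c' * tau)%C = IZR c' * Im tau) by (unfold ZtoC, Im; simpl; ring).
    pose proof (sum_row (ZtoC c' * tau)%C l) as H0. rewrite E in H0. apply H0; auto. nra. }
  destruct (Z_lt_le_dec 0 c) as [H|H].
  - rewrite Z.abs_eq by lia. apply P; auto.
  - rewrite Z.abs_neq by lia.
    apply sum_le_inj with (phi := Z.opp) (m' := fun a : Z => / Cmod (lin tau (a, (- c)%Z)) ^ l).
    + intros a. left. apply Rinv_0_lt_compat, pow_lt, Cmod_gt_0, lin_nz; [lra | congruence].
    + intros a _. right. f_equal. f_equal. rewrite <- Cmod_opp. f_equal.
      unfold lin, ZtoC; cbn [fst snd]. rewrite !opp_IZR, !RtoC_opp. ring.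
    + intros; lia.
    + apply P. lia.
Qed.

(** The constant 384 is 8 * 3 * 16: 8 from each row, 3 from 1/c^2 <= 3 [wt c], and 16 from the sum
    of [wt]. *)
Lemma lin_sum (tau : C) (l : nat) : 1 <= Im tau -> (3 <= l)%nat ->
  sum_le (fun p => if (snd p =? 0)%Z then 0 else / Cmod (lin tau p) ^ l) (384 / Im tau ^ (l - 1)).
Proof.
  intros Ht Hl. set (Y := Im tau) in *.
  assert (HYp : 0 < Y ^ (l - 1)) by (apply pow_lt; lra).
  assert (Hpos : forall p, 0 <= (if (snd p =? 0)%Z then 0 else / Cmod (lin tau p) ^ l)).
  { intros p. destruct (Z.eqb_spec (snd p) 0); [lra|]. left.
    apply Rinv_0_lt_compat, pow_lt, Cmod_gt_0, lin_nz; [fold Y; lra|]. destruct p; simpl in *;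
      congruence. }
  apply sum_le_inj with (phi := fun p => (snd p, fst p))
    (m' := fun x : Z * Z => if (fst x =? 0)%Z then 0 else / Cmod (lin tau (snd x, fst x)) ^ l); auto.
  - intros [a c] _. simpl. lra.
  - intros [a c] [a' c'] _ _ E. simpl in E. congruence.
  - apply sum_le_prod with (fun c => 24 / Y ^ (l - 1) * wt c).
    + intros [c a]. apply (Hpos (a, c)).
    + intros c. cbn [fst snd]. pose proof (wt_pos c) as Hw. destruct (Z.eqb_spec c 0) as [Hc|Hc].
      * intros L _. rewrite rsum_const, Rmult_0_r. apply Rmult_le_pos; [|lra].
        apply Rdiv_le_0_compat; lra.
      * intros L HL. eapply Rle_trans; [apply (row_sum tau c l Ht ltac:(lia) Hc); auto|]. fold Y.
        set (x := IZR (Z.abs c)). assert (Hx : 1 <= x) by (apply IZR_le; lia).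
        rewrite Rpow_mult_distr. unfold Rdiv. rewrite Rinv_mult.
        assert (Hxl : x * x <= x ^ (l - 1)).
        { replace (x * x) with (x ^ 2) by ring. apply Rle_pow; auto. lia. }
        assert (Hwt : / (x * x) <= 3 * wt c).
        { unfold wt. fold x. assert (Hsq : sqrt (1 + x) <= 3 / 2 * x).
          { apply Rsqr_incr_0_var; [|lra]. unfold Rsqr. rewrite sqrt_sqrt; nra. }
          assert (0 < sqrt (1 + x)) by (apply sqrt_lt_R0; lra).
          rewrite <- (Rinv_inv 3), <- Rinv_mult. apply Rinv_le_contravar; [nra|]. nra. }
        assert (/ x ^ (l - 1) <= / (x * x)) by (apply Rinv_le_contravar; nra).
        assert (0 < / Y ^ (l - 1)) by (apply Rinv_0_lt_compat; auto). nra.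
    + replace (384 / Y ^ (l - 1)) with (24 / Y ^ (l - 1) * 16) by (field; lra).
      apply sum_le_scal; [apply Rdiv_le_0_compat; lra | apply wt_sum].
Qed.

(** The first summand bounds the terms with p = 1 or -1, the second those in which both p and w have
    a nonzero coefficient at tau. *)
Definition error_bound (l n D : nat) (Y : R) : R :=
  16 / (INR D * Y) ^ (n - 1) + 384 / Y ^ (n - 1) * (384 / Y ^ (l - 1)).

Lemma mul_eq_1 (a d : Z) : (a * d = 1)%Z -> (a = 1 /\ d = 1)%Z \/ (a = -1 /\ d = -1)%Z.
Proof.
  intros H. assert (Ha : (a = 1 \/ a = -1)%Z) by (apply Z.divide_1_r; exists d; lia). lia.
Qed.

(** If c = 0 then a = d is 1 or -1, and up to sign w = x + D tau with x an integer, so these terms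
    lie in two rows at height D Y. For the others the pair (p, w) has nonzero second entries, and
    the sum is bounded by a product of two lattice sums. *)
Lemma error_sum l n tau (r D : nat) : (3 <= l)%nat -> (3 <= n)%nat -> (0 < D)%nat -> 1 <= Im tau ->
  sum_le (fun g => Cmod (if (snd (wvec r D g) =? 0)%Z then RtoC 0 else period_term l n tau r D g))
    (error_bound l n D (Im tau)).
Proof.
  intros Hl Hn HD Ht. set (Y := Im tau) in *.
  assert (Ht0 : 0 < Im tau) by (fold Y; lra).
  assert (HDR : 1 <= INR D) by (replace 1 with (INR 1) by reflexivity; apply le_INR; lia).
  set (t := fun g => Cmod (if (snd (wvec r D g) =? 0)%Z then RtoC 0 else period_term l n tau r D g)).
  set (t1 := fun g => if (snd (fst g) =? 0)%Z then t g else 0).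
  set (t2 := fun g => if (snd (fst g) =? 0)%Z then 0 else t g).
  assert (Htpos : forall g, 0 <= t g) by (intros g; apply Cmod_ge_0).
  assert (Ht1 : sum_le t1 (16 / (INR D * Y) ^ (n - 1))).
  { set (v := fun x : bool * Z => / Cmod (lin tau (snd x, Z.of_nat D)) ^ n).
    apply sum_le_inj with (phi := fun g : (Z * Z) * (Z * Z) => ((0 <? fst (fst g))%Z,
      (fst (fst g) * fst (wvec r D g))%Z)) (m' := v).
    - intros g. unfold t1. destruct (snd (fst g) =? 0)%Z; auto; lra.
    - intros [[a c] [b d]] H. unfold t1, t, period_term, v in *. cbn [fst snd] in *.
      destruct (Z.eqb_spec c 0) as [->|]; [|lra].
      destruct (Z.eqb_spec (snd (wvec r D ((a, 0%Z), (b, d)))) 0) as [|Hw2]; [rewrite Cmod_0 in H; lra|].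
      destruct (Z.eqb_spec (det ((a, 0%Z), (b, d))) 1) as [Hd|]; [|rewrite Cmod_0 in H; lra].
      unfold det in Hd; cbn [fst snd] in Hd.
      assert (Had : (a = 1 /\ d = 1)%Z \/ (a = -1 /\ d = -1)%Z) by (apply mul_eq_1; lia).
      assert (Np : lin tau (a, 0%Z) <> RtoC 0) by (apply lin_nz; auto; intros E; inversion E; lia).
      assert (Nw : lin tau (wvec r D ((a, 0%Z), (b, d))) <> RtoC 0).
      { apply lin_nz; auto. intros E. rewrite E in Hw2. simpl in Hw2. lia. }
      rewrite Cmod_inv by (apply Cmult_neq_0; apply Cpow_nz; auto).
      rewrite Cmod_mult, !Cmod_pow.
      assert (E1 : Cmod (lin tau (a, 0%Z)) = 1).
      { unfold lin, ZtoC; cbn [fst snd]. rewrite Cmult_0_l, Cplus_0_r, Cmod_R, <- abs_IZR.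
        f_equal. lia. }
      rewrite E1, pow1, Rmult_1_l.
      right. f_equal. f_equal. unfold wvec; cbn [fst snd].
      destruct Had as [[-> ->]|[-> ->]].
      + f_equal. f_equal. f_equal; ring.
      + rewrite <- Cmod_opp, <- lin_opp. f_equal. f_equal. cbn [fst snd]. f_equal; ring.
    - intros [[a c] [b d]] [[a' c'] [b' d']] H H' E. unfold t1, t, period_term in H,
      H'. cbn [fst snd] in *.
      destruct (Z.eqb_spec c 0) as [->|]; [|lra]. destruct (Z.eqb_spec c' 0) as [->|]; [|lra].
      destruct (snd (wvec r D ((a, 0%Z), (b, d))) =? 0)%Z; [rewrite Cmod_0 in H; lra|].
      destruct (snd (wvec r D ((a', 0%Z), (b', d'))) =? 0)%Z; [rewrite Cmod_0 in H'; lra|].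
      destruct (Z.eqb_spec (det ((a, 0%Z), (b, d))) 1) as [Hd|]; [|rewrite Cmod_0 in H; lra].
      destruct (Z.eqb_spec (det ((a', 0%Z), (b', d'))) 1) as [Hd'|]; [|rewrite Cmod_0 in H'; lra].
      clear H H'. unfold det in Hd, Hd'; cbn [fst snd] in Hd, Hd'.
      assert (Had : (a = 1 /\ d = 1)%Z \/ (a = -1 /\ d = -1)%Z) by (apply mul_eq_1; lia).
      assert (Had' : (a' = 1 /\ d' = 1)%Z \/ (a' = -1 /\ d' = -1)%Z) by (apply mul_eq_1; lia).
      unfold wvec in E; cbn [fst snd] in E. injection E as E1 E2.
      destruct Had as [[-> ->]|[-> ->]], Had' as [[-> ->]|[-> ->]]; try discriminate E1;
        (assert (b = b') by nia); congruence.
    - replace (16 / (INR D * Y) ^ (n - 1)) with (2 * (8 / (INR D * Y) ^ (n - 1))).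
      2: { field. apply pow_nonzero. nra. }
      apply sum_le_prod with (fun _ => 8 / (INR D * Y) ^ (n - 1)).
      + intros [b x]. unfold v. left. apply Rinv_0_lt_compat, pow_lt, Cmod_gt_0, lin_nz; auto.
        cbn [snd]. intros E. inversion E. lia.
      + intros b. unfold v; cbn [snd].
        pose proof (row_sum tau (Z.of_nat D) n Ht ltac:(lia) ltac:(lia)) as H.
        rewrite Z.abs_eq, <- INR_IZR_INZ in H by lia. exact H.
      + intros L HL. rewrite rsum_const. apply Rmult_le_compat_r.
        * apply Rdiv_le_0_compat; [lra|]. apply pow_lt. nra.
        * replace 2 with (INR (length [true; false])) by (simpl; ring).
          apply le_INR. apply NoDup_incl_length; auto. intros [|] _; simpl; auto. }
  assert (Ht2 : sum_le t2 (384 / Y ^ (n - 1) * (384 / Y ^ (l - 1)))).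
  { set (u := fun (j : nat) p => if (snd p =? 0)%Z then 0 else / Cmod (lin tau p) ^ j).
    assert (Hu : forall j p, 0 <= u j p).
    { intros j p. unfold u. destruct (Z.eqb_spec (snd p) 0); [lra|]. left.
      apply Rinv_0_lt_compat, pow_lt, Cmod_gt_0, lin_nz; auto. destruct p; simpl in *; congruence. }
    apply sum_le_inj with (phi := fun g => (fst g,
      wvec r D g)) (m' := fun x => u l (fst x) * u n (snd x)).
    - intros g. unfold t2. destruct (snd (fst g) =? 0)%Z; auto; lra.
    - intros g H. unfold t2, t, u, period_term in *. cbn [fst snd].
      destruct (Z.eqb_spec (snd (fst g)) 0) as [|Hc]; [lra|].
      destruct (Z.eqb_spec (snd (wvec r D g)) 0) as [|Hw]; [rewrite Cmod_0 in H; lra|].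
      destruct (Z.eqb_spec (det g) 1) as [Hd|]; [|rewrite Cmod_0 in H; lra].
      destruct (det_nz g Hd) as [Hp _].
      assert (Np : lin tau (fst g) <> RtoC 0) by (apply lin_nz; auto).
      assert (Nw : lin tau (wvec r D g) <> RtoC 0) by (apply lin_nz; auto; apply wvec_nz; auto).
      rewrite Cmod_inv by (apply Cmult_neq_0; apply Cpow_nz; auto).
      rewrite Cmod_mult, !Cmod_pow, Rinv_mult. lra.
    - intros g g' _ _ E. apply (wvec_inj r D); auto.
    - apply sum_le_mult; auto; apply lin_sum; auto. }
  unfold error_bound. apply sum_le_mono with (fun g => t1 g + t2 g); [|apply sum_le_plus; auto].
  intros g. unfold t1, t2. fold (t g). destruct (snd (fst g) =? 0)%Z; lra.
Qed.

(* Averaging over the N-th roots of unity isolates the coefficients with index congruent to n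
   modulo N; for N large those other than the n-th are negligible. *)
Lemma coef_bound (b : nat -> C) (M E : R) (n : nat) :
  sum_le (fun m => Cmod (b m)) M ->
  (forall x : R, exists s, has_sum (fun m => b m * qpar (RtoC (INR m * x)))%C s /\ Cmod s <= E) ->
  Cmod (b n) <= E.
Proof.
  intros HM HE. apply le_epsilon. intros eps He.
  destruct (sum_le_tail (fun m => Cmod (b m)) M) with (eps := eps) as [l0 [Hl0 Ht]]; auto.
  { intros; apply Cmod_ge_0. }
  (* N exceeds |m - n| for every m in [l0], so an index other than n that is congruent to n modulo N
     lies in the tail. *)
  set (N := (n + list_max l0 + 1)%nat).
  assert (HN : (0 < N)%nat) by (unfold N; lia). assert (HNR : 0 < INR N) by (apply lt_0_INR; auto).
  set (sx := fun x : R => epsilon (inhabits (RtoC 0)) (fun s => has_sum (fun m => b m * qpar (RtoC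
    (INR m * x)))%C s /\ Cmod s <= E)).
  assert (Hsx : forall x, has_sum (fun m => b m * qpar (RtoC (INR m * x)))%C (sx x) /\ Cmod (sx x) <= E).
  { intros x. unfold sx. apply epsilon_spec. apply HE. }
  set (T := lsum (fun j : nat => qpar (RtoC (- (INR j * INR n / INR N))) * sx (INR j / INR N)%R)%C
    (seq 0 N)).
  assert (HT : has_sum (fun m => b m * (if ((Z.of_nat m - Z.of_nat n) mod Z.of_nat N =? 0)%Z then
    RtoC (INR N) else RtoC 0))%C T).
  { assert (H : forall j, In j (seq 0 N) -> has_sum (fun m => qpar (RtoC (- (INR j * INR n / INR
    N))) * (b m * qpar (RtoC (INR m * (INR j / INR N)))))%C
      (qpar (RtoC (- (INR j * INR n / INR N))) * sx (INR j / INR N)%R)%C).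
    { intros j _. apply has_sum_scal. apply Hsx. }
    apply has_sum_ext with (2 := has_sum_lsum _ _ _ H). intros m.
    rewrite <- unity_sum, <- lsum_scal by auto. apply lsum_ext. intros j _.
    transitivity (b m * (qpar (RtoC (- (INR j * INR n / INR N))) * qpar (RtoC (INR m * (INR j / INR
      N)))))%C; [ring|].
    rewrite <- qpar_plus, <- RtoC_plus. do 3 f_equal.
    rewrite minus_IZR, <- !INR_IZR_INZ. field. lra. }
  assert (HTb : Cmod T <= INR N * E).
  { unfold T. eapply Rle_trans; [apply Cmod_lsum|].
    apply Rle_trans with (rsum (fun _ : nat => E) (seq 0 N)).
    - apply rsum_le. intros j _. rewrite Cmod_mult, Cmod_qpar_R, Rmult_1_l. apply Hsx.
    - rewrite rsum_const, length_seq. lra. }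
  set (d := fun m => if (m =? n)%nat then (RtoC (INR N) * b n)%C else RtoC 0).
  assert (Hd : has_sum d (RtoC (INR N) * b n)%C).
  { replace (RtoC (INR N) * b n)%C with (lsum d [n]).
    - apply has_sum_finite; [repeat constructor; simpl; tauto|]. intros m Hm. unfold d.
      destruct (Nat.eqb_spec m n); auto. exfalso. apply Hm. left; auto.
    - simpl. unfold d. rewrite Nat.eqb_refl. ring. }
  pose proof (has_sum_plus _ _ _ _ HT (has_sum_scal (RtoC (-1)) _ _ Hd)) as Hdiff.
  assert (Hdb : Cmod (T + RtoC (-1) * (RtoC (INR N) * b n))%C <= INR N * eps).
  { apply has_sum_bound with (2 := Hdiff). intros l Hl. cbv beta.
    set (l' := filter (fun m => if in_dec eqd m l0 then false else true) l).
    assert (Hl' : rsum (fun m => Cmod (b m)) l' <= eps).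
    { apply Ht; [apply NoDup_filter; auto|]. intros m Hm. unfold l' in Hm. apply filter_In in Hm.
      destruct (in_dec eqd m l0); intuition congruence. }
    apply Rle_trans with (INR N * rsum (fun m => Cmod (b m)) l'); [|apply Rmult_le_compat_l; lra].
    unfold l'. clear Hl Hl' l'. induction l as [|m l IH]; simpl; [lra|].
    assert (Hm : Cmod (b m * (if ((Z.of_nat m - Z.of_nat n) mod Z.of_nat N =? 0)%Z then RtoC (INR
      N) else RtoC 0) + RtoC (-1) * d m)%C
       <= INR N * (if in_dec eqd m l0 then 0 else Cmod (b m))).
    { unfold d. destruct (Nat.eqb_spec m n) as [->|Hmn].
      - rewrite Z.sub_diag, Z.mod_0_l by lia. cbn [Z.eqb].
        replace (b n * RtoC (INR N) + RtoC (-1) * (RtoC (INR N) * b n))%C with (RtoC 0) by ring.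
        rewrite Cmod_0. apply Rmult_le_pos; [lra|]. destruct (in_dec eqd n l0); [lra | apply Cmod_ge_0].
      - rewrite Cmult_0_r, Cplus_0_r, Cmod_mult.
        destruct (Z.eqb_spec ((Z.of_nat m - Z.of_nat n) mod Z.of_nat N) 0) as [Hz|Hz].
        + rewrite Cmod_INR. destruct (in_dec eqd m l0) as [Hin|Hin]; [|lra]. exfalso.
          assert (m <= list_max l0)%nat.
          { pose proof (proj1 (list_max_le l0 (list_max l0)) (le_n _)) as HF.
            rewrite Forall_forall in HF. auto. }
          apply Z.mod_divide in Hz; [|lia]. destruct Hz as [q Hq].
          assert (Hb : (- Z.of_nat N < q * Z.of_nat N < Z.of_nat N)%Z) by (unfold N in *; lia).
          assert (q = 0)%Z by nia. subst q. lia.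
        + rewrite Cmod_0, Rmult_0_r. apply Rmult_le_pos; [lra|]. destruct (in_dec eqd m l0);
          [lra | apply Cmod_ge_0]. }
    destruct (in_dec eqd m l0); simpl; lra. }
  assert (Hfin : INR N * Cmod (b n) <= INR N * E + INR N * eps).
  { rewrite <- (Cmod_INR N) at 1. rewrite <- Cmod_mult.
    replace (RtoC (INR N) * b n)%C with (T + - (T + RtoC (-1) * (RtoC (INR N) * b n)))%C by ring.
    eapply Rle_trans; [apply Cmod_triangle|]. rewrite Cmod_opp. lra. }
  apply Rmult_le_reg_l with (INR N); auto. lra.
Qed.

(** The arithmetic part of the m-th Fourier coefficient in tau of the main terms, combined with
    weights [Cr]; the factor m^(l-1) is kept apart. *)
Definition main_coef (D : nat) (Cr : nat -> C) (m : nat) : C :=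
  lsum (fun r => Cr r * qpar (RtoC (- (INR m * IZR (inv_mod D (Z.of_nat r)) / INR D))))%C (seq 0 D).

(** The relation holds at every point x + i Y of a horizontal line. There the main terms form an
    absolutely convergent Fourier series in x, bounded by D B times the error bound, and each of its
    coefficients obeys the same bound. *)
Lemma coefficient_bound l n D (Y B : R) (Cr : nat -> C) :
  (3 <= l)%nat -> (3 <= n)%nat -> (0 < D)%nat -> Nat.Even (l + n) -> 1 <= Y ->
  (forall r, (r < D)%nat -> Cmod (Cr r) <= B) ->
  (forall r, Z.gcd (Z.of_nat r) (Z.of_nat D) <> 1%Z -> Cr r = RtoC 0) ->
  (forall tau, 0 < Im tau -> lsum (fun r => Cr r * Sum (period_term l n tau r D))%C (seq 0 D) =
    RtoC 0) ->
  forall m, Cmod (main_coef D Cr m) * (INR m ^ (l - 1) * exp (- (2 * PI * (INR m * Y))) *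
     (2 * / INR D ^ l * Cmod (Lconst (l - 1)))) <= INR D * B * error_bound l n D Y.
Proof.
  intros Hl Hn HD HK HY HB Hz HR m.
  assert (HDR : 0 < INR D) by (apply lt_0_INR; auto).
  assert (HDz : RtoC (- INR D) <> RtoC 0) by (intros E; apply RtoC_inj in E; lra).
  set (c0 := (RtoC 2 * (/ RtoC (- INR D) ^ l * Lconst (l - 1)))%C).
  set (b := fun m : nat => (c0 * RtoC (INR m ^ (l - 1)) * main_coef D Cr m * qpar (0, Y) ^ m)%C).
  assert (Hc0 : Cmod c0 = 2 * / INR D ^ l * Cmod (Lconst (l - 1))).
  { unfold c0. rewrite !Cmod_mult, Cmod_inv, Cmod_pow, !Cmod_R, Rabs_Ropp,
    !Rabs_pos_eq by (try (apply Cpow_nz; auto); lra). ring. }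
  assert (Hqm : forall m, Cmod (qpar (0, Y) ^ m)%C = exp (- (2 * PI * (INR m * Y)))).
  { intros j. rewrite qpar_pow, Cmod_qpar. f_equal. f_equal. unfold Im; simpl. ring. }
  assert (Hb : Cmod (b m) <= INR D * B * error_bound l n D Y).
  2: { unfold b in Hb. rewrite !Cmod_mult, Hqm, Hc0, Cmod_R, Rabs_pos_eq in Hb by (apply pow_le,
    pos_INR).
    eapply Rle_trans; [|apply Hb]. right. ring. }
  assert (HB0 : 0 <= B).
  { eapply Rle_trans; [apply Cmod_ge_0 | apply (HB 0%nat HD)]. }
  destruct (pow_geom_sum (l - 1) (Cmod (qpar (0, Y)))) as [M HM].
  { split; [apply Cmod_ge_0 | apply Cmod_qpar_lt_1; simpl; lra]. }
  apply coef_bound with (M := Cmod c0 * (INR D * B) * M).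
  - apply sum_le_mono with (fun m => Cmod c0 * (INR D * B) * (INR m ^ (l - 1) * Cmod (qpar (0, Y)) ^ m)).
    + intros j. unfold b. rewrite !Cmod_mult, Cmod_R, Rabs_pos_eq, Cmod_pow by (apply pow_le, pos_INR).
      assert (HA : Cmod (main_coef D Cr j) <= INR D * B).
      { unfold main_coef. eapply Rle_trans; [apply Cmod_lsum|].
        replace (INR D * B) with (rsum (fun _ : nat => B) (seq 0 D)) by (rewrite rsum_const,
          length_seq; auto).
        apply rsum_le. intros r Hr. apply in_seq in Hr. rewrite Cmod_mult, Cmod_qpar_R,
          Rmult_1_r. apply HB. lia. }
      replace (Cmod c0 * INR j ^ (l - 1) * Cmod (main_coef D Cr j) * Cmod (qpar (0, Y)) ^ j) with
        ((Cmod c0 * (INR j ^ (l - 1) * Cmod (qpar (0, Y)) ^ j)) * Cmod (main_coef D Cr j)) by ring.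
      replace (Cmod c0 * (INR D * B) * (INR j ^ (l - 1) * Cmod (qpar (0, Y)) ^ j)) with
        ((Cmod c0 * (INR j ^ (l - 1) * Cmod (qpar (0, Y)) ^ j)) * (INR D * B)) by ring.
      apply Rmult_le_compat_l; auto. apply Rmult_le_pos; [apply Cmod_ge_0|].
      apply Rmult_le_pos; apply pow_le; [apply pos_INR | apply Cmod_ge_0].
    + apply sum_le_scal; auto. apply Rmult_le_pos; [apply Cmod_ge_0 | apply Rmult_le_pos; lra].
  - intros x. set (tau := (x, Y) : C). assert (Ht : 0 < Im tau) by (simpl; lra).
    set (zr := fun r : nat => (tau + RtoC (- (IZR (inv_mod D (Z.of_nat r)) / INR D)))%C).
    set (S := fun r => Sum (fun m : nat => RtoC (INR m ^ (l - 1)) * qpar (zr r) ^ m)%C).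
    assert (HS : forall r, has_sum (fun m : nat => RtoC (INR m ^ (l - 1)) * qpar (zr r) ^ m)%C (S r)).
    { intros r. unfold S, Sum. apply epsilon_spec. apply qser_ex. unfold zr.
      change (0 < Im tau + 0). lra. }
    exists (lsum (fun r => Cr r * (c0 * S r))%C (seq 0 D)). split.
    + assert (H : forall r, In r (seq 0 D) -> has_sum (fun m : nat => Cr r * (c0 * (RtoC (INR m ^
      (l - 1)) * qpar (zr r) ^ m)))%C (Cr r * (c0 * S r))%C).
      { intros r _. apply has_sum_scal, has_sum_scal, HS. }
      apply has_sum_ext with (2 := has_sum_lsum _ _ _ H). intros j. unfold b, main_coef.
      transitivity (c0 * RtoC (INR j ^ (l - 1)) * (qpar (0, Y) ^ j * qpar (RtoC (INR j * x))) *
        lsum (fun r => Cr r * qpar (RtoC (- (INR j * IZR (inv_mod D (Z.of_nat r)) / INR D))))%C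
          (seq 0 D))%C; [|ring].
      rewrite <- lsum_scal. apply lsum_ext. intros r _.
      assert (E : (qpar (zr r) ^ j)%C = (qpar (0,
        Y) ^ j * qpar (RtoC (INR j * x)) * qpar (RtoC (- (INR j * IZR (inv_mod D (Z.of_nat r)) /
          INR D))))%C).
      { rewrite !qpar_pow, <- !qpar_plus. f_equal. unfold zr, tau.
        apply injective_projections; simpl; field; lra. }
      rewrite E. ring.
    + assert (Hpart : forall r, exists e, Cmod e <= error_bound l n D Y /\
        (Cr r * (c0 * S r))%C = (Cr r * Sum (period_term l n tau r D) - Cr r * e)%C).
      { intros r. pose proof (error_sum l n tau r D Hl Hn HD ltac:(simpl;
        auto)) as He. change (Im tau) with Y in He.
        destruct (has_sum_ex _ _ He) as [e Hes]. exists e. split; [exact (has_sum_bound _ _ _ He Hes)|].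
        destruct (Z.eq_dec (Z.gcd (Z.of_nat r) (Z.of_nat D)) 1) as [Hr|Hr]; [|rewrite Hz by auto; ring].
        destruct (inv_mod_spec D _ HD Hr) as [_ [q Hq]].
        pose proof (main_sum l n tau r D (inv_mod D (Z.of_nat r)) (- q)%Z (S r) Hl Hn HD HK Ht
          ltac:(lia) (HS r)) as Hm.
        destruct (period_term_sum_le l n tau r D Hl Hn HD Ht) as [M' HM'].
        assert (Et : Sum (period_term l n tau r D) = (RtoC 2 * (/ RtoC (- INR D) ^ l * (Lconst (l -
          1) * S r)) + e)%C).
        { eapply has_sum_unique; [apply Sum_spec with M'; auto|].
          apply has_sum_ext with (2 := has_sum_plus _ _ _ _ Hm Hes). intros g.
          destruct (snd (wvec r D g) =? 0)%Z; ring. }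
        rewrite Et. unfold c0. ring. }
      set (e := fun r => epsilon (inhabits (RtoC 0)) (fun e => Cmod e <= error_bound l n D Y /\
        (Cr r * (c0 * S r))%C = (Cr r * Sum (period_term l n tau r D) - Cr r * e)%C)).
      assert (He : forall r, Cmod (e r) <= error_bound l n D Y /\
        (Cr r * (c0 * S r))%C = (Cr r * Sum (period_term l n tau r D) - Cr r * e r)%C).
      { intros r. unfold e. apply epsilon_spec. auto. }
      rewrite (lsum_ext _ (fun r => Cr r * Sum (period_term l n tau r D) - Cr r * e r)%C) by
        (intros; apply He).
      rewrite lsum_minus, HR by auto.
      replace (RtoC 0 - lsum (fun r => Cr r * e r) (seq 0 D))%C with (- lsum (fun r => Cr r * e r)
        (seq 0 D))%C by ring.
      rewrite Cmod_opp. eapply Rle_trans; [apply Cmod_lsum|].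
      replace (INR D * B * error_bound l n D Y) with (rsum (fun _ : nat => B * error_bound l n D Y)
        (seq 0 D))
        by (rewrite rsum_const, length_seq; ring).
      apply rsum_le. intros r Hr. apply in_seq in Hr. rewrite Cmod_mult.
      apply Rmult_le_compat; try apply Cmod_ge_0; [apply HB; lia | apply He].
Qed.

(** * Stirling's bound and the choice of the height *)

Lemma fact_exp_le L : (1 <= L)%nat -> INR (fact L) * exp (INR L) <= 3 * INR L * INR L ^ L.
Proof.
  intros HL. induction HL as [|L HL IH].
  - simpl. pose proof exp_le_3. lra.
  - assert (HLR : 1 <= INR L) by (replace 1 with (INR 1) by reflexivity; apply le_INR; auto).
    assert (Hstep : exp 1 * INR L ^ S L <= INR (S L) ^ S L).
    { rewrite S_INR.
      (* Raised to the power L + 1, the inequality 1 - 1/(L+1) <= e^(-1/(L+1)) gives e L^(L+1) <=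
         (L+1)^(L+1), the inductive step for this weak form of Stirling's bound. *)
      assert (H1 : INR L / (INR L + 1) <= exp (- / (INR L + 1))).
      { eapply Rle_trans; [|apply exp_ineq1_le]. right. field. lra. }
      assert (H0 : 0 <= INR L / (INR L + 1)) by (apply Rdiv_le_0_compat; lra).
      pose proof (pow_incr _ _ (S L) (conj H0 H1)) as H2.
      assert (H3 : exp (- / (INR L + 1)) ^ S L * exp 1 = 1).
      { assert (E : forall k x, exp x ^ k = exp (INR k * x)).
        { induction k as [|k IHk]; intros x; [simpl; rewrite Rmult_0_l, exp_0; auto|].
          rewrite S_INR. simpl. rewrite IHk, <- exp_plus. f_equal. ring. }
        rewrite E, <- exp_plus, S_INR. transitivity (exp 0); [f_equal; field; lra | apply exp_0]. }
      unfold Rdiv in H2. rewrite Rpow_mult_distr, pow_inv in H2.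
      assert (Hp : 0 < (INR L + 1) ^ S L) by (apply pow_lt; lra).
      pose proof (exp_pos 1).
      apply Rmult_le_reg_r with (/ (INR L + 1) ^ S L); [apply Rinv_0_lt_compat; auto|].
      rewrite Rinv_r by lra. nra. }
    change (fact (S L)) with (S L * fact L)%nat. rewrite mult_INR.
    replace (exp (INR (S L))) with (exp (INR L) * exp 1) by (rewrite S_INR, exp_plus; auto).
    pose proof (exp_pos 1). pose proof (exp_pos (INR L)). pose proof (pos_INR (S L)).
    replace (INR (S L) * INR (fact L) * (exp (INR L) * exp 1)) with
      (INR (S L) * exp 1 * (INR (fact L) * exp (INR L))) by ring.
    apply Rle_trans with (INR (S L) * exp 1 * (3 * INR L * INR L ^ L)).
    + apply Rmult_le_compat_l; auto. apply Rmult_le_pos; lra.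
    + replace (INR (S L) * exp 1 * (3 * INR L * INR L ^ L)) with (3 * INR (S L) * (exp 1 * INR L ^
      S L)) by (simpl pow; ring).
      apply Rmult_le_compat_l; auto. lra.
Qed.

Lemma Cmod_Lconst k : Cmod (Lconst k) = (2 * PI) ^ S k / INR (fact k).
Proof.
  unfold Lconst. pose proof PI_RGT_0.
  rewrite Cmod_div, Cmod_pow, Cmod_mult, Cmod_Ci, Cmod_R, Cmod_INR, Rabs_Ropp, Rabs_pos_eq,
    Rmult_1_r by (try apply fact_C_nz; lra).
  reflexivity.
Qed.

Lemma pow_ge_linear (Y : R) (i : nat) : 2 <= Y -> Y + INR i <= Y ^ S i.
Proof.
  intros HY. induction i as [|i IH]; [simpl; lra|]. pose proof (pos_INR i).
  rewrite S_INR. change (Y ^ S (S i)) with (Y * Y ^ S i). nra.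
Qed.

Lemma sq_le_pow2 (h : nat) : INR h * INR h <= 4 * 2 ^ h.
Proof.
  assert (P : forall h, (4 <= h)%nat -> INR h * INR h <= 2 ^ h).
  { intros h' Hh. induction Hh as [|h' Hh IH]; [simpl; lra|].
    assert (4 <= INR h') by (replace 4 with (INR 4) by (simpl; ring); apply le_INR; auto).
    rewrite S_INR. change (2 ^ S h') with (2 * 2 ^ h'). nra. }
  destruct (le_lt_dec 4 h) as [H|H].
  - specialize (P h H). assert (0 <= INR h * INR h) by (apply Rle_0_sqr). lra.
  - destruct h as [|[|[|[|h]]]]; [simpl; lra | simpl; lra | simpl; lra | simpl; lra | lia].
Qed.

(* Y is, up to a constant, the height at which m^(l-1) e^(-2 pi m Y) dominates. *)
Lemma error_bound_small (Nmax D : nat) (delta : R) : (1 <= Nmax)%nat -> (0 < D)%nat -> 0 < delta ->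
  exists K0 : nat, forall l n m : nat, (K0 <= l + n)%nat -> (3 <= l)%nat -> (l + 2 <= n)%nat ->
  (1 <= m <= Nmax)%nat -> exists Y, 1 <= Y /\
  INR D * error_bound l n D Y <= delta * (INR m ^ (l - 1) * exp (- (2 * PI * (INR m * Y))) *
     (2 * / INR D ^ l * Cmod (Lconst (l - 1)))).
Proof.
  intros HN HD Hdelta. pose proof PI_RGT_0 as Hpi. pose proof PI_4 as Hpi4.
  assert (Hpi3 : 3 <= PI) by (pose proof PI2_3_2; lra).
  assert (HNR : 1 <= INR Nmax) by (replace 1 with (INR 1) by reflexivity; apply le_INR; auto).
  assert (HDR : 1 <= INR D) by (replace 1 with (INR 1) by reflexivity; apply le_INR; lia).
  (* The cost of raising the height by 2D: the factor e^(4 pi m D) is at most [C1] for all m <=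
     Nmax. *)
  set (C1 := exp (4 * PI * INR Nmax * INR D)). assert (HC1 : 0 < C1) by apply exp_pos.
  (* Chosen so that Y >= c (l-1) for every m <= Nmax. *)
  set (c := / (2 * PI * INR Nmax)).
  assert (Hc0 : 1 <= 2 * PI * INR Nmax) by nra.
  assert (Hc : 0 < c) by (apply Rinv_0_lt_compat; lra).
  assert (Hc1 : c <= 1) by (unfold c; rewrite <- Rinv_1; apply Rinv_le_contravar; lra).
  (* This collects the constants of [T1], [T2] and [Hsplit]. The final estimate is delta X / Q with
     Q = (l+n)/2 - 2, and l + n >= 2X + 6 makes Q at least X. *)
  set (X := (48 * C1 / (c * c) + 24 * (384 * 384) * C1) / delta).
  destruct (INR_unbounded (2 * X + 6)) as [K0 HK0]. exists (K0 + 10)%nat.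
  intros l n m HK Hl Hn Hm.
  assert (Hm1 : 1 <= INR m) by (replace 1 with (INR 1) by reflexivity; apply le_INR; lia).
  assert (HmN : INR m <= INR Nmax) by (apply le_INR; lia).
  assert (Hmp : 0 < 2 * PI * INR m) by nra.
  set (L := (l - 1)%nat). assert (HlL : l = S L) by (unfold L; lia).
  assert (HL2 : 2 <= INR L) by (replace 2 with (INR 2) by (simpl; ring); apply le_INR; unfold L; lia).
  set (Y0 := INR L / (2 * PI * INR m)).
  assert (HY0 : 0 < Y0) by (apply Rdiv_lt_0_compat; lra).
  (* [Y0] maximises m^(l-1) e^(-2 pi m Y). The added 2D keeps Y >= 2 when l is small and lets
     Y^(n-1) outweigh D^(l+1). *)
  set (Y := Y0 + 2 * INR D). exists Y.
  assert (HY2 : 2 <= Y) by (unfold Y; lra). assert (HYD : 2 * INR D <= Y) by (unfold Y; lra).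
  split; [lra|].
  assert (HYL : c * INR L <= Y).
  { apply Rle_trans with Y0; [|unfold Y; lra]. unfold Y0, c, Rdiv. rewrite Rmult_comm.
    apply Rmult_le_compat_l; [lra|]. apply Rinv_le_contravar; nra. }
  (* The excess of the decay exponent n - 1 of the error over the exponent l - 1 of the main
     term. *)
  set (j := (n - 1 - L)%nat). assert (Hj2 : (2 <= j)%nat) by (unfold j, L; lia).
  assert (Hnj : (n - 1 = L + j)%nat) by (unfold j, L; lia).
  assert (HKr : 2 * X + 6 <= INR (l + n)).
  { apply Rle_trans with (INR K0); [lra|]. apply le_INR. lia. }
  assert (HX : 0 < X).
  { unfold X. apply Rdiv_lt_0_compat; auto. apply Rplus_lt_0_compat.
    - apply Rdiv_lt_0_compat; nra.
    - nra. }
  set (Q := INR (l + n) / 2 - 2). assert (HQ : X <= Q) by (unfold Q; lra).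
  assert (HYj : 0 < Y ^ j) by (apply pow_lt; lra).
  assert (HYLp : 0 < Y ^ L) by (apply pow_lt; lra).
  (* One factor Y is at least c L and cancels the numerator. The other j - 1 satisfy Y^(j-1) >= Y +
     (j-2) >= c Q, which covers large l and large n - l at once. *)
  assert (T1 : INR L / Y ^ j <= / (c * c) / Q).
  { assert (HYj1 : c * Q <= Y ^ (j - 1)).
    { destruct j as [|[|i]] eqn:Ej; [lia | lia |]. simpl Nat.sub.
      eapply Rle_trans; [|apply pow_ge_linear; auto].
      apply Rle_trans with (c * INR L + c * INR i).
      - assert (Q <= INR L + INR i); [|nra]. unfold Q.
        assert (Hi : (l + n = 2 * l + 2 + i)%nat) by lia.
        assert (INR (l + n) <= 2 * (INR L + INR i) + 4); [|lra].
        rewrite Hi, HlL, !plus_INR, mult_INR, !S_INR. simpl INR. pose proof (pos_INR i). lra.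
      - apply Rplus_le_compat; auto. rewrite <- (Rmult_1_l (INR i)) at 2. apply Rmult_le_compat_r;
        auto. apply pos_INR. }
    replace (Y ^ j) with (Y * Y ^ (j - 1)) by (replace j with (S (j - 1)) at 2 by lia; reflexivity).
    assert (0 < c * Q) by nra. assert (HcL : 0 < c * INR L) by nra.
    unfold Rdiv. rewrite <- Rinv_mult.
    apply Rle_trans with (INR L * / ((c * INR L) * (c * Q))).
    - apply Rmult_le_compat_l; [lra|]. apply Rinv_le_contravar; [nra|]. apply Rmult_le_compat; lra.
    - right. field. repeat split; lra. }
  (* Y >= 2D absorbs D^(l+1) and leaves 2^(-(n-1)), which outweighs the product of L and (l+n)/2. *)
  assert (T2 : INR D ^ S l * INR L / Y ^ (n - 1) <= 8 / Q).
  { assert (HDl : INR D ^ S l * 2 ^ (n - 1) <= Y ^ (n - 1)).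
    { apply Rle_trans with ((2 * INR D) ^ (n - 1)); [|apply pow_incr; lra].
      rewrite Rpow_mult_distr, Rmult_comm. apply Rmult_le_compat_l; [apply pow_le; lra|].
      apply Rle_pow; auto. lia. }
    assert (Hh : INR L * (INR (l + n) / 2) <= 4 * 2 ^ (n - 1)).
    { eapply Rle_trans; [|apply sq_le_pow2]. apply Rmult_le_compat; try lra.
      - apply le_INR. unfold L. lia.
      - assert (INR (l + n) <= INR (2 * (n - 1))) by (apply le_INR; lia).
        rewrite mult_INR in H. simpl (INR 2) in H. lra. }
    assert (H2n : 0 < 2 ^ (n - 1)) by (apply pow_lt; lra).
    assert (HYn : 0 < Y ^ (n - 1)) by (apply pow_lt; lra).
    assert (HQ' : Q <= INR (l + n) / 2) by (unfold Q; lra).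
    apply Rmult_le_reg_r with (Y ^ (n - 1) * Q); [nra|].
    replace (INR D ^ S l * INR L / Y ^ (n - 1) * (Y ^ (n - 1) * Q)) with (INR D ^ S l * (INR L *
      Q)) by (field; lra).
    replace (8 / Q * (Y ^ (n - 1) * Q)) with (8 * Y ^ (n - 1)) by (field; lra).
    assert (HDp : 0 < INR D ^ S l) by (apply pow_lt; lra).
    assert (INR L * Q <= 4 * 2 ^ (n - 1)) by nra.
    nra. }
  assert (HDl : 0 < INR D ^ l) by (apply pow_lt; lra).
  assert (Hfact : 0 < INR (fact L)) by (apply lt_0_INR, lt_O_fact).
  assert (Hexp : exp (2 * PI * (INR m * Y)) <= exp (INR L) * C1).
  { unfold C1. rewrite <- exp_plus.
    assert (E : 2 * PI * (INR m * Y) <= INR L + 4 * PI * INR Nmax * INR D).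
    { unfold Y, Y0. replace (2 * PI * (INR m * (INR L / (2 * PI * INR m) + 2 * INR D))) with
        (INR L + 4 * PI * INR m * INR D) by (field; lra).
      assert (4 * PI * INR m * INR D <= 4 * PI * INR Nmax * INR D); [|lra].
      apply Rmult_le_compat_r; [lra|]. apply Rmult_le_compat_l; lra. }
    destruct E as [E|E]; [left; apply exp_increasing; auto | rewrite E; lra]. }
  (* Stirling's bound together with L = 2 pi m Y0 <= 2 pi m Y: the factorial and the exponential are
     traded for powers of Y at the cost of 3 C1 L. *)
  assert (Hst : INR (fact L) * exp (2 * PI * (INR m * Y)) <= 3 * C1 * INR L * ((2 * PI * INR m) ^ L
    * Y ^ L)).
  { apply Rle_trans with (INR (fact L) * exp (INR L) * C1).
    - rewrite (Rmult_assoc (INR (fact L))). apply Rmult_le_compat_l; lra.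
    - pose proof (fact_exp_le L ltac:(unfold L; lia)) as HF.
      assert (HLL : INR L ^ L <= (2 * PI * INR m) ^ L * Y ^ L).
      { rewrite <- Rpow_mult_distr. apply pow_incr. split; [lra|].
        apply Rle_trans with (2 * PI * INR m * Y0); [right; unfold Y0; field; lra|].
        apply Rmult_le_compat_l; [lra | unfold Y; lra]. }
      apply Rle_trans with (3 * INR L * INR L ^ L * C1); [apply Rmult_le_compat_r; lra|].
      replace (3 * C1 * INR L * ((2 * PI * INR m) ^ L * Y ^ L)) with (3 * INR L * ((2 * PI * INR m)
        ^ L * Y ^ L) * C1) by ring.
      apply Rmult_le_compat_r; [lra|]. apply Rmult_le_compat_l; lra. }
  rewrite Cmod_Lconst. fold L. rewrite <- HlL.
  assert (Hpm : 0 < (2 * PI * INR m) ^ L) by (apply pow_lt; auto).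
  set (Em := exp (2 * PI * (INR m * Y))) in *.
  assert (HEm : 0 < Em) by apply exp_pos.
  assert (Eexp : exp (- (2 * PI * (INR m * Y))) = / Em) by (rewrite exp_Ropp; auto).
  rewrite Eexp.
  assert (Hmain : INR D ^ S l * (INR (fact L) * Em) * error_bound l n D Y <= delta * (2 * (2 * PI)
    * (2 * PI * INR m) ^ L)).
  { assert (Herr : 0 <= error_bound l n D Y).
    { unfold error_bound. apply Rplus_le_le_0_compat.
      - apply Rdiv_le_0_compat; [lra|]. apply pow_lt. nra.
      - apply Rmult_le_pos; apply Rdiv_le_0_compat; try lra; apply pow_lt; lra. }
    assert (HDs : 0 < INR D ^ S l) by (apply pow_lt; lra).
    apply Rle_trans with (INR D ^ S l * (3 * C1 * INR L * ((2 * PI * INR m) ^ L * Y ^ L)) *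
      error_bound l n D Y).
    { apply Rmult_le_compat_r; auto. apply Rmult_le_compat_l; [lra | auto]. }
    assert (Hrel : INR D ^ S l * (3 * C1 * INR L * Y ^ L) * error_bound l n D Y <= delta).
    { assert (Hsplit : INR D ^ S l * (3 * C1 * INR L * Y ^ L) * error_bound l n D Y <=
        48 * C1 * (INR L / Y ^ j) + 3 * (384 * 384) * C1 * (INR D ^ S l * INR L / Y ^ (n - 1))).
      { unfold error_bound. fold L. rewrite Rmult_plus_distr_l. apply Rplus_le_compat.
        - rewrite Rpow_mult_distr.
          assert (HDn : 0 < INR D ^ (n - 1)) by (apply pow_lt; lra).
          assert (HDD : INR D ^ S l <= INR D ^ (n - 1)) by (apply Rle_pow; auto; lia).
          rewrite Hnj at 2. rewrite (pow_add Y).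
          replace (INR D ^ S l * (3 * C1 * INR L * Y ^ L) * (16 / (INR D ^ (n - 1) * (Y ^ L * Y ^
            j)))) with
            (48 * C1 * (INR L / Y ^ j) * (INR D ^ S l / INR D ^ (n - 1))) by (field; lra).
          rewrite <- (Rmult_1_r (48 * C1 * (INR L / Y ^ j))) at 2. apply Rmult_le_compat_l.
          + apply Rmult_le_pos; [lra|]. apply Rdiv_le_0_compat; lra.
          + apply Rmult_le_reg_r with (INR D ^ (n - 1)); auto. field_simplify; lra.
        - right. field. split; [|lra]. apply pow_nonzero. lra. }
      eapply Rle_trans; [apply Hsplit|].
      apply Rle_trans with (48 * C1 * (/ (c * c) / Q) + 3 * (384 * 384) * C1 * (8 / Q)).
      { apply Rplus_le_compat; apply Rmult_le_compat_l; auto; lra. }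
      replace (48 * C1 * (/ (c * c) / Q) + 3 * (384 * 384) * C1 * (8 / Q)) with (delta * (X / Q)).
      - rewrite <- (Rmult_1_r delta) at 2. apply Rmult_le_compat_l; [lra|].
        apply Rmult_le_reg_r with Q; [lra|]. field_simplify; lra.
      - unfold X. field. repeat split; lra. }
    replace (INR D ^ S l * (3 * C1 * INR L * ((2 * PI * INR m) ^ L * Y ^ L)) * error_bound l n D Y) with
      ((INR D ^ S l * (3 * C1 * INR L * Y ^ L) * error_bound l n D Y) * (2 * PI * INR m) ^ L) by ring.
    apply Rle_trans with (delta * (2 * PI * INR m) ^ L); [apply Rmult_le_compat_r; lra|].
    apply Rmult_le_compat_l; [lra|]. rewrite <- (Rmult_1_l ((2 * PI * INR m) ^ L)) at 1.
    apply Rmult_le_compat_r; lra. }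
  apply Rmult_le_reg_r with (INR D ^ l * (INR (fact L) * Em)); [repeat apply Rmult_lt_0_compat; auto|].
  replace (INR D * error_bound l n D Y * (INR D ^ l * (INR (fact L) * Em))) with
    (INR D ^ S l * (INR (fact L) * Em) * error_bound l n D Y) by (simpl pow; ring).
  eapply Rle_trans; [apply Hmain|]. right.
  assert (HP : (2 * PI) ^ l = 2 * PI * (2 * PI) ^ L) by (rewrite HlL; reflexivity).
  rewrite HP, (Rpow_mult_distr (2 * PI) (INR m)). clearbody Em. field. repeat split; lra.
Qed.

(** * Linear independence *)

Lemma sum_n_m_lsum (f : nat -> C) n : sum_n_m (G := C_AbelianMonoid) f 1 n = lsum f (seq 1 n).
Proof.
  induction n as [|n IH].
  - exact (sum_n_m_zero (G := C_AbelianMonoid) f 1 0 (le_n 1)).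
  - rewrite sum_n_Sm, seq_S, lsum_app, IH by lia. simpl. change plus with Cplus. ring.
Qed.

Lemma chi_inv_mod D chi r : (0 < D)%nat -> dirichlet_char D chi -> Z.gcd r (Z.of_nat D) = 1%Z ->
  (chi r * chi (inv_mod D r))%C = RtoC 1.
Proof.
  intros HD Hchi Hr. destruct (inv_mod_spec D r HD Hr) as [_ Hi].
  rewrite <- (dc_mul _ _ Hchi), <- (chi_1 D chi Hchi). apply (chi_congr D chi HD Hchi). auto.
Qed.

Lemma gcd_inv_mod D r : (0 < D)%nat -> Z.gcd r (Z.of_nat D) = 1%Z -> Z.gcd (inv_mod D r) (Z.of_nat
  D) = 1%Z.
Proof.
  intros HD Hr. destruct (inv_mod_spec D r HD Hr) as [_ Hi]. apply gcd_of_inverse with r.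
  rewrite Z.mul_comm. auto.
Qed.

(** Reindexing by the inverse modulo D turns the sum into the one that defines chi_hat(m). The map
    [h] is the identity on non-units, so that it permutes all residues; both sides contribute 0
    there. *)
Lemma inverse_sum D chi (m : nat) : (0 < D)%nat -> dirichlet_char D chi ->
  lsum (fun r => (if (Z.gcd (Z.of_nat r) (Z.of_nat D) =? 1)%Z then chi (inv_mod D (Z.of_nat r))
    else RtoC 0) *
    qpar (RtoC (- (INR m * IZR (inv_mod D (Z.of_nat r)) / INR D))))%C (seq 0 D)
  = (RtoC (INR D) * chi_hat D chi (Z.of_nat m))%C.
Proof.
  intros HD Hchi. assert (HDR : 0 < INR D) by (apply lt_0_INR; auto). pose proof (INR_C_nz D HD) as HDz.
  set (h := fun r : nat => if (Z.gcd (Z.of_nat r) (Z.of_nat D) =? 1)%Z then Z.to_nat (inv_mod D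
    (Z.of_nat r)) else r).
  assert (Hh : forall r, Z.gcd (Z.of_nat r) (Z.of_nat D) = 1%Z -> Z.of_nat (h r) = inv_mod D
    (Z.of_nat r)).
  { intros r Hr. unfold h. rewrite Hr. cbn [Z.eqb Pos.eqb]. destruct (inv_mod_spec D _ HD Hr). lia. }
  assert (Hh' : forall r, Z.gcd (Z.of_nat r) (Z.of_nat D) <> 1%Z -> h r = r).
  { intros r Hr. unfold h. destruct (Z.eqb_spec (Z.gcd (Z.of_nat r) (Z.of_nat D)) 1); tauto. }
  transitivity (lsum (fun b => chi (Z.of_nat b) * qpar (RtoC (- (IZR (Z.of_nat b) * IZR (Z.of_nat
    m) / INR D))))%C (seq 0 D)).
  2: { unfold chi_hat. field. auto. }
  rewrite <- (lsum_residues (fun b => chi (Z.of_nat b) * qpar (RtoC (- (IZR (Z.of_nat b) * IZR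
    (Z.of_nat m) / INR D))))%C h D).
  - apply lsum_ext. intros r _. destruct (Z.eqb_spec (Z.gcd (Z.of_nat r) (Z.of_nat D)) 1) as [Hr|Hr].
    + rewrite (Hh r Hr). f_equal. f_equal. f_equal. rewrite <- INR_IZR_INZ. unfold Rdiv. ring.
    + rewrite (Hh' r Hr).
      assert (E : chi (Z.of_nat r) = RtoC 0).
      { destruct (excluded_middle_informative (chi (Z.of_nat r) = RtoC 0)) as [|Hne]; auto.
        exfalso. apply Hr. apply (dc_unit _ _ Hchi). auto. }
      rewrite E. ring.
  - intros r Hr. destruct (Z.eq_dec (Z.gcd (Z.of_nat r) (Z.of_nat D)) 1) as [Hg|Hg].
    + specialize (Hh r Hg). destruct (inv_mod_spec D _ HD Hg). lia.
    + rewrite Hh'; auto.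
  - intros a b Ha Hb E.
    assert (P : forall a b, (a < D)%nat -> (b < D)%nat -> h a = h b -> Z.gcd (Z.of_nat a) (Z.of_nat
      D) = 1%Z ->
      Z.gcd (Z.of_nat b) (Z.of_nat D) = 1%Z).
    { intros x y Hx Hy Exy Hg. destruct (Z.eq_dec (Z.gcd (Z.of_nat y) (Z.of_nat D)) 1) as [|Hgy]; auto.
      rewrite <- (Hh' y Hgy), <- Exy, (Hh x Hg). apply gcd_inv_mod; auto. }
    destruct (Z.eq_dec (Z.gcd (Z.of_nat a) (Z.of_nat D)) 1) as [Hga|Hga].
    + pose proof (P a b Ha Hb E Hga) as Hgb.
      destruct (inv_mod_spec D _ HD Hga) as [_ Ia]. destruct (inv_mod_spec D _ HD Hgb) as [_ Ib].
      apply (f_equal Z.of_nat) in E. rewrite (Hh a Hga), (Hh b Hgb) in E. rewrite <- E in Ib.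
      assert (Hd : (Z.of_nat D | Z.of_nat a - Z.of_nat b)%Z).
      { apply Gauss with (inv_mod D (Z.of_nat a)).
        - replace (inv_mod D (Z.of_nat a) * (Z.of_nat a - Z.of_nat b))%Z with
            ((Z.of_nat a * inv_mod D (Z.of_nat a) - 1) - (Z.of_nat b * inv_mod D (Z.of_nat a) -
              1))%Z by ring.
          apply Z.divide_sub_r; auto.
        - apply rel_prime_sym, Zgcd_1_rel_prime, gcd_inv_mod; auto. }
      destruct Hd as [q Hq]. assert (- Z.of_nat D < q * Z.of_nat D < Z.of_nat D)%Z by lia.
      assert (q = 0)%Z by nia. subst q. lia.
    + rewrite <- (Hh' a Hga), <- (Hh' b); auto. intros Hgb. apply Hga. apply (P b a); auto.
Qed.

Section Orthogonality.
Context (N : nat) (lam mu : nat -> C) (n : nat).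
Context (HN : (0 < N)%nat).
Context (Hroot : forall i, (1 <= i <= n)%nat -> (lam i ^ N)%C = RtoC 1).
Context (Hinv : forall i, (1 <= i <= n)%nat -> (lam i * mu i)%C = RtoC 1).
Context (Hdist : forall i j, (1 <= i <= n)%nat -> (1 <= j <= n)%nat -> i <> j -> lam i <> lam j).

Lemma root_orthogonality i k : (1 <= i <= n)%nat -> (1 <= k <= n)%nat ->
  lsum (fun j => lam k ^ j * mu i ^ j)%C (seq 0 N) = if (i =? k)%nat then RtoC (INR N) else RtoC 0.
Proof.
  intros Hi Hk. rewrite (lsum_ext _ (fun j => (lam k * mu i) ^ j)%C) by (intros;
    rewrite Cpow_mult_l; auto).
  destruct (Nat.eqb_spec i k) as [->|Hne].
  - rewrite Hinv by auto. rewrite (lsum_ext _ (fun _ => RtoC 1)) by (intros; apply Cpow_1_l).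
    rewrite lsum_const, length_seq. ring.
  - pose proof (geom_sum (lam k * mu i)%C N) as G0.
    assert (Hmu : (mu i ^ N)%C = RtoC 1).
    { transitivity (lam i ^ N * mu i ^ N)%C; [rewrite (Hroot i Hi); ring|].
      rewrite <- Cpow_mult_l, Hinv by auto. apply Cpow_1_l. }
    rewrite Cpow_mult_l, (Hroot k Hk), Hmu in G0.
    apply Cmult_reg_l with (1 - lam k * mu i)%C.
    + intros E. apply (Hdist k i Hk Hi); auto.
      transitivity (lam k * (lam i * mu i))%C; [rewrite (Hinv i Hi); ring|].
      transitivity (lam i * (1 - (1 - lam k * mu i)))%C; [ring | rewrite E; ring].
    + rewrite G0. ring.
Qed.

Lemma orthogonality_recover (gam : nat -> C) k : (1 <= k <= n)%nat ->
  lsum (fun j => lam k ^ j * lsum (fun i => gam i * mu i ^ j) (seq 1 n))%C (seq 0 N) = (RtoC (INR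
    N) * gam k)%C.
Proof.
  intros Hk.
  rewrite (lsum_ext _ (fun j => lsum (fun i => gam i * (lam k ^ j * mu i ^ j)) (seq 1 n))%C).
  - rewrite lsum_swap.
    rewrite (lsum_ext _ (fun i => gam i * (if (i =? k)%nat then RtoC (INR N) else RtoC 0))%C).
    + rewrite (lsum_single _ k).
      * rewrite Nat.eqb_refl. ring.
      * apply seq_NoDup.
      * apply in_seq. lia.
      * intros i _ Hik. destruct (Nat.eqb_spec i k); [congruence | ring].
    + intros i Hi. apply in_seq in Hi. rewrite lsum_scal, root_orthogonality by lia. reflexivity.
  - intros j _. rewrite <- lsum_scal. apply lsum_ext. intros i _. ring.
Qed.

(* Distinct N-th roots of unity are at most N in number: compare the sum over j of
   |sum_i lambda_i^j|^2, which is N n, with its term at j = 0. *)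
Lemma roots_le : (forall i, (1 <= i <= n)%nat -> Cmod (lam i) = 1) -> (n <= N)%nat.
Proof.
  intros Hmod. destruct (Nat.eq_dec n 0) as [->|Hn0]; [lia|].
  assert (Hmu : forall i, (1 <= i <= n)%nat -> mu i = Cconj (lam i)).
  { intros i Hi. pose proof (Cmod2_conj (lam i)) as E. rewrite Hmod in E by auto.
    replace (RtoC (1 ^ 2)) with (RtoC 1) in E by (f_equal; ring).
    apply Cmult_reg_l with (lam i).
    - apply Cmod_gt_0. rewrite Hmod by auto. lra.
    - rewrite Hinv by auto. exact E. }
  set (x := fun j : nat => lsum (fun i => lam i ^ j)%C (seq 1 n)).
  assert (Hx : forall j, lsum (fun i => mu i ^ j)%C (seq 1 n) = Cconj (x j)).
  { intros j. unfold x. assert (H : forall l, (forall i, In i l -> (1 <= i <= n)%nat) ->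
      lsum (fun i => mu i ^ j)%C l = Cconj (lsum (fun i => lam i ^ j)%C l)).
    { induction l as [|i l IH]; intros Hl; simpl.
      - unfold Cconj, RtoC; simpl. f_equal. ring.
      - rewrite IH by (intros; apply Hl; right; auto). rewrite Hmu by (apply Hl; left; auto).
        rewrite <- Cpow_conj. unfold Cconj, Cplus; simpl. f_equal. ring. }
    apply H. intros i Hi. apply in_seq in Hi. lia. }
  assert (S1 : lsum (fun j => x j * Cconj (x j))%C (seq 0 N) = RtoC (INR n * INR N)).
  { rewrite (lsum_ext _ (fun j => lsum (fun k => lam k ^ j * lsum (fun i => RtoC 1 * mu i ^ j) (seq
    1 n)) (seq 1 n))%C).
    - rewrite lsum_swap.
      rewrite (lsum_ext _ (fun _ => RtoC (INR N))).
      + rewrite lsum_const, length_seq, <- RtoC_mult. reflexivity.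
      + intros k Hk. apply in_seq in Hk.
        rewrite (orthogonality_recover (fun _ => RtoC 1) k) by lia. ring.
    - intros j _. rewrite <- Hx. unfold x. rewrite Cmult_comm, <- lsum_scal. apply lsum_ext. intros k _.
      rewrite Cmult_comm. f_equal. apply lsum_ext. intros; ring. }
  assert (S2 : lsum (fun j => x j * Cconj (x j))%C (seq 0 N) = RtoC (rsum (fun j => Cmod (x j) ^ 2)
    (seq 0 N))).
  { generalize (seq 0 N). induction l as [|j l IH]; simpl lsum; simpl rsum; [reflexivity|].
    rewrite IH, RtoC_plus, <- Cmod2_conj. reflexivity. }
  rewrite S2 in S1. apply RtoC_inj in S1.
  assert (Hx0 : Cmod (x 0%nat) = INR n).
  { unfold x. rewrite (lsum_ext _ (fun _ => RtoC 1)) by reflexivity.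
    rewrite lsum_const, length_seq, Cmult_1_r. apply Cmod_INR. }
  destruct N as [|N']; [lia|]. cbn [seq rsum] in S1. rewrite Hx0 in S1.
  assert (H0 : 0 <= rsum (fun j => Cmod (x j) ^ 2) (seq 1 N')) by (apply rsum_nonneg; intros;
    apply pow2_ge_0).
  assert (Hnp : 0 < INR n) by (apply lt_0_INR; lia).
  apply INR_le. apply Rmult_le_reg_l with (INR n); auto.
  replace (INR n * INR n) with (INR n ^ 2) by ring. lra.
Qed.

End Orthogonality.

Theorem theorem1p3 (D : nat) (hD1 : (1 <= D)%nat) (hDodd : Nat.Odd D)
    (hDsf : squarefree D) :
  exists K0 : nat,
  forall K : nat, Nat.Even K -> (K0 <= K)%nat ->
  forall (ell n : nat) (chi : nat -> Z -> C),
    (3 <= ell)%nat -> (ell <= (K - 2) / 2)%nat ->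
    (forall i : nat, (1 <= i <= n)%nat -> primitive_char D (chi i)) ->
    (forall i : nat, (1 <= i <= n)%nat ->
       chi i (-1)%Z = Cpow (Copp (RtoC 1)) ell) ->
    (forall i j : nat, (1 <= i <= n)%nat -> (1 <= j <= n)%nat -> i <> j ->
       chi i 2%Z <> chi j 2%Z) ->
    lin_indep n
      (fun (i : nat) (f : cusp_form K) => twisted_period (ell - 1) (chi i) f).
Proof.
  assert (HD : (0 < D)%nat) by lia.
  assert (H2 : Z.gcd 2 (Z.of_nat D) = 1%Z).
  { destruct hDodd as [d Hd]. apply Zgcd_1_rel_prime, bezout_rel_prime.
    apply Bezout_intro with (- Z.of_nat d)%Z 1%Z. lia. }
  destruct (pow_eq_1_mod 2 D HD H2) as [N [HN HN2]].
  assert (HNR : 1 <= INR N) by (replace 1 with (INR 1) by reflexivity; apply le_INR; auto).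
  (* The range 2^N covers m = 2^j for j < N, and the accuracy 1/(2N) makes a sum over at most N
     indices gain a factor 1/2 at the end. Both depend on D only, hence so does [K0]. *)
  destruct (error_bound_small (2 ^ N) D (/ (2 * INR N))) as [K0 HK0]; auto.
  { apply Nat.neq_0_lt_0. apply Nat.pow_nonzero. lia. }
  { apply Rinv_0_lt_compat. lra. }
  exists K0. intros K HKe HK ell n chi Hl Hl2 Hprim _ Hdist c Hc.
  assert (HlK : (2 * ell + 2 <= K)%nat).
  { pose proof (Nat.div_mod_eq (K - 2) 2) as E.
    pose proof (Nat.mod_upper_bound (K - 2) 2 ltac:(lia)). lia. }
  set (k := (K - ell)%nat). assert (EK : K = (ell + k)%nat) by (unfold k; lia).
  assert (Hk : (ell + 2 <= k)%nat) by (unfold k; lia). clearbody k. subst K.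
  destruct (kernel_form_twisted_period ell k D Hl ltac:(lia) HD) as [b [Hb Hper]].
  set (ps := fun i => chi_hat D (chi i)).
  set (Cr := fun r : nat => lsum (fun i => c i * ps i (Z.of_nat r))%C (seq 1 n)).
  (* The unknowns are rescaled by chi_hat_i(1), the common factor of chi_hat_i(r) at all units r;
     every weight [Cr r] is then bounded by [B]. *)
  set (bet := fun i => (c i * ps i 1%Z)%C).
  set (B := rsum (fun i => Cmod (bet i)) (seq 1 n)).
  assert (Hin : forall i, In i (seq 1 n) -> (1 <= i <= n)%nat) by (intros i Hi; apply in_seq in Hi; lia).
  assert (Hch : forall i, (1 <= i <= n)%nat -> dirichlet_char D (chi i)) by (intros i Hi;
    apply (Hprim i Hi)).
  assert (Hcps : forall i r, (1 <= i <= n)%nat -> (c i * ps i (Z.of_nat r))%C =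
    (bet i * (if (Z.gcd (Z.of_nat r) (Z.of_nat D) =? 1)%Z then chi i (inv_mod D (Z.of_nat r)) else
      RtoC 0))%C).
  { intros i r Hi. unfold bet, ps. destruct (Z.eqb_spec (Z.gcd (Z.of_nat r) (Z.of_nat D)) 1) as [Hr|Hr].
    - rewrite (chi_hat_unit D (chi i) _ HD (Hch i Hi) Hr). ring.
    - rewrite chi_hat_primitive by auto. ring. }
  assert (HCr0 : forall r, Z.gcd (Z.of_nat r) (Z.of_nat D) <> 1%Z -> Cr r = RtoC 0).
  { intros r Hr. unfold Cr. apply lsum_zero. intros i Hi. unfold ps.
    rewrite chi_hat_primitive by auto. ring. }
  assert (HCrB : forall r, (r < D)%nat -> Cmod (Cr r) <= B).
  { intros r _. unfold Cr, B. eapply Rle_trans; [apply Cmod_lsum|]. apply rsum_le. intros i Hi.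
    rewrite Hcps, Cmod_mult by auto. rewrite <- (Rmult_1_r (Cmod (bet i))) at 2.
    apply Rmult_le_compat_l; [apply Cmod_ge_0|].
    destruct (Z.eqb_spec (Z.gcd (Z.of_nat r) (Z.of_nat D)) 1) as [Hr|Hr]; [|rewrite Cmod_0; lra].
    rewrite (Cmod_chi D (chi i) HD); [lra | auto | apply gcd_inv_mod; auto]. }
  (* The relation is tested on the form attached to tau and the common nonzero factor b D^k is
     cancelled. *)
  assert (HR : forall tau, 0 < Im tau -> lsum (fun r => Cr r * Sum (period_term ell k tau r D))%C
    (seq 0 D) = RtoC 0).
  { intros tau Ht. destruct (kernel_cusp_form (ell + k) tau ltac:(lia) Ht) as [f Hf].
    specialize (Hc f). rewrite sum_n_m_lsum in Hc.
    set (S := fun r => Sum (period_term ell k tau r D)) in *.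
    assert (Hnz : (RtoC b * RtoC (INR D) ^ k)%C <> RtoC 0).
    { apply Cmult_neq_0; [intros E; apply RtoC_inj in E; lra | apply Cpow_nz, INR_C_nz; auto]. }
    apply Cmult_reg_l with (RtoC b * RtoC (INR D) ^ k)%C; auto. rewrite Cmult_0_r, <- Hc.
    rewrite (lsum_ext _ (fun i => (RtoC b * RtoC (INR D) ^ k) * lsum (fun r => c i * ps i (Z.of_nat
      r) * S r) (seq 0 D))%C (seq 1 n)).
    - rewrite lsum_scal, lsum_swap. f_equal. apply lsum_ext. intros r _. unfold Cr.
      rewrite Cmult_comm, <- lsum_scal. apply lsum_ext. intros i _. fold (S r). ring.
    - intros i Hi. rewrite (Hper tau f (chi i) (fun r => ps i (Z.of_nat r)) Ht Hf).
      +
        transitivity (RtoC b * RtoC (INR D) ^ k * (c i * lsum (fun r => ps i (Z.of_nat r) * S r)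
          (seq 0 D)))%C; [unfold S; ring|].
        f_equal. rewrite <- lsum_scal. apply lsum_ext. intros r _. ring.
      + intros j. apply chi_expansion; auto. }
  set (lam := fun i => chi i 2%Z). set (mu := fun i => chi i (inv_mod D 2)).
  assert (Hroot : forall i, (1 <= i <= n)%nat -> (lam i ^ N)%C = RtoC 1).
  { intros i Hi. unfold lam. rewrite <- (chi_pow D (chi i) HD (Hch i Hi)),
    <- (chi_1 D (chi i) (Hch i Hi)).
    apply (chi_congr D (chi i) HD (Hch i Hi)). auto. }
  assert (Hinv : forall i, (1 <= i <= n)%nat -> (lam i * mu i)%C = RtoC 1).
  { intros i Hi. apply chi_inv_mod; auto. }
  assert (HnN : (n <= N)%nat).
  { apply (roots_le N lam mu n); auto. intros i Hi. apply (Cmod_chi D (chi i) HD (Hch i Hi)); auto. }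
  (* A second factor chi_hat_i(1) appears because the sum over inverse residues is again a Fourier
     coefficient of chi_i, taken at 2^j. *)
  set (gam := fun i => (RtoC (INR D) * (bet i * ps i 1%Z))%C).
  assert (HA : forall j : nat, main_coef D Cr (2 ^ j) = lsum (fun i => gam i * mu i ^ j)%C (seq 1 n)).
  { intros j. unfold main_coef, Cr.
    rewrite (lsum_ext _ (fun r => lsum (fun i => bet i * ((if (Z.gcd (Z.of_nat r) (Z.of_nat D) =?
      1)%Z then chi i (inv_mod D (Z.of_nat r)) else RtoC 0) *
      qpar (RtoC (- (INR (2 ^ j) * IZR (inv_mod D (Z.of_nat r)) / INR D)))))%C (seq 1 n))).
    - rewrite lsum_swap. apply lsum_ext. intros i Hi. apply Hin in Hi. rewrite lsum_scal,
      inverse_sum by auto.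
      assert (Hg : Z.gcd (2 ^ Z.of_nat j) (Z.of_nat D) = 1%Z).
      { clear -H2. induction j as [|j IH]; [apply Z.gcd_1_l|].
        rewrite Nat2Z.inj_succ, Z.pow_succ_r by lia. apply Zgcd_1_rel_prime.
        apply rel_prime_sym, rel_prime_mult; apply rel_prime_sym, Zgcd_1_rel_prime; auto. }
      rewrite Nat2Z.inj_pow. change (Z.of_nat 2) with 2%Z.
        rewrite (chi_hat_unit D (chi i) _ HD (Hch i Hi) Hg).
      assert (E : chi i (inv_mod D (2 ^ Z.of_nat j)) = (mu i ^ j)%C).
      { pose proof (chi_inv_mod D (chi i) _ HD (Hch i Hi) Hg) as E1.
        rewrite (chi_pow D (chi i) HD (Hch i Hi)) in E1. fold (lam i) in E1.
        assert (E2 : (lam i ^ j * mu i ^ j)%C = RtoC 1) by (rewrite <- Cpow_mult_l, Hinv by auto;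
          apply Cpow_1_l).
        apply Cmult_reg_l with (lam i ^ j)%C; [|congruence].
        intros E0. rewrite E0, Cmult_0_l in E2. apply RtoC_inj in E2. lra. }
      rewrite E. unfold gam, ps. ring.
    - intros r _. rewrite Cmult_comm,
      <- lsum_scal. apply lsum_ext. intros i Hi. rewrite Hcps by auto. ring. }
  assert (HB0 : 0 <= B) by (apply rsum_nonneg; intros; apply Cmod_ge_0).
  assert (HAj : forall j, (j < N)%nat -> Cmod (main_coef D Cr (2 ^ j)) <= / (2 * INR N) * B).
  { intros j Hj.
    destruct (HK0 ell k (2 ^ j)%nat HK Hl Hk) as [Y [HY HE]].
    { split; [apply Nat.neq_0_lt_0, Nat.pow_nonzero; lia | apply Nat.pow_le_mono_r; lia]. }
    pose proof (coefficient_bound ell k D Y B Cr Hl ltac:(lia) HD HKe HY HCrB HCr0 HR (2 ^ j)%nat)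
      as HAb.
    set (X := INR (2 ^ j) ^ (ell - 1) * exp (- (2 * PI * (INR (2 ^ j) * Y))) * (2 * / INR D ^ ell *
      Cmod (Lconst (ell - 1)))) in *.
    assert (HX : 0 < X).
    { unfold X. apply Rmult_lt_0_compat; [apply Rmult_lt_0_compat|].
      - apply pow_lt, lt_0_INR, Nat.neq_0_lt_0, Nat.pow_nonzero. lia.
      - apply exp_pos.
      - apply Rmult_lt_0_compat; [apply Rmult_lt_0_compat; [lra|]|].
        + apply Rinv_0_lt_compat, pow_lt, lt_0_INR. auto.
        + rewrite Cmod_Lconst. apply Rdiv_lt_0_compat; [apply pow_lt; pose proof PI_RGT_0; lra|].
          apply lt_0_INR, lt_O_fact. }
    apply Rmult_le_reg_r with X; auto. eapply Rle_trans; [apply HAb|].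
    replace (INR D * B * error_bound ell k D Y) with (B * (INR D * error_bound ell k D Y)) by ring.
    replace (/ (2 * INR N) * B * X) with (B * (/ (2 * INR N) * X)) by ring.
    apply Rmult_le_compat_l; auto. }
  assert (Hbet : forall i, (1 <= i <= n)%nat -> Cmod (bet i) <= / (2 * INR N) * B).
  { intros i Hi.
    (* The second factor is removed by D |chi_hat_i(1)| >= 1. *)
    assert (Hgam : Cmod (bet i) <= Cmod (gam i)).
    { unfold gam. rewrite !Cmod_mult, Cmod_INR.
      pose proof (chi_hat_1_lower D (chi i) HD hDsf (Hprim i Hi)) as Hp. fold (ps i) in Hp.
      pose proof (Cmod_ge_0 (bet i)). nra. }
    pose proof (orthogonality_recover N lam mu n HN Hroot Hinv Hdist gam i Hi) as Hrec.
    apply (f_equal Cmod) in Hrec. rewrite Cmod_mult, Cmod_INR in Hrec.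
    assert (Hs : INR N * Cmod (gam i) <= INR N * (/ (2 * INR N) * B)).
    { rewrite <- Hrec. eapply Rle_trans; [apply Cmod_lsum|].
      replace (INR N * (/ (2 * INR N) * B)) with (rsum (fun _ : nat => / (2 * INR N) * B) (seq 0 N))
        by (rewrite rsum_const, length_seq; reflexivity).
      apply rsum_le. intros j Hj. apply in_seq in Hj. rewrite <- HA, Cmod_mult, Cmod_pow.
      unfold lam. rewrite (Cmod_chi D (chi i) HD (Hch i Hi)) by auto. rewrite pow1,
        Rmult_1_l. apply HAj. lia. }
    apply Rmult_le_reg_l in Hs; lra. }
  (* There are at most N characters, their values at 2 being distinct N-th roots of unity; summing
     the bounds gives B <= B/2. *)
  assert (HB : B = 0).
  { assert (B <= INR n * (/ (2 * INR N) * B)).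
    { unfold B at 1. eapply Rle_trans; [apply rsum_le; intros i Hi; apply Hbet; auto|].
      rewrite rsum_const, length_seq. lra. }
    assert (Hn2 : INR n * (/ (2 * INR N) * B) <= INR N * (/ (2 * INR N) * B)).
    { apply Rmult_le_compat_r; [|apply le_INR; auto]. apply Rmult_le_pos; auto.
      left. apply Rinv_0_lt_compat. lra. }
    replace (INR N * (/ (2 * INR N) * B)) with (B / 2) in Hn2 by (field; lra). lra. }
  intros i Hi. specialize (Hbet i Hi). rewrite HB, Rmult_0_r in Hbet.
  assert (E : bet i = RtoC 0) by (apply Cmod_eq_0; pose proof (Cmod_ge_0 (bet i)); lra).
  pose proof (chi_hat_1_lower D (chi i) HD hDsf (Hprim i Hi)) as Hp. fold (ps i) in Hp.
  assert (Hpz : ps i 1%Z <> RtoC 0).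
  { intros E0. rewrite E0, Cmod_0, Rmult_0_r in Hp. lra. }
  apply Cmult_reg_l with (ps i 1%Z); auto. rewrite Cmult_0_r, Cmult_comm. exact E.
Qed.
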